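(* Let $(q_k,p_{k1},p_{k2})_{k\ge2}$ be real numbers with $q_k>0$, $p_{k1}\ge0$, $p_{k2}>0$ and $q_k+p_{k1}+p_{k2}=1$ for all $k\ge2$. Let $X$ and $Y$ be the (2,1) and (1,2) random walks defined in the context, and let $Z\in\{X,Y\}$. Suppose that $a_k\to a$ and $b_k\to b$ as $k\to\infty$ for some numbers $a>0$, $b>0$, that $a+b=1$, and that there exists $N_0>0$ such that $\varrho_k$ is increasing in $k\ge N_0$ when $Z=X$, and decreasing in $k\ge N_0$ when $Z=Y$. (1) If $\sum_{n=2}^\infty \frac{1}{D_Z(n)\log n}<\infty$, then almost surely $Z$ has at most finitely many cutpoints. (2) If there exists $\delta>0$ such that $D_Z(n)\le \delta n\log n$ for all $n$ large enough and $\sum_{n=2}^\infty \frac{1}{D_Z(n)\log n}=\infty$, then almost surely $Z$ has infinitely many cutpoints.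
   Context: $\mathbb Z_+=\{0,1,2,\dots\}$. The (2,1) random walk $X=(X_k)_{k\ge0}$ is the Markov chain on $\mathbb Z_+$ with $X_0=2$ and transition probabilities $P(X_{k+1}=1\mid X_k=0)=P(X_{k+1}=2\mid X_k=1)=1$ and, for $n\ge2$, $P(X_{k+1}=n+1\mid X_k=n)=q_n$, $P(X_{k+1}=n-1\mid X_k=n)=p_{n1}$, $P(X_{k+1}=n-2\mid X_k=n)=p_{n2}$. The (1,2) random walk $Y=(Y_k)_{k\ge0}$ is the Markov chain on $\mathbb Z_+$ with $Y_0=2$ and transition probabilities $P(Y_{k+1}=0\mid Y_k=1)=P(Y_{k+1}=2\mid Y_k=0)=1$ and, for $n\ge2$, $P(Y_{k+1}=n-1\mid Y_k=n)=q_n$, $P(Y_{k+1}=n+1\mid Y_k=n)=p_{n1}$, $P(Y_{k+1}=n+2\mid Y_k=n)=p_{n2}$. For $k\ge2$ set $a_k=(p_{k1}+p_{k2})/q_k$, $b_k=p_{k2}/q_k$ and $\varrho_k=\frac{a_k+\sqrt{a_k^2+4b_k}}{2}$. For $n\ge2$, $D_X(n)=1+\sum_{j=n+1}^\infty\prod_{i=n+1}^j\varrho_i$ and $D_Y(n)=1+\sum_{j=n+1}^\infty\prod_{i=n+1}^j\varrho_i^{-1}$. A site $k$ is a cutpoint of $X$ if $\#\{n\ge0:X_n=k\}=1$; a site $k$ is a cutpoint of $Y$ if $\#\{n\ge0:Y_n=k\}=0$. *)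

(* Defs.v *)
From HB Require Import structures.
From mathcomp Require Import all_boot all_order all_algebra.
From mathcomp Require Import all_classical all_reals all_analysis.
Set Implicit Arguments. Unset Strict Implicit. Unset Printing Implicit Defensive.
Import Order.TTheory GRing.Theory Num.Theory.
Import numFieldNormedType.Exports.
Local Open Scope classical_set_scope.
Local Open Scope ring_scope.

Section Defs.
Variable R : realType.
Variables (q p1 p2 : nat -> R).

Definition transX (m n : nat) : R :=
  if m == 0%N then (n == 1%N)%:R
  else if m == 1%N then (n == 2%N)%:R
  else if n == m.+1 then q m
  else if n == (m - 1)%N then p1 m
  else if n == (m - 2)%N then p2 m
  else 0.

Definition transY (m n : nat) : R :=
  if m == 1%N then (n == 0%N)%:R
  else if m == 0%N then (n == 2%N)%:R
  else if n == (m - 1)%N then q m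
  else if n == m.+1 then p1 m
  else if n == m.+2 then p2 m
  else 0.

Definition ak (k : nat) : R := (p1 k + p2 k) / q k.
Definition bk (k : nat) : R := p2 k / q k.
Definition rho (k : nat) : R := (ak k + Num.sqrt (ak k ^+ 2 + 4 * bk k)) / 2.

Definition DX (n : nat) : \bar R :=
  (1%:E + \sum_(n.+1 <= j <oo) (\prod_(n.+1 <= i < j.+1) rho i)%:E)%E.
Definition DY (n : nat) : \bar R :=
  (1%:E + \sum_(n.+1 <= j <oo) (\prod_(n.+1 <= i < j.+1) (rho i)^-1)%:E)%E.
End Defs.

(* 1/x for an extended real x >= 1, with 1/(+oo) = 0 *)
Definition einv {R : realType} (x : \bar R) : R :=
  match x with EFin r => r^-1 | _ => 0 end.

Definition is_markov_chain {d : measure_display} {T : measurableType d}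
  {R : realType} (P : probability T R) (Z : nat -> T -> nat) (x0 : nat)
  (trans : nat -> nat -> R) : Prop :=
  (forall n k, measurable [set w | Z n w = k]) /\
  forall (n : nat) (x : nat -> nat),
    P [set w | forall i, (i <= n)%N -> Z i w = x i] =
    ((x 0%N == x0)%:R * \prod_(i < n) trans (x i) (x i.+1))%:E.

Definition cutpointX {T : Type} (Z : nat -> T -> nat) (w : T) (k : nat) : Prop :=
  exists! n : nat, Z n w = k.
Definition cutpointY {T : Type} (Z : nat -> T -> nat) (w : T) (k : nat) : Prop :=
  forall n : nat, Z n w <> k.

(* Main.v *)
Require Import Defs.
From HB Require Import structures.
From mathcomp Require Import all_boot all_order all_algebra.
From mathcomp Require Import all_classical all_reals all_analysis.
From mathcomp Require Import zify ring lra.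
Import Order.TTheory GRing.Theory Num.Theory.
Import numFieldNormedType.Exports.
Local Open Scope classical_set_scope.
Local Open Scope ring_scope.

Set Implicit Arguments. Unset Strict Implicit. Unset Printing Implicit Defensive.

(* Let r_i be rho_i for X and 1 / rho_i for Y; under the hypotheses r is eventually
   nondecreasing with values in [1/2, 1].  Since rho_i ^ 2 = a_i rho_i + b_i, monotonicity
   makes the partial sums of the products r_n1 ... r_(j-1) superharmonic for the walk, and
   their shift by one index subharmonic.  Hence, up to constants, the walk at m + 1 never
   returns to [0, m] with probability 1 / D(m), and reaches n before [0, m] with
   probability 1 / D(m, n), where D(m, n) is the sum of the first n - m terms of D(m).

   A cutpoint m arises when the walk crosses the level m for the first time in the right
   way and then stays above m, so that, given that m is a cutpoint, past and future are
   independent.  Therefore P(m cut) is of order 1 / D(m), and P(m, n cut) is of order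
   1 / (D(m, n) D(n)) for m < n.

   (1) If m is the last cutpoint in a block (2b, 4b], the site n < m is a cutpoint with
   conditional probability at least c / (m - n), since D(n, m) <= m - n; so a nonempty
   block forces on average c ln b cutpoints in (b, 4b].  Hence P(block nonempty) is at
   most C * sum_(b < n <= 4b) 1 / (D(n) ln n), and Borel-Cantelli applies.

   (2) Let W be the sum of 1 / ln n over the cutpoints n in [M, N).  From
   D(m) = D(m, n) + (D(m, n+1) - D(m, n)) D(n) one gets
   D(m) / (D(m, n) D(n)) = 1 / D(n) + (D(m, n+1) - D(m, n)) / D(m, n), whose second part
   telescopes to at most 2 ln D(m) = O(ln m); so E W^2 <= C (E W)^2 once E W >= 1.  This
   holds conditionally on any past, with a uniform constant, so there is a cutpoint beyond
   M with conditional probability at least c, and a zero-one argument concludes. *)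

(** * Events on path space *)

(** Conditional probabilities never occur. An estimate bounds the mass of an event inside [F] by a
    constant times [pr F], for every [F] decided by time [t] on which the walk sits at a fixed
    state; such bounds add up over histories and over passage times.

    Being a cutpoint depends on the whole future. It is traded for a passage, decided at a finite
    time, followed by staying above the level. The exchange is a pathwise fact about unbounded paths
    that make only allowed steps, so these are shown to have full measure.

    X rises and Y falls by single steps only; reading [isX] as 0 or 1 in offsets such as [s + isX]
    treats both at once.

    With coefficients varying from site to site no explicit harmonic function is at hand, hence the
    pair of one-sided potentials. The relation a + b = 1 makes 1 the only possible limit of [rho],
    so that monotonicity puts the ratios on one side of 1.

    In the divergent case the weight 1 / ln m cancels the excess 2 ln D(m) of the correlations, once
    the growth bound on D has compared ln D(m) with ln m. *)

Definition past (t : nat) (B : set (nat -> nat)) : Prop :=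
  forall z z' : nat -> nat, (forall i, (i <= t)%N -> z i = z' i) -> B z -> B z'.

Definition cylinders : set (set (nat -> nat)) := [set B | exists t, past t B].

Definition paths := g_sigma_algebraType cylinders.

Definition shift (t : nat) (B : set (nat -> nat)) : set (nat -> nat) :=
  [set z | B (fun i => z (t + i)%N)].

Lemma pastW s t B : (s <= t)%N -> past s B -> past t B.
Proof.
by move=> st pB z z' zz'; apply: pB => i ?; apply: zz'; exact: leq_trans st.
Qed.

Lemma pastI t A B : past t A -> past t B -> past t (A `&` B).
Proof. by move=> pA pB z z' zz' [/(pA _ _ zz') ? /(pB _ _ zz')]. Qed.

Lemma pastC t A : past t A -> past t (~` A).
Proof.
move=> pA z z' zz' nA /(pA _ z) Az'; apply: nA; apply: Az' => i it.
by rewrite zz'.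
Qed.

Lemma pastU t A B : past t A -> past t B -> past t (A `|` B).
Proof. by move=> pA pB z z' zz' [/(pA _ _ zz') ?|/(pB _ _ zz') ?]; [left|right]. Qed.

Lemma past_coord t i (p : nat -> Prop) : (i <= t)%N -> past t [set z | p (z i)].
Proof. by move=> it z z' zz' /=; rewrite zz'. Qed.

Lemma past_measurable t B : past t B -> measurable (B : set paths).
Proof. by move=> pB; apply: sub_gen_smallest; exists t. Qed.

Lemma measurable_coord i (p : nat -> Prop) :
  measurable ([set z | p (z i)] : set paths).
Proof. by apply: (@past_measurable i); exact: past_coord. Qed.

Lemma measurable_const (p : Prop) : measurable ([set z | p] : set paths).
Proof. by apply: (@past_measurable 0). Qed.

Lemma measurable_and (A B : set paths) : measurable A -> measurable B ->
  measurable ([set z | A z /\ B z] : set paths).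
Proof. exact: measurableI. Qed.

Lemma measurable_or (A B : set paths) : measurable A -> measurable B ->
  measurable ([set z | A z \/ B z] : set paths).
Proof. exact: measurableU. Qed.

Lemma measurable_not (A : set paths) : measurable A ->
  measurable ([set z | ~ A z] : set paths).
Proof. exact: measurableC. Qed.

Lemma measurable_imp (A B : set paths) : measurable A -> measurable B ->
  measurable ([set z | A z -> B z] : set paths).
Proof.
move=> mA mB; rewrite (_ : mkset _ = ~` A `|` B); first by apply: measurableU => //; exact: measurableC.
apply/seteqP; split => z /=; have [Az|nAz] := pselect (A z).
- by move=> /(_ Az); right.
- by left.
- by case.
- by [].
Qed.

Lemma measurable_all (A : nat -> set paths) : (forall n, measurable (A n)) ->
  measurable ([set z | forall n, A n z] : set paths).
Proof.
move=> mA; rewrite (_ : mkset _ = \bigcap_n A n); first exact: bigcapT_measurable.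
by apply/seteqP; split => z /= zA n //; exact: zA.
Qed.

Lemma measurable_ex (A : nat -> set paths) : (forall n, measurable (A n)) ->
  measurable ([set z | exists n, A n z] : set paths).
Proof.
move=> mA; rewrite (_ : mkset _ = \bigcup_n A n); first exact: bigcupT_measurable.
by apply/seteqP; split => z /= [n]; [exists n|exists n].
Qed.

Lemma shift_measurable t (B : set paths) : measurable B ->
  measurable (shift t B : set paths).
Proof.
move: B; apply: smallest_sub; last first.
  move=> B [n pB]; apply: (@past_measurable (t + n)) => z z' zz'.
  by apply: pB => i it; apply: zz'; rewrite leq_add2l.
split.
- rewrite (_ : shift t set0 = set0); first exact: measurable0. by [].
- move=> A mA; rewrite setTD; exact: (@measurableC _ paths).
- move=> A mA. rewrite (_ : shift t _ = \bigcup_k shift t (A k)).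
    exact: (@bigcupT_measurable _ paths).
  by apply/seteqP; split => z [k _ ?]; exists k.
Qed.

Lemma measurable_eq i k : measurable ([set z | z i = k] : set paths).
Proof. exact: (measurable_coord i (fun x => x = k)). Qed.

Lemma measurable_le i k : measurable ([set z | (z i <= k)%N] : set paths).
Proof. exact: (measurable_coord i (fun x => x <= k)%N). Qed.

Lemma measurable_lt i k : measurable ([set z | (z i < k)%N] : set paths).
Proof. exact: (measurable_coord i (fun x => x < k)%N). Qed.

Lemma measurable_ge i k : measurable ([set z | (k <= z i)%N] : set paths).
Proof. exact: (measurable_coord i (fun x => k <= x)%N). Qed.

Ltac meas := repeat first
  [ assumption
  | match goal with
    | |- measurable _ => first [ exact: measurable_eq | exact: measurable_le
      | exact: measurable_lt | exact: measurable_ge | exact: measurable_const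
      | apply: measurable_and | apply: measurable_or | apply: measurable_not
      | apply: measurable_all => ? | apply: measurable_ex => ? | apply: measurable_imp
      | apply: shift_measurable | apply: measurableI | apply: measurableU
      | apply: measurableC | apply: measurableD ]
   end ].

(** * Real-valued probabilities and countable partitions *)

Section RealProbability.
Context {R : realType} (Q : probability paths R).
Implicit Types A B F V : set paths.

Definition pr A : R := fine (Q A).

Lemma prE A : measurable A -> Q A = (pr A)%:E.
Proof. by move=> mA; rewrite /pr fineK// fin_num_measure. Qed.

Lemma pr_ge0 A : 0 <= pr A.
Proof. by rewrite /pr fine_ge0. Qed.

Lemma pr_setT : pr setT = 1.
Proof. by rewrite /pr probability_setT. Qed.

Lemma pr_set0 : pr set0 = 0.
Proof. by rewrite /pr measure0. Qed.

Lemma pr_le A B : measurable A -> measurable B -> A `<=` B -> pr A <= pr B.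
Proof.
move=> mA mB AB; rewrite -lee_fin -!prE//.
by apply: le_measure => //; rewrite inE.
Qed.

Lemma pr_le1 A : measurable A -> pr A <= 1.
Proof. by move=> mA; rewrite -pr_setT; apply: pr_le. Qed.

Lemma pr_split A B : measurable A -> measurable B ->
  pr A = pr (A `&` B) + pr (A `&` ~` B).
Proof.
move=> mA mB; have mAB : measurable (A `&` B) by exact: measurableI.
have mAC : measurable (A `&` ~` B) by apply: measurableI => //; exact: measurableC.
apply: EFin_inj; rewrite EFinD -!prE// -measureU//.
- by rewrite -setIUr setUCr setIT.
- by rewrite setIACA setICr setI0.
Qed.

Lemma pr_setC A : measurable A -> pr (~` A) = 1 - pr A.
Proof.
move=> mA; rewrite -pr_setT (@pr_split setT A)// !setTI; lra.
Qed.

Lemma pr_setU_le A B : measurable A -> measurable B -> pr (A `|` B) <= pr A + pr B.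
Proof.
move=> mA mB; rewrite (@pr_split (A `|` B) A)//; last exact: measurableU.
rewrite setUK lerD2l; apply: pr_le => //.
  by apply: measurableI; [exact: measurableU|exact: measurableC].
by move=> z [[Az|//] nAz].
Qed.

Lemma pr_null_eq A B N : measurable A -> measurable B -> measurable N ->
  pr N = 0 -> (forall z, ~ N z -> A z -> B z) -> pr A <= pr B.
Proof.
move=> mA mB mN N0 AB; rewrite -[leRHS]addr0 -N0.
apply: le_trans (pr_setU_le mB mN); apply: pr_le => //.
  exact: measurableU.
by move=> z Az; have [Nz|nNz] := pselect (N z); [right|left; exact: AB].
Qed.

Lemma lee_prZ A B (c : R) : measurable A -> measurable B ->
  (c * pr B <= pr A -> (c%:E * Q B <= Q A)%E) /\
  (pr A <= c * pr B -> (Q A <= c%:E * Q B)%E).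
Proof. by move=> mA mB; rewrite !prE// -EFinM !lee_fin. Qed.

(** Takes the place of conditioning: a ratio bound proved on each cell of a countable family, such
    as the histories or the passage times of a level, adds up to the union. *)
Lemma pr_bigcup_le (E : nat -> set paths) V U (c : R) :
  0 <= c -> (forall i, measurable (E i)) -> trivIset setT E ->
  measurable V -> measurable U ->
  (forall i, pr (V `&` E i) <= c * pr (U `&` E i)) ->
  pr (V `&` \bigcup_i E i) <= c * pr (U `&` \bigcup_i E i).
Proof.
move=> c0 mE tE mV mU le.
have tI W : trivIset setT (fun i => W `&` E i) by exact: trivIset_setIl.
have mI W : measurable W -> forall i, measurable (W `&` E i).
  by move=> mW i; exact: measurableI.
have mIU W : measurable W -> measurable (W `&` \bigcup_i E i).
  by move=> mW; apply: measurableI => //; exact: bigcupT_measurable.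
rewrite -lee_fin EFinM -!prE//; try exact: mIU.
rewrite !setI_bigcupr !measure_bigcup//; try by move=> i _; exact: mI.
rewrite -nneseriesZl//; apply: lee_nneseries => // i _.
have H := (proj2 (lee_prZ c (mI V mV i) (mI U mU i)) (le i)). exact: H.
Qed.

Lemma pr_bigcup_ge (E : nat -> set paths) V U (c : R) :
  0 <= c -> (forall i, measurable (E i)) -> trivIset setT E ->
  measurable V -> measurable U ->
  (forall i, c * pr (U `&` E i) <= pr (V `&` E i)) ->
  c * pr (U `&` \bigcup_i E i) <= pr (V `&` \bigcup_i E i).
Proof.
move=> c0 mE tE mV mU le.
have tI W : trivIset setT (fun i => W `&` E i) by exact: trivIset_setIl.
have mI W : measurable W -> forall i, measurable (W `&` E i).
  by move=> mW i; exact: measurableI.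
have mIU W : measurable W -> measurable (W `&` \bigcup_i E i).
  by move=> mW; apply: measurableI => //; exact: bigcupT_measurable.
rewrite -lee_fin EFinM -!prE//; try exact: mIU.
rewrite !setI_bigcupr !measure_bigcup//; try by move=> i _; exact: mI.
rewrite -nneseriesZl//; apply: lee_nneseries => // i _.
  by rewrite mule_ge0.
exact: (proj1 (lee_prZ c (mI V mV i) (mI U mU i)) (le i)).
Qed.

Lemma pr_bigcup_lub (A : nat -> set paths) (c : R) :
  (forall n, measurable (A n)) -> (forall n, A n `<=` A n.+1) ->
  (forall n, pr (A n) <= c) -> pr (\bigcup_n A n) <= c.
Proof.
move=> mA ndA le; have mU : measurable (\bigcup_n A n) by exact: bigcupT_measurable.
rewrite -lee_fin -prE//.
have := @nondecreasing_cvg_mu _ _ _ Q A mA mU.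
move=> /(_ _)/cvg_lim <-//; last first.
  apply: homo_leq => [x|y x z|n]; first by rewrite subsetEset.
    by rewrite !subsetEset; exact: subset_trans.
  by rewrite subsetEset.
apply: lime_le.
  apply: cvgP; apply: nondecreasing_cvg_mu => //.
  apply: homo_leq => [x|y x z|n]; first by rewrite subsetEset.
    by rewrite !subsetEset; exact: subset_trans.
  by rewrite subsetEset.
by apply: nearW => n; rewrite /= prE// lee_fin.
Qed.

Lemma pr_bigcap_glb (A : nat -> set paths) (c : R) :
  (forall n, measurable (A n)) -> (forall n, A n.+1 `<=` A n) ->
  (forall n, c <= pr (A n)) -> c <= pr (\bigcap_n A n).
Proof.
move=> mA niA ge; have mI : measurable (\bigcap_n A n) by exact: bigcapT_measurable.
suff: pr (\bigcup_n ~` A n) <= 1 - c.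
  by rewrite -setC_bigcap pr_setC//; lra.
apply: pr_bigcup_lub => n.
- exact: measurableC.
- exact: subsetC.
- by rewrite pr_setC//; have := ge n; lra.
Qed.

Lemma pr_ord_partition A (f : paths -> nat) n : measurable A ->
  (forall y, measurable [set z | f z = y]) ->
  pr A = \sum_(y < n) pr (A `&` [set z | f z = y]) + pr (A `&` [set z | (n <= f z)%N]).
Proof.
move=> mA mf.
have mge k : measurable [set z | (k <= f z)%N].
  rewrite (_ : mkset _ = ~` \bigcup_(i in [set i | (i < k)%N]) [set z | f z = i]).
    by apply: measurableC; apply: bigcup_measurable.
  apply/seteqP; split => z /=.
    by move=> kf [i /= ik fi]; move: kf; rewrite fi leqNgt ik.
  by move=> nfi; rewrite leqNgt; apply/negP => fk; apply: nfi; exists (f z).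
elim: n => [|n IH].
  by rewrite big_ord0 add0r; congr pr; apply/seteqP; split => z //= [].
rewrite IH big_ord_recr/= -addrA; congr (_ + _).
have -> : A `&` [set z | f z = n] = A `&` [set z | (n <= f z)%N] `&` [set z | f z = n].
  apply/seteqP; split => z /=; last by case=> -[].
  by case=> Az <-.
rewrite (@pr_split (A `&` _) [set z | f z = n])//; last exact: measurableI.
congr (_ + _); congr pr; apply/seteqP; split => z /=.
  by case=> -[Az nf] /eqP fn; split=> //; rewrite ltn_neqAle eq_sym fn nf.
by case=> Az nf; split; [split => //; exact: ltnW|move=> fn; move: nf; rewrite fn ltnn].
Qed.

End RealProbability.

(** * Markov chains on the naturals *)

Lemma past_at t x : past t [set z | z t = x].
Proof. by move=> z z' zz' /=; rewrite zz'. Qed.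

Lemma past_next t F y : past t F -> past t.+1 (F `&` [set z : nat -> nat | z t.+1 = y]).
Proof. by move=> pF; apply: pastI; [exact: pastW pF|exact: past_at]. Qed.

(** Coding the path up to time [t] by one number turns the histories into a countable partition
    indexed by [nat]; a number that codes no such prefix gives an empty cell. *)
Definition history (t k : nat) : set paths :=
  [set z : nat -> nat | pickle (mkseq z t.+1) = k].

Lemma eq_history t k z z' : history t k z ->
  history t k z' <-> forall i, (i <= t)%N -> z' i = z i.
Proof.
rewrite /history /= => <-; split.
  move=> /(pcan_inj (@pickleK _)) e i it.
  by have := congr1 (nth 0%N ^~ i) e; rewrite !nth_mkseq.
move=> e; congr pickle; apply/eq_in_map => i; rewrite mem_iota => /andP[_ it].
exact: e.
Qed.

Lemma past_history t k : past t (history t k).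
Proof. by move=> z z' zz' hz; apply/(eq_history _ hz) => i it; rewrite zz'. Qed.

Lemma trivIset_history t : trivIset setT (history t).
Proof.
apply/trivIsetP => i j _ _ /eqP ij; apply/seteqP; split => // z [].
by rewrite /history /= => Ei Ej; apply: ij; rewrite -Ei -Ej.
Qed.

Lemma bigcup_history t : \bigcup_k history t k = setT.
Proof. by apply/seteqP; split => z // _; exists (pickle (mkseq z t.+1)). Qed.

Definition markov_paths {R : realType} (Q : probability paths R) (x0 : nat)
    (tr : nat -> nat -> R) :=
  forall n (x : nat -> nat), Q [set z | forall i, (i <= n)%N -> z i = x i] =
    ((x 0%N == x0)%:R * \prod_(i < n) tr (x i) (x i.+1))%:E.

(** Only visits to [B] strictly before the arrival in [A] are excluded, so [A] wins at a state that
    satisfies both. *)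
Definition hit (A B : pred nat) : set (nat -> nat) :=
  [set z | exists s, A (z s) /\ forall r, (r < s)%N -> ~~ B (z r)].

Definition hit_before (n : nat) (A B : pred nat) : set (nat -> nat) :=
  [set z | exists s, (s <= n)%N /\ (A (z s) /\ forall r, (r < s)%N -> ~~ B (z r))].

Lemma measurable_hit_before n A B : measurable (hit_before n A B : set paths).
Proof.
apply: measurable_ex => s; apply: measurable_and; first exact: measurable_const.
apply: measurable_and; first exact: (@measurable_coord s A).
apply: measurable_all => r; apply: measurable_imp; first exact: measurable_const.
exact: (@measurable_coord r (fun k => ~~ B k)).
Qed.

Lemma hitE A B : hit A B = \bigcup_n hit_before n A B.
Proof.
apply/seteqP; split => z; first by case=> s ?; exists s => //; exists s.
by case=> n _ [s [_ ?]]; exists s.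
Qed.

Lemma measurable_hit A B : measurable (hit A B : set paths).
Proof.
by rewrite hitE; apply: bigcupT_measurable => n; exact: measurable_hit_before.
Qed.

Section Chain.
Context {R : realType} (Q : probability paths R) (x0 : nat) (tr : nat -> nat -> R).
Hypothesis tr_ge0 : forall x y, 0 <= tr x y.
Hypothesis tr_sum : forall x, \sum_(y < x + 3) tr x y = 1.
Hypothesis QZ : markov_paths Q x0 tr.
Local Notation pr := (pr Q).
Implicit Types F V : set paths.

(** A history cell either misses [F] or is a single cylinder inside it, and on a cylinder the
    product formula gains exactly one factor. *)
Lemma pr_next t F x y : past t F -> F `<=` [set z | z t = x] ->
  pr (F `&` [set z : nat -> nat | z t.+1 = y]) = tr x y * pr F.
Proof.
move=> pF Fx; pose E := history t; have EU : \bigcup_k E k = setT := bigcup_history t.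
have mE k : measurable (E k) by exact: past_measurable (@past_history t k).
have tE : trivIset setT E := @trivIset_history t.
have mF := past_measurable pF.
have mFn := past_measurable (@past_next t F y pF).
have key k : pr (F `&` [set z : nat -> nat | z t.+1 = y] `&` E k) = tr x y * pr (F `&` E k).
  have [[z0 [Fz0 Ek]]|/forallNP noz] := pselect (exists z, F z /\ E k z); last first.
    have -> : F `&` E k = set0 by apply/seteqP; split => z // /noz.
    have -> : F `&` [set z : nat -> nat | z t.+1 = y] `&` E k = set0.
      by apply/seteqP; split => z // -[[Fz _]] Ez; case: (noz z).
    by rewrite pr_set0 mulr0.
  have inj z : E k z -> forall i, (i <= t)%N -> z i = z0 i by move/(eq_history z Ek).
  have jni z : (forall i, (i <= t)%N -> z i = z0 i) -> E k z by move/(eq_history z Ek).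
  have -> : F `&` E k = [set z | forall i, (i <= t)%N -> z i = z0 i].
    apply/seteqP; split => z; first by case=> _ /inj.
    move=> zz0; split; last exact: jni.
    by apply: (pF z0) => // i it; rewrite zz0.
  pose z1 i := if (i <= t)%N then z0 i else y.
  have -> : F `&` [set z : nat -> nat | z t.+1 = y] `&` E k =
      [set z | forall i, (i <= t.+1)%N -> z i = z1 i].
    apply/seteqP; split => z.
      case=> -[Fz zy] /inj zz0 i; rewrite leq_eqVlt /z1 => /orP[/eqP ->|].
        by rewrite ltnn.
      by rewrite ltnS => it; rewrite it zz0.
    move=> /= zz1.
    have zz0 : forall i, (i <= t)%N -> z i = z0 i.
      by move=> i it; rewrite zz1 1?ltnW// /z1 it.
    split; last exact: jni.
    split; first by apply: (pF z0) => // i it; rewrite zz0.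
    by rewrite /= zz1// /z1 ltnn.
  rewrite /pr !QZ /= big_ord_recr/= mulrA [RHS]mulrC.
  have -> : z1 0%N = z0 0%N by rewrite /z1 leq0n.
  have -> : \prod_(i < t) tr (z1 i) (z1 i.+1) = \prod_(i < t) tr (z0 i) (z0 i.+1).
    by apply: eq_bigr => i _; rewrite /z1 (ltnW (ltn_ord i)) ltn_ord.
  congr (_ * _).
  by rewrite /z1 leqnn ltnn; have := Fx _ Fz0 => /= ->.
apply/eqP; rewrite eq_le; apply/andP; split.
  have := @pr_bigcup_le _ Q E (F `&` [set z : nat -> nat | z t.+1 = y]) F (tr x y) (tr_ge0 x y)
    mE tE mFn mF.
  by rewrite EU !setIT; apply => i; rewrite key.
have := @pr_bigcup_ge _ Q E (F `&` [set z : nat -> nat | z t.+1 = y]) F (tr x y) (tr_ge0 x y)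
  mE tE mFn mF.
by rewrite EU !setIT; apply => i; rewrite key.
Qed.

(** The states below [x + 3] already receive total probability 1 from [x], so within [F] a jump to
    any other state is a null event. *)
Lemma pr_step t F x V : past t F -> F `<=` [set z | z t = x] -> measurable V ->
  pr (F `&` V) = \sum_(y < x + 3) pr (F `&` [set z : nat -> nat | z t.+1 = y] `&` V).
Proof.
move=> pF Fx mV; have mF := past_measurable pF.
have mt y : measurable ([set z : nat -> nat | z t.+1 = y] : set paths) by exact: measurable_eq.
have mge : measurable ([set z | (x + 3 <= z t.+1)%N] : set paths) by exact: measurable_ge.
have := @pr_ord_partition _ Q F (fun z => z t.+1) (x + 3) mF mt.
rewrite (eq_bigr (fun y : 'I__ => tr x y * pr F)); last by move=> y _; rewrite (pr_next _ pF Fx).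
rewrite -mulr_suml tr_sum mul1r -{1}[pr F]addr0 => /addrI /esym rest0.
rewrite (@pr_ord_partition _ Q (F `&` V) (fun z => z t.+1) (x + 3))//; last exact: measurableI.
rewrite [X in _ + X](_ : _ = 0).
  by rewrite addr0; apply: eq_bigr => y _; rewrite setIAC.
apply/eqP; rewrite eq_le pr_ge0 andbT -rest0; apply: pr_le.
- by do !apply: measurableI.
- exact: measurableI.
- by move=> z [[]].
Qed.

Lemma pr_step_le t F x V (f : nat -> R) (c : R) :
  past t F -> F `<=` [set z | z t = x] -> measurable V ->
  (forall y, pr (F `&` [set z : nat -> nat | z t.+1 = y] `&` V) <=
     f y * pr (F `&` [set z : nat -> nat | z t.+1 = y])) ->
  \sum_(y < x + 3) tr x y * f y <= c ->
  pr (F `&` V) <= c * pr F.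
Proof.
move=> pF Fx mV le lec; rewrite (pr_step pF Fx mV).
apply: le_trans (ler_wpM2r (pr_ge0 _ _) lec); rewrite mulr_suml.
apply: ler_sum => y _; apply: le_trans (le y) _.
by rewrite (pr_next _ pF Fx) mulrCA mulrA.
Qed.

(** Optional stopping for a superharmonic function: first-step induction on a finite horizon, then a
    monotone limit. Superharmonicity is asked only off [A] and [B], which leaves room for truncated
    functions. *)
Lemma pr_hit_le (A B : pred nat) (f : nat -> R) :
  (forall y, 0 <= f y) -> (forall y, A y -> 1 <= f y) ->
  (forall y, ~~ A y -> ~~ B y -> \sum_(i < y + 3) tr y i * f i <= f y) ->
  forall t F x, past t F -> F `<=` [set z | z t = x] ->
  pr (F `&` shift t (hit A B)) <= f x * pr F.
Proof.
move=> f0 f1 fsup t F x pF Fx; have mF := past_measurable pF.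
have mhit n s : measurable (shift s (hit_before n A B) : set paths).
  by apply: shift_measurable; exact: measurable_hit_before.
suff fin n : pr (F `&` shift t (hit_before n A B)) <= f x * pr F.
  have -> : F `&` shift t (hit A B) = \bigcup_n (F `&` shift t (hit_before n A B)).
    rewrite hitE -setI_bigcupr; congr (_ `&` _).
  apply: pr_bigcup_lub => // n; first exact: measurableI.
  by apply: setIS => z [s [sn ?]]; exists s; split => //; exact: leqW.
elim: n t F x pF Fx mF => [|n IH] t F x pF Fx mF.
all: have [Ax|nAx] := boolP (A x);
  first by (apply: le_trans (_ : pr F <= _);
    [apply: pr_le => //; exact: measurableI|exact: ler_peMl (pr_ge0 _ _) (f1 _ Ax)]).
  rewrite [F `&` _](_ : _ = set0) ?pr_set0 ?mulr_ge0 ?pr_ge0//.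
  apply/seteqP; split => // z [/Fx /= zt] [s []]; rewrite leqn0 => /eqP -> [].
  by rewrite addn0 zt (negbTE nAx).
have [Bx|nBx] := boolP (B x).
  rewrite [F `&` _](_ : _ = set0) ?pr_set0 ?mulr_ge0 ?pr_ge0//.
  apply/seteqP; split => // z [/Fx /= zt] [[|s] [_ []]].
    by rewrite addn0 zt (negbTE nAx).
  by move=> _ /(_ 0%N isT); rewrite addn0 zt Bx.
apply: (@pr_step_le t F x _ f) => //; last exact: fsup.
move=> y; have pFy := @past_next t F y pF.
apply: le_trans (IH t.+1 _ y pFy _ (past_measurable pFy)); last by move=> z [].
apply: pr_le.
- by apply: measurableI => //; exact: past_measurable pFy.
- by apply: measurableI => //; exact: past_measurable pFy.
move=> z [[Fz zy]] [[|s] [sn [As Bs]]].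
  by move: As; rewrite addn0 (Fx _ Fz) (negbTE nAx).
split=> //; exists s; split => //; rewrite addSnnS; split => // r rs.
by rewrite addSnnS; exact: Bs.
Qed.

(* [g] is a Lyapunov function: it grows by at least 1 per step on average, so
   [C - g] bounds the expected exit time from [0, N). *)
Lemma pr_bounded_eq0 (g : nat -> R) : (forall y, 0 <= g y) ->
  (forall y, g y + 1 <= \sum_(i < y + 3) tr y i * g i) ->
  forall N t F x, past t F -> F `<=` [set z | z t = x] ->
  pr (F `&` [set z | forall s, (z (t + s) < N)%N]) = 0.
Proof.
move=> g0 gsub N t F x pF Fx.
(* [C] dominates [g] at every state reachable in one step from below [N], so the truncation in [h]
   is inactive there. *)
pose C := \sum_(y < N + 3) g y; pose h y := Num.max 0 (C - g y).
have hE y : (y < N + 3)%N -> h y = C - g y.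
  move=> yN; rewrite /h max_r// subr_ge0 /C (bigD1 (Ordinal yN))//= lerDl.
  by apply: sumr_ge0.
pose B t n := [set z : nat -> nat | forall s, (s <= n)%N -> (z (t + s) < N)%N] : set paths.
have mB s n : measurable (B s n).
  apply: measurable_all => k; apply: measurable_imp; first exact: measurable_const.
  exact: measurable_lt.
have fin n : \sum_(k < n) pr (F `&` B t k) <= h x * pr F.
  elim: n t F x pF Fx => [|n IH] t F x pF Fx.
    by rewrite big_ord0 mulr_ge0 ?pr_ge0// /h le_max lexx.
  have mF := past_measurable pF.
  have [xN|Nx] := ltnP x N; last first.
    rewrite big1 ?mulr_ge0 ?pr_ge0 ?/h ?le_max ?lexx// => k _.
    rewrite [F `&` _](_ : _ = set0) ?pr_set0//.
    apply/seteqP; split => // z [/Fx /= zt] /(_ 0%N (leq0n _)).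
    by rewrite addn0 zt ltnNge Nx.
  rewrite big_ord_recl.
  have le0 : pr (F `&` B t 0%N) <= pr F by apply: pr_le => //; exact: measurableI.
  apply: (@le_trans _ _ (pr F + \sum_(y < x + 3) h y * (tr x y * pr F))); last first.
    rewrite (eq_bigr (fun y : 'I_(x + 3) => (C * tr x y - tr x y * g y) * pr F)); last first.
      by move=> y _; rewrite hE ?(leq_trans (ltn_ord y)) ?leq_add2r 1?ltnW//; ring.
    rewrite -mulr_suml sumrB -mulr_sumr tr_sum mulr1 -{1}[pr F]mul1r -mulrDl.
    apply: ler_wpM2r; first exact: pr_ge0.
    by rewrite hE ?ltn_addr//; have := gsub x; lra.
  apply: lerD => //.
  rewrite (eq_bigr (fun k : 'I_n => \sum_(y < x + 3)
      pr (F `&` [set z : nat -> nat | z t.+1 = y] `&` B t k.+1))); last first.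
    by move=> k _; rewrite (pr_step pF Fx).
  rewrite exchange_big/=; apply: ler_sum => y _.
  rewrite -(pr_next _ pF Fx).
  have pFy := @past_next t F y pF.
  apply: le_trans (IH t.+1 _ y pFy _); last by move=> z [].
  apply: ler_sum => k _; apply: pr_le.
  - by apply: measurableI => //; exact: past_measurable pFy.
  - by apply: measurableI => //; exact: past_measurable pFy.
  - by move=> z [Fz Bz]; split => // s sk; rewrite addSnnS; exact: Bz.
apply/eqP; rewrite eq_le pr_ge0 andbT; set p := pr _.
have mF := past_measurable pF.
(* The event in question lies in every [B t k], so [n] copies of its probability stay below a bound
   free of [n]. *)
have le n : p *+ n <= h x * pr F.
  apply: le_trans (fin n); rewrite -[n in p *+ n]card_ord -sumr_const.
  apply: ler_sum => k _; apply: pr_le.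
  - apply: measurableI => //; apply: measurable_all => s; exact: measurable_lt.
  - exact: measurableI.
  - by move=> z [Fz zN]; split => // s _; exact: zN.
rewrite leNgt; apply/negP => p0.
have := le (Num.truncn (h x * pr F / p)).+1; rewrite leNgt => /negP; apply.
rewrite -mulr_natl -ltr_pdivrMr//; exact: Num.Theory.truncnS_gt.
Qed.

End Chain.

(** * The Markov property and a zero-one law *)

Section MarkovProperty.
Context {R : realType} (Q : probability paths R) (x0 : nat) (tr : nat -> nat -> R).
Hypothesis tr_ge0 : forall x y, 0 <= tr x y.
Hypothesis tr_sum : forall x, \sum_(y < x + 3) tr x y = 1.
Hypothesis QZ : markov_paths Q x0 tr.
Local Notation pr := (pr Q).

(** [k] plays the role of the probability of [G] for the walk started at [x]; the point is that one
    value serves all [t] and [F]. *)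
Lemma markov_past n (G : set paths) x : past n G ->
  exists k : R, forall t F, past t F -> F `<=` [set z | z t = x] ->
    pr (F `&` shift t G) = k * pr F.
Proof.
elim: n G x => [|n IH] G x pG.
  have [[y [Gy y0]]|nG] := pselect (exists y, G y /\ y 0%N = x).
    exists 1 => t F pF Fx; rewrite mul1r; congr pr.
    apply/seteqP; split => z; first by case.
    move=> Fz; split => //; apply: pG Gy => -[|//] _.
    by rewrite addn0 (Fx _ Fz).
  exists 0 => t F pF Fx; rewrite mul0r [F `&` _](_ : _ = set0) ?pr_set0//.
  apply/seteqP; split => // z [Fz Gz]; apply: nG; eexists; split; first exact: Gz.
  by rewrite /= addn0 (Fx _ Fz).
(* What is left of [G] once its initial state is known to be [x]: one coordinate fewer. *)
pose Gx := [set z | G (fun i => if i is j.+1 then z j else x)] : set paths.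
have pGx : past n Gx.
  by move=> z z' zz'; apply: pG => -[//|i] ilt; exact: zz'.
have /choice[k kP] y := IH Gx y pGx.
exists (\sum_(y < x + 3) tr x y * k y) => t F pF Fx.
have mG : measurable (shift t G : set paths).
  by apply: shift_measurable; exact: past_measurable pG.
rewrite (pr_step tr_ge0 tr_sum QZ pF Fx)// mulr_suml; apply: eq_bigr => y _.
rewrite -mulrA mulrCA -(pr_next tr_ge0 QZ _ pF Fx) -(kP y t.+1); last 2 first.
- exact: past_next.
- by move=> z [].
congr pr; apply/seteqP; split => z [[Fz zy] Gz]; (split; first by split).
  rewrite /shift /Gx /=; move: Gz; rewrite /shift/=; congr G.
  by apply/funext => -[|i]; [rewrite addn0 (Fx _ Fz)|rewrite addSnnS].
move: Gz; rewrite /shift /Gx /=; congr G.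
by apply/funext => -[|i]; [rewrite addn0 (Fx _ Fz)|rewrite addSnnS].
Qed.

(** The time-homogeneous Markov property in cross-multiplied form. It avoids dividing by the mass of
    null events and is linear in [G], hence stable under complements and disjoint unions, as Dynkin
    induction requires. *)
Lemma markov_proportional (G : set paths) : measurable G ->
  forall x t F t' F', past t F -> F `<=` [set z | z t = x] ->
  past t' F' -> F' `<=` [set z | z t' = x] ->
  pr F' * pr (F `&` shift t G) = pr F * pr (F' `&` shift t' G).
Proof.
move: G; apply: (@dynkin_induction _ paths cylinders) => //.
- move=> A B [n pA] [m pB]; exists (maxn n m).
  by apply: pastI; [apply: pastW pA; exact: leq_maxl|apply: pastW pB; exact: leq_maxr].
- by move=> x t F t' F' _ _ _ _; rewrite !setIT mulrC.
- move=> G [n pG] x t F t' F' pF Fx pF' Fx'.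
  by have [k kP] := markov_past x pG; rewrite !(kP _ _ _ Fx, kP _ _ _ Fx')//; ring.
- move=> G mG IH x t F t' F' pF Fx pF' Fx'.
  have /= := IH x t F t' F' pF Fx pF' Fx'.
  have := pr_split Q (past_measurable pF) (shift_measurable t mG).
  have := pr_split Q (past_measurable pF') (shift_measurable t' mG).
  have -> : shift t (~` G) = ~` shift t G by [].
  have -> : shift t' (~` G) = ~` shift t' G by [].
  set a := pr F; set b := pr F'; set u := pr _; set v := pr _.
  by set u' := pr _; set v' := pr _ => -> -> ; nra.
move=> G mG tG IH x t F t' F' pF Fx pF' Fx'.
have mF := past_measurable pF; have mF' := past_measurable pF'.
have sE s : shift s (\bigcup_k G k) = \bigcup_k shift s (G k) by [].
have ms s k : measurable (shift s (G k) : set paths) by exact: shift_measurable.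
have ts s (A : set paths) : trivIset setT (fun k => A `&` shift s (G k)).
  apply: trivIset_setIl; apply/trivIsetP => i j _ _ ij.
  move/trivIsetP : tG => /(_ i j I I ij) Gij.
  by rewrite -subset0 => z; rewrite -[_ z]/((G i `&` G j) _) Gij.
have mU (A : set paths) s : measurable A -> measurable (A `&` \bigcup_k shift s (G k)).
  by move=> mA; apply: measurableI => //; exact: bigcupT_measurable.
have mI (A : set paths) s k : measurable A -> measurable (A `&` shift s (G k)).
  by move=> mA; exact: measurableI.
have sumE (A : set paths) s : measurable A ->
    (pr (A `&` \bigcup_k shift s (G k)))%:E = (\sum_(k <oo) (pr (A `&` shift s (G k)))%:E)%E.
  move=> mA; rewrite -prE; last exact: mU.
  rewrite setI_bigcupr measure_semi_bigcup//; [|by move=> k; exact: mI|by rewrite -setI_bigcupr; exact: mU].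
  by apply: eq_eseriesr => k _; rewrite -prE//; exact: mI.
apply: EFin_inj; rewrite !sE !EFinM !sumE// -!nneseriesZl//; last 2 first.
- by move=> k _; rewrite lee_fin pr_ge0.
- by move=> k _; rewrite lee_fin pr_ge0.
by apply: eq_eseriesr => k _; rewrite -!EFinM (IH k x t F t' F').
Qed.

(** [k] is read off from any one past event of positive mass at [x]. If there is none, both sides
    vanish and [k = 0] works. *)
Lemma markov (G : set paths) x : measurable G ->
  exists2 k : R, 0 <= k & forall t F, past t F -> F `<=` [set z | z t = x] ->
    pr (F `&` shift t G) = k * pr F.
Proof.
move=> mG.
have [[t0 [F0 [pF0 [Fx0 F0pos]]]]|noF] :=
  pselect (exists t F, past t F /\ F `<=` [set z | z t = x] /\ 0 < pr F).
  exists (pr (F0 `&` shift t0 G) / pr F0); first by rewrite divr_ge0// pr_ge0.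
  move=> t F pF Fx.
  have := markov_proportional mG pF Fx pF0 Fx0.
  by move=> E; rewrite mulrAC [_ * pr F]mulrC -E mulrC mulKf// gt_eqF.
exists 0 => // t F pF Fx; have mF := past_measurable pF.
have F0 : pr F = 0.
  apply/eqP; rewrite eq_le pr_ge0 andbT leNgt; apply/negP => Fpos.
  by apply: noF; exists t, F.
rewrite mul0r; apply/eqP; rewrite eq_le pr_ge0 andbT -F0; apply: pr_le => //.
by apply: measurableI => //; exact: shift_measurable.
Qed.

End MarkovProperty.

Section ZeroOne.
Context {R : realType} (Q : probability paths R).
Local Notation pr := (pr Q).
Implicit Types A B H : set paths.

Let approximable A := forall e : R, 0 < e ->
  exists t F, past t F /\ pr (A `\` F) + pr (F `\` A) <= e.

Let approxU A B : measurable A -> measurable B ->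
  approximable A -> approximable B -> approximable (A `|` B).
Proof.
move=> mA mB aA aB e e0; have e2 : 0 < e / 2 by lra.
have [t [F [pF Fe]]] := aA _ e2; have [u [G [pG Ge]]] := aB _ e2.
exists (maxn t u), (F `|` G); split.
  by apply: pastU; [apply: pastW pF; exact: leq_maxl|apply: pastW pG; exact: leq_maxr].
have mF := past_measurable pF; have mG := past_measurable pG.
have mD C D : measurable C -> measurable D -> measurable (C `\` D : set paths).
  exact: measurableD.
have mU C D : measurable C -> measurable D -> measurable (C `|` D : set paths).
  exact: measurableU.
have h1 : pr ((A `|` B) `\` (F `|` G)) <= pr (A `\` F) + pr (B `\` G).
  apply: le_trans (pr_setU_le Q (mD _ _ mA mF) (mD _ _ mB mG)).
  apply: pr_le; [exact: mD (mU _ _ mA mB) (mU _ _ mF mG)|exact: mU (mD _ _ mA mF) (mD _ _ mB mG)|].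
  by move=> z [[Az|Bz] nFG]; [left|right]; split => // ?; apply: nFG; [left|right].
have h2 : pr ((F `|` G) `\` (A `|` B)) <= pr (F `\` A) + pr (G `\` B).
  apply: le_trans (pr_setU_le Q (mD _ _ mF mA) (mD _ _ mG mB)).
  apply: pr_le; [exact: mD (mU _ _ mF mG) (mU _ _ mA mB)|exact: mU (mD _ _ mF mA) (mD _ _ mG mB)|].
  by move=> z [[Fz|Gz] nAB]; [left|right]; split => // ?; apply: nAB; [left|right].
lra.
Qed.

(** Approximable events form a Dynkin system containing the cylinders; a countable union is first
    cut down to finitely many of its sets. *)
Lemma past_approximation A : measurable A -> approximable A.
Proof.
move: A; apply: (@dynkin_induction _ paths cylinders) => //.
- move=> A B [n pA] [m pB]; exists (maxn n m).
  by apply: pastI; [apply: pastW pA; exact: leq_maxl|apply: pastW pB; exact: leq_maxr].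
- by move=> e e0; exists 0%N, setT; split => //; rewrite setDv pr_set0; lra.
- by move=> A [n pA] e e0; exists n, A; split => //; rewrite setDv pr_set0; lra.
- move=> A mA aA e e0; have [t [F [pF Fe]]] := aA _ e0.
  exists t, (~` F); split; first exact: pastC.
  have CD (B C : set paths) : ~` B `\` ~` C = C `\` B by rewrite !setDE setCK setIC.
  by rewrite !CD addrC.
move=> G mG tG aG e e0; have e2 : 0 < e / 2 by lra.
pose U n := \bigcup_(k in [set k | (k < n)%N]) G k : set paths.
have mU n : measurable (U n) by apply: bigcup_measurable.
have mGG : measurable (\bigcup_k G k) by exact: bigcupT_measurable.
have aU n : approximable (U n).
  elim: n => [|n IH].
    have -> : U 0%N = set0 by apply/seteqP; split => // z [].
    by move=> d d0; exists 0%N, set0; split => //; rewrite setDv pr_set0; lra.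
  have -> : U n.+1 = U n `|` G n.
    apply/seteqP; split => z.
      move=> [k /=]; rewrite ltnS leq_eqVlt => /orP[/eqP -> ?|kn Gk]; first by right.
      by left; exists k.
    by move=> [[k /= kn ?]|?]; [exists k => //=; exact: ltnW|exists n => /=].
  exact: approxU.
have [n Un] : exists n, pr ((\bigcup_k G k) `\` U n) <= e / 2.
  apply: contrapT => /forallNP no.
  have : e / 2 <= pr (\bigcap_n ((\bigcup_k G k) `\` U n)).
    apply: pr_bigcap_glb => n.
    - exact: measurableD.
    - by move=> z [Gz nU]; split => // -[k /= kn Gk]; apply: nU; exists k => //=; exact: ltnW.
    - by rewrite leNgt; apply/negP => /ltW; exact: no.
  rewrite (_ : \bigcap_n _ = set0) ?pr_set0; first by rewrite leNgt e2.
  apply/seteqP; split => // z zn; have [[k _ Gk] _] := zn 0%N I.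
  by have [_] := zn k.+1 I; apply; exists k => /=.
have [t [F [pF Fe]]] := aU n _ e2; have mF := past_measurable pF.
exists t, F; split => //.
have h1 : pr ((\bigcup_k G k) `\` F) <= pr ((\bigcup_k G k) `\` U n) + pr (U n `\` F).
  apply: le_trans (pr_setU_le Q (measurableD mGG (mU n)) (measurableD (mU n) mF)).
  apply: pr_le; [exact: measurableD|by apply: measurableU; exact: measurableD|].
  by move=> z [Gz nF]; have [?|?] := pselect (U n z); [right|left].
have h2 : pr (F `\` \bigcup_k G k) <= pr (F `\` U n).
  apply: pr_le; [exact: measurableD|exact: measurableD|].
  by move=> z [Fz nG]; split => // -[k _ Gk]; apply: nG; exists k.
lra.
Qed.

(** A substitute for the zero-one law of Lévy. If the past event [F] approximates [H], then [F]
    minus [H] is small, yet it carries at least the fraction [c] of [F]; so [F] is small, and [H]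
    with it. *)
Lemma pr_eq0_of_past H (c : R) : measurable H -> 0 < c ->
  (forall t F, past t F -> c * pr F <= pr (F `\` H)) -> pr H = 0.
Proof.
move=> mH c0 Hc; apply/eqP; rewrite eq_le pr_ge0 andbT; apply/ler_addgt0Pl => e e0; rewrite addr0.
have e'0 : 0 < e / (1 + c^-1) by rewrite divr_gt0// addr_gt0// invr_gt0.
have [t [F [pF Fe]]] := past_approximation mH e'0.
have mF := past_measurable pF.
have h1 : pr H <= pr (H `\` F) + pr F.
  apply: le_trans (pr_setU_le Q (measurableD mH mF) mF); apply: pr_le => //.
    by apply: measurableU => //; exact: measurableD.
  by move=> z Hz; have [?|?] := pselect (F z); [right|left].
have h2 : pr F <= c^-1 * pr (F `\` H).
  by rewrite mulrC ler_pdivlMr// mulrC; exact: Hc pF.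
have a0 := pr_ge0 Q (H `\` F); have b0 := pr_ge0 Q (F `\` H).
have ci : 0 < c^-1 by rewrite invr_gt0.
apply: le_trans h1 _.
apply: (@le_trans _ _ ((1 + c^-1) * (e / (1 + c^-1)))); last first.
  by rewrite mulrC divfK// gt_eqF// addr_gt0.
apply: le_trans (ler_wpM2l _ Fe); last by lra.
by move: h2 a0 b0 ci; set u := pr _; set v := pr _; set w := pr _; nra.
Qed.

End ZeroOne.

(** * Cutpoints as regeneration points *)

Lemma pr_bigcup_null {R : realType} (Q : probability paths R) (A : nat -> set paths) :
  (forall n, measurable (A n)) -> (forall n, pr Q (A n) = 0) -> pr Q (\bigcup_n A n) = 0.
Proof.
move=> mA A0; have QA n : Q (A n) = 0%E by rewrite prE// A0.
apply: EFin_inj; rewrite -prE; last exact: bigcupT_measurable.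
apply: measure_negligible; first exact: bigcupT_measurable.
by apply: negligible_bigcup => n; apply/negligibleP => //; exact: QA.
Qed.

(** The crossing that a cutpoint requires: X enters [n, oo) at [n] and steps up at once, Y jumps
    over [n] to [n + 1]. In both cases [s + isX] is the time of arrival at [n + 1]. *)
Definition pass (isX : bool) (n s : nat) : set (nat -> nat) :=
  [set z | (forall r, (r < s)%N -> (z r < n)%N) /\ z s = (n + ~~ isX)%N /\
           (isX -> z s.+1 = n.+1)].

Definition is_cutpoint (isX : bool) (n : nat) : set (nat -> nat) :=
  [set z | if isX then exists! s, z s = n else forall s, z s <> n].

Definition above (n : nat) : set (nat -> nat) := [set z | forall r, (n < z r)%N].

Section Pass.
Variable isX : bool.
Local Notation pass := (pass isX).
Local Notation cut := (is_cutpoint isX).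

Lemma past_pass n s : past (s + isX) (pass n s).
Proof.
move=> z z' zz' [zlt [zs zX]]; split.
  by move=> r rs; rewrite -zz'; [exact: zlt|exact: leq_trans (ltnW rs) (leq_addr _ _)].
rewrite -zz' ?leq_addr//; split=> // iX; rewrite -zz' ?iX ?addn1//; exact: zX.
Qed.

Lemma pass_end n s : pass n s `<=` [set z | z (s + isX)%N = n.+1].
Proof.
by move=> z [_ []] /=; case: isX => /= [_ /(_ isT)|+ _]; rewrite ?addn0 ?addn1.
Qed.

Lemma pass_prefix n s z r : pass n s z -> (r < s + isX)%N -> (z r <= n)%N.
Proof.
move=> [zlt [zs zX]] rs; case: (ltnP r s) => [/zlt/ltnW//|sr].
move: rs zs; case: isX => /=; rewrite ?addn0 ?addn1 ?ltnS => rs.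
  by move=> <-; rewrite (_ : r = s)//; apply/eqP; rewrite eqn_leq rs.
by move: rs; rewrite ltnNge sr.
Qed.

Lemma pass_inj n s s' z : pass n s z -> pass n s' z -> s = s'.
Proof.
move=> [lt1 [e1 _]] [lt2 [e2 _]]; apply/eqP; rewrite eqn_leq.
apply/andP; split; rewrite leqNgt; apply/negP.
  by move=> /lt1; rewrite e2 ltnNge leq_addr.
by move=> /lt2; rewrite e1 ltnNge leq_addr.
Qed.

Lemma trivIset_pass n : trivIset setT (pass n).
Proof.
apply/trivIsetP => i j _ _ /eqP ij; apply/seteqP; split => z // [pi pj].
exact/ij/(pass_inj pi).
Qed.

Lemma measurable_pass n s : measurable (pass n s : set paths).
Proof. exact: past_measurable (@past_pass n s). Qed.

Lemma measurable_cut n : measurable (cut n : set paths).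
Proof.
rewrite /is_cutpoint; case: isX.
  have -> : [set z : nat -> nat | exists! s, z s = n] =
    [set z | exists s, z s = n /\ forall r, z r = n -> s = r] by [].
  by meas.
by meas.
Qed.

Lemma measurable_above n : measurable (above n : set paths).
Proof. by rewrite /above; meas. Qed.

Lemma pass_cut n s z : pass n s z -> shift (s + isX) (above n) z -> cut n z.
Proof.
move=> pz ab.
have ab' r : (s + isX <= r)%N -> (n < z r)%N.
  by move=> sr; have := ab (r - (s + isX))%N; rewrite subnKC.
case: (pz) => zlt [zs zX]; rewrite /is_cutpoint /=; move: ab' zs zX; case: isX => /= ab' zs zX.
  exists s; split; first by rewrite zs addn0.
  move=> r zr; apply/eqP; rewrite eqn_leq; apply/andP; split; rewrite leqNgt; apply/negP.
    by move=> /zlt; rewrite zr ltnn.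
  by rewrite -addn1 => /ab'; rewrite zr ltnn.
move=> r zr; have [/zlt|sr] := ltnP r s; first by rewrite zr ltnn.
by have := ab' r; rewrite addn0 zr ltnn => /(_ sr).
Qed.

Lemma cut_shift n t z : (forall r, (r < t)%N -> z r <> n) ->
  cut n z <-> shift t (cut n) z.
Proof.
move=> zn; rewrite /shift /is_cutpoint /=; case: isX; split.
- move=> [s [zs us]]; have ts : (t <= s)%N by rewrite leqNgt; apply/negP => /zn.
  exists (s - t)%N; split => [|r zr]; first by rewrite subnKC.
  by rewrite (us _ zr) addKn.
- move=> [s [zs us]]; exists (t + s)%N; split => // r zr.
  have tr : (t <= r)%N by rewrite leqNgt; apply/negP => /zn.
  by rewrite (us (r - t)%N) /= subnKC.
- by move=> zn' s; exact: zn'.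
- move=> zn' s; have [/zn//|ts] := ltnP s t.
  by rewrite -(subnKC ts); exact: zn'.
Qed.

End Pass.

(** * Transition sums and jump ranges of the two walks *)

Section Walk.
Context {R : realType} (isX : bool) (q p1 p2 : nat -> R).
Hypothesis Hq : forall k, (2 <= k)%N ->
  0 < q k /\ 0 <= p1 k /\ 0 < p2 k /\ q k + p1 k + p2 k = 1.

Definition walk := if isX then transX q p1 p2 else transY q p1 p2.

Lemma sum_delta (n a : nat) (f : nat -> R) : (a < n)%N ->
  \sum_(y < n) (y == a :> nat)%:R * f y = f a.
Proof.
move=> an; rewrite (bigD1 (Ordinal an))//= eqxx mul1r big1 ?addr0// => i.
by rewrite -val_eqE/= => /negbTE ->; rewrite mul0r.
Qed.

Lemma walkX_sum x (f : nat -> R) : isX -> (2 <= x)%N ->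
  \sum_(y < x + 3) walk x y * f y =
  q x * f x.+1 + p1 x * f (x - 1)%N + p2 x * f (x - 2)%N.
Proof.
move=> iX x2; rewrite -(sum_delta f (_ : x.+1 < x + 3)%N) ?addn3 ?ltnS//.
rewrite -(sum_delta f (_ : x - 1 < x + 3)%N); last by lia.
rewrite -(sum_delta f (_ : x - 2 < x + 3)%N); last by lia.
rewrite addn3 !mulr_sumr -!big_split/=; apply: eq_bigr => y _.
rewrite /walk iX /transX.
have [-> ->] : (x == 0%N) = false /\ (x == 1%N) = false by split; apply/eqP; lia.
case: eqP => [->|_].
  have [-> ->] : (x.+1 == x - 1)%N = false /\ (x.+1 == x - 2)%N = false.
    by split; apply/eqP; lia.
  by rewrite /=; ring.
case: eqP => [->|_]; last by case: eqP => _ /=; ring.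
have -> : (x - 1 == x - 2)%N = false by apply/eqP; lia.
by rewrite /=; ring.
Qed.

Lemma walkY_sum x (f : nat -> R) : ~~ isX -> (2 <= x)%N ->
  \sum_(y < x + 3) walk x y * f y =
  q x * f (x - 1)%N + p1 x * f x.+1 + p2 x * f x.+2.
Proof.
move=> iX x2; rewrite -(sum_delta f (_ : x - 1 < x + 3)%N); last by lia.
rewrite -(sum_delta f (_ : x.+1 < x + 3)%N) ?addn3 ?ltnS//.
rewrite -(sum_delta f (_ : x.+2 < x.+3)%N)//.
rewrite !mulr_sumr -!big_split/=; apply: eq_bigr => y _.
rewrite /walk (negbTE iX) /transY.
have [-> ->] : (x == 0%N) = false /\ (x == 1%N) = false by split; apply/eqP; lia.
case: eqP => [->|_].
  have [-> ->] : (x - 1 == x.+1)%N = false /\ (x - 1 == x.+2)%N = false.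
    by split; apply/eqP; lia.
  by rewrite /=; ring.
case: eqP => [->|_]; last by case: eqP => _ /=; ring.
have -> : (x.+1 == x.+2)%N = false by apply/eqP; lia.
by rewrite /=; ring.
Qed.

Lemma walk_sum_small x (f : nat -> R) : (x < 2)%N ->
  \sum_(y < x + 3) walk x y * f y =
  if isX then f x.+1 else f (if x == 0%N then 2%N else 0%N).
Proof.
rewrite /walk /transX /transY; case: isX; case: x => [|[|//]] _ /=.
- exact: (@sum_delta 3 1).
- exact: (@sum_delta 4 2).
- exact: (@sum_delta 3 2).
- exact: (@sum_delta 4 0).
Qed.

Lemma walk_ge0 x y : 0 <= walk x y.
Proof.
rewrite /walk /transX /transY; have [|x2] := ltnP x 2.
  by case: isX; case: x => [|[|//]] _ /=; exact: ler0n.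
have [q0 [p10 [p20 _]]] := Hq x2.
have [e0 e1] : (x == 0%N) = false /\ (x == 1%N) = false by split; apply/eqP; lia.
by case: isX; rewrite e0 e1; repeat case: ifP => _ //; exact: ltW.
Qed.

Lemma walk_sum1 x : \sum_(y < x + 3) walk x y = 1.
Proof.
pose f (y : nat) : R := 1.
have -> : \sum_(y < x + 3) walk x y = \sum_(y < x + 3) walk x y * f y.
  by apply: eq_bigr => y _; rewrite mulr1.
have [x2|x2] := ltnP x 2; first by rewrite walk_sum_small//; case: isX.
have [_ [_ [_ s1]]] := Hq x2.
have [iX|iX] := boolP isX; first by rewrite walkX_sum// !mulr1 -s1; lra.
by rewrite walkY_sum// !mulr1 -s1.
Qed.

Lemma walkX_jump x y : isX -> 0 < walk x y -> (y <= x.+1)%N.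
Proof.
rewrite /walk /transX => ->; case: eqP => [->|_].
  by case: eqP => [->|]//=; rewrite ltxx.
case: eqP => [->|_]; first by case: eqP => [->|]//=; rewrite ltxx.
case: eqP => [->//|_]; case: eqP => [->|_]; first by lia.
by case: eqP => [->|_]; [lia|rewrite ltxx].
Qed.

Lemma walkY_jump x y : ~~ isX -> 0 < walk x y -> (y <= x.+2)%N /\ (x <= y.+1)%N.
Proof.
rewrite /walk /transY => /negbTE ->; case: eqP => [->|_].
  by case: eqP => [->|]//=; rewrite ltxx.
case: eqP => [->|_]; first by case: eqP => [->|]//=; rewrite ltxx.
case: eqP => [->|_]; first by lia.
case: eqP => [->|_]; first by lia.
by case: eqP => [->|_]; [lia|rewrite ltxx].
Qed.

Lemma walk_range x y : (2 <= x)%N -> 0 < walk x y ->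
  (x <= y.+1 + isX)%N /\ (y <= x.+1 + ~~ isX)%N.
Proof.
move=> x2; have [e0 e1] : (x == 0%N) = false /\ (x == 1%N) = false by split; apply/eqP; lia.
rewrite /walk /transX /transY; case: isX; rewrite e0 e1.
  by do 3 (case: eqP => [->|_]; first by move=> _; split => /=; lia); rewrite ltxx.
by do 3 (case: eqP => [->|_]; first by move=> _; split => /=; lia); rewrite ltxx.
Qed.

Lemma eq_walk_sum x (f g : nat -> R) : (forall y, 0 < walk x y -> f y = g y) ->
  \sum_(y < x + 3) walk x y * f y = \sum_(y < x + 3) walk x y * g y.
Proof.
move=> fg; apply: eq_bigr => y _; have [/fg -> //|w0] := ltP 0 (walk x y).
suff -> : walk x y = 0 by rewrite !mul0r.
by apply/eqP; rewrite eq_le w0 walk_ge0.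
Qed.

(** [U] is defined recursively by dividing by the probability of one upward jump, so that this jump
    alone already contributes [U k + 1] to the mean after one step. *)
Lemma walk_lyapunov : exists g : nat -> R, (forall y, 0 <= g y) /\
  forall y, g y + 1 <= \sum_(i < y + 3) walk y i * g i.
Proof.
(* For Y the jump by two is taken because [p1] may vanish. *)
pose up k := if isX then q k else p2 k.
have up01 k : (2 <= k)%N -> 0 < up k <= 1.
  move=> /Hq[q0 [p10 [p20 s1]]]; rewrite /up; case: isX; lra.
pose U := fix U n := if n is k.+1 then (U k + 1) / up k.+2 else 2.
have U0 n : 0 <= U n.
  elim: n => [|n IH] /=; first by lra.
  by have /andP[u0 _] := @up01 n.+2 isT; rewrite divr_ge0// ?ltW//; lra.
have US n : U n + 1 <= U n.+1.
  have /andP[u0 u1] := @up01 n.+2 isT.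
  rewrite /= ler_pdivlMr// ler_piMr//; have := U0 n; lra.
have UM n : U n + 1 <= up n.+2 * U n.+1.
  have /andP[u0 u1] := @up01 n.+2 isT.
  by rewrite /= mulrC divfK// gt_eqF.
(* Below 2 the walk is deterministic, along 0, 1, 2 for X and 1, 0, 2 for Y; [g] takes the values 0,
   1, 2 on this route. *)
pose g n : R := if n is k.+2 then U k else if n == isX :> nat then 1 else 0.
have g0 n : 0 <= g n.
  by case: n => [|[|n]] //=; case: ifP.
exists g; split => // y; have [y2|y2] := ltnP y 2.
  rewrite walk_sum_small// /g; case: y y2 => [|[|//]] _; case: isX => /=; lra.
have [q0 [p10 [p20 s1]]] := Hq y2.
case: y y2 q0 p10 p20 s1 => [//|[//|y]] _ q0 p10 p20 s1.
have := UM y; have := US y.+1; rewrite /up.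
have [iX|iX] := boolP isX => US1 UM1.
  rewrite walkX_sum//; apply: (le_trans UM1); rewrite -addrA lerDl.
  by rewrite addr_ge0// mulr_ge0 ?g0// ltW.
rewrite walkY_sum//; apply: (le_trans UM1); rewrite addrC; apply: ler_wpDr.
  by rewrite addr_ge0// mulr_ge0 ?g0// ltW.
rewrite /g ler_pM2l//; apply: le_trans US1; by rewrite lerDl.
Qed.

End Walk.

Section Passage.
Context {R : realType} (isX : bool) (q p1 p2 : nat -> R).
Hypothesis Hq : forall k, (2 <= k)%N ->
  0 < q k /\ 0 <= p1 k /\ 0 < p2 k /\ q k + p1 k + p2 k = 1.
Local Notation tr := (walk isX q p1 p2).
Local Notation pass := (pass isX).
Local Notation cut := (is_cutpoint isX).

(** The jump ranges and unboundedness hold only almost surely; this event gathers what the pathwise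
    arguments use of them. *)
Definition regular : set (nat -> nat) :=
  [set z | (forall i, 0 < tr (z i) (z i.+1)) /\ forall M N, exists s, (N <= z (M + s))%N].

(** X enters [n, oo) exactly at [n]; were it below [n] later, unboundedness would force a second
    visit to [n] on the way up. Y avoids [n] and jumps up by at most two, so it enters at [n + 1],
    and its single steps down could not cross [n] unnoticed. *)
Lemma cut_pass n z : regular z -> (z 0 < n)%N -> cut n z ->
  exists s, pass n s z /\ shift (s + isX) (above n) z.
Proof.
move=> [step unb] z0n; have ex0 : exists s, (n <= z s)%N.
  by have [s] := unb 0%N n; exists s.
case: (ex_minnP ex0) => s0 nzs0 mins0.
have lts0 r : (r < s0)%N -> (z r < n)%N.
  by move=> rs; rewrite ltnNge; apply/negP => /mins0; rewrite leqNgt rs.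
have s0pos : (0 < s0)%N by case: s0 nzs0 {mins0 lts0} => //; rewrite leqNgt z0n.
have ltp : (z s0.-1 < n)%N by apply: lts0; rewrite prednK.
have stp := step s0.-1; rewrite prednK// in stp.
rewrite /is_cutpoint /pass /=; have [iX|iX] := boolP isX.
  have zs0 : z s0 = n by have := walkX_jump iX stp; lia.
  move=> [s [zs us]]; have ss0 : s = s0 by exact: us.
  have ab r : (s0 < r)%N -> (n < z r)%N.
    move=> sr; rewrite ltnNge; apply/negP => zrn.
    have [s1 ns1] := unb r n; have ex1 : exists s, (n <= z (r + s))%N by exists s1.
    case: (ex_minnP ex1) => m nzm minm.
    have znr k : z (r + k)%N <> n by move=> /us; lia.
    have m0 : (0 < m)%N.
      by case: m nzm {minm} => //; have := znr 0%N; rewrite addn0; lia.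
    have := minm m.-1; have := znr m; have := walkX_jump iX (step (r + m.-1)%N).
    by rewrite -addnS prednK//; lia.
  exists s0; rewrite zs0 addn0; split.
    split => //; split => // _; have := walkX_jump iX (step s0); have := ab s0.+1 (ltnSn _).
    by rewrite zs0; lia.
  by move=> r; rewrite /= addn1; apply: ab; rewrite ltn_addr.
move=> nz; have [j1 j2] := walkY_jump iX stp.
have zs0 : z s0 = n.+1 by have := nz s0; lia.
exists s0; rewrite zs0 addn1; split => // r; rewrite addn0.
elim: r => [|r IH]; first by rewrite addn0 zs0.
have [_] := walkY_jump iX (step (s0 + r)%N); rewrite -addnS; have := nz (s0 + r.+1)%N.
by lia.
Qed.

Context (Q : probability paths R) (x0 : nat) (QZ : markov_paths Q x0 tr).
Local Notation pr := (pr Q).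
Let tr_ge0 := walk_ge0 isX Hq.
Let tr_sum := walk_sum1 isX Hq.

Lemma measurable_step i : measurable ([set z : nat -> nat | 0 < tr (z i) (z i.+1)] : set paths).
Proof.
by apply: (@past_measurable i.+1) => z z' zz' /=; rewrite !zz'.
Qed.

Lemma measurable_regular : measurable (regular : set paths).
Proof.
rewrite /regular; apply: measurable_and; last by meas.
by apply: measurable_all => i; exact: measurable_step.
Qed.

Lemma pr_at_null t (V : set paths) : measurable V ->
  (forall x, pr (V `&` [set z | z t = x]) = 0) -> pr V = 0.
Proof.
move=> mV V0; have mE x : measurable ([set z | z t = x] : set paths) by meas.
have EU : \bigcup_x [set z : nat -> nat | z t = x] = setT.
  by apply/seteqP; split => z // _; exists (z t).
have := @pr_bigcup_le _ Q (fun x => [set z | z t = x]) V setT 0 (lexx _) mE.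
rewrite EU !setIT mul0r => H; apply/eqP; rewrite eq_le pr_ge0 andbT; apply: H => //.
- apply/trivIsetP => i j _ _ /eqP ij; apply/seteqP; split => // z [].
  by rewrite /= => Ei Ej; apply: ij; rewrite -Ei -Ej.
- by move=> x; rewrite V0 mul0r.
Qed.

Lemma pr_not_regular : pr (~` regular) = 0.
Proof.
have [g [g0 gsub]] := walk_lyapunov isX Hq.
pose A n := [set z : nat -> nat | ~ 0 < tr (z n) (z n.+1)] : set paths.
pose B n := \bigcup_k [set z : nat -> nat | forall s, (z (n + s) < k)%N] : set paths.
have mA n : measurable (A n) by apply: measurable_not; exact: measurable_step.
have mBk n k : measurable ([set z : nat -> nat | forall s, (z (n + s) < k)%N] : set paths).
  by meas.
have mB n : measurable (B n) by exact: bigcupT_measurable.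
have -> : ~` regular = \bigcup_n A n `|` \bigcup_n B n.
  rewrite /regular; apply/seteqP; split => z.
    move=> /not_andP[/existsNP[i nstep]|/existsNP[n /existsNP[k /forallNP nk]]].
      by left; exists i.
    by right; exists n => //; exists k => // s; rewrite ltnNge; apply/negP; exact: nk.
  move=> [[i _ nstep]|[n _ [k _ zk]]] [step unb]; first exact: nstep (step i).
  by have [s] := unb n k; rewrite leqNgt zk.
apply/eqP; rewrite eq_le pr_ge0 andbT.
apply: le_trans (pr_setU_le Q _ _) _; try exact: bigcupT_measurable.
rewrite !pr_bigcup_null ?addr0//.
  move=> n; apply: pr_bigcup_null => // k; apply: (@pr_at_null n) => // x.
  by rewrite setIC (pr_bounded_eq0 tr_ge0 tr_sum QZ g0 gsub k (@past_at n x) (@subset_refl _ _)).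
move=> n; apply: (@pr_at_null n) => // x; rewrite setIC.
rewrite (pr_step tr_ge0 tr_sum QZ (@past_at n x) (@subset_refl _ _))//; apply: big1 => y _.
have [pos|npos] := ltP 0 (tr x y).
  rewrite [X in pr X](_ : _ = set0) ?pr_set0//.
  by apply/seteqP; split => // z [[/= zx zy]]; rewrite /A /= zx zy pos.
apply/eqP; rewrite eq_le pr_ge0 andbT.
apply: (@le_trans _ _ (pr ([set z | z n = x] `&` [set z : nat -> nat | z n.+1 = y]))).
  apply: pr_le; last by move=> z [].
    by apply: measurableI => //; apply: measurableI; meas.
  by apply: measurableI; meas.
by rewrite (pr_next tr_ge0 QZ _ (@past_at n x) (@subset_refl _ _)) mulr_le0_ge0// pr_ge0.
Qed.

Lemma pr_regular_le (A B : set paths) : measurable A -> measurable B ->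
  (forall z, regular z -> A z -> B z) -> pr A <= pr B.
Proof.
move=> mA mB AB; apply: (@pr_null_eq _ Q A B (~` regular)) => //.
- by apply: measurableC; exact: measurable_regular.
- exact: pr_not_regular.
- by move=> z /contrapT; exact: AB.
Qed.

Variables (eps : R) (n1 : nat).
Hypothesis eps01 : 0 < eps <= 1.
Hypothesis n12 : (2 <= n1)%N.
Hypothesis eps_le : forall k, (n1 <= k)%N -> eps <= q k /\ (~~ isX -> eps <= p2 k).

Lemma walkX_up k : isX -> (n1 <= k)%N -> eps <= tr k k.+1.
Proof.
move=> iX nk; have [qe _] := eps_le nk; rewrite /walk iX /transX.
have [-> ->] : (k == 0%N) = false /\ (k == 1%N) = false by split; apply/eqP; lia.
by rewrite eqxx.
Qed.

Lemma walkY_up k : ~~ isX -> (n1 <= k)%N -> eps <= tr k k.+2.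
Proof.
move=> iX nk; have [_ /(_ iX) pe] := eps_le nk; rewrite /walk (negbTE iX) /transY.
have [-> ->] : (k == 0%N) = false /\ (k == 1%N) = false by split; apply/eqP; lia.
have [-> ->] : (k.+2 == k - 1)%N = false /\ (k.+2 == k.+1)%N = false by split; apply/eqP; lia.
by rewrite eqxx.
Qed.

Lemma walkY_down k : ~~ isX -> (n1 <= k)%N -> eps <= tr k (k - 1).
Proof.
move=> iX nk; have [qe _] := eps_le nk; rewrite /walk (negbTE iX) /transY.
have [-> ->] : (k == 0%N) = false /\ (k == 1%N) = false by split; apply/eqP; lia.
by rewrite eqxx.
Qed.

Lemma pr_next_ge t (F : set paths) x y : past t F -> F `<=` [set z | z t = x] ->
  eps <= tr x y -> eps * pr F <= pr (F `&` [set z | z t.+1 = y]).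
Proof.
by move=> pF Fx le; rewrite (pr_next tr_ge0 QZ _ pF Fx) ler_wpM2r// pr_ge0.
Qed.

(* X enters level [n] at [n] and then steps up. Y might enter level [n] at [n], which
   spoils the cutpoint, so it is stopped at level [n - 2]: from [n - 1] it jumps to
   [n + 1], and from [n - 2] it follows [n - 3, n - 1, n + 1] (as p1 may vanish). *)
Lemma pr_pass_ge t (F : set paths) x n (B : pred nat) (v : R) :
  past t F -> F `<=` [set z | z t = x] ->
  F `<=` [set z | forall r, (r <= t)%N -> (z r < n)%N] ->
  (x + 3 <= n)%N -> (n1 + 3 <= n)%N -> 0 <= v ->
  (forall k, (n - 3 <= k)%N -> ~~ B k) ->
  pr (F `&` shift t (hit B [pred k | (n - 2 * ~~ isX <= k)%N])) <= (1 - v) * pr F ->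
  eps ^+ 3 * v * pr F <= pr (F `&` [set z | exists s, pass n s z /\
    forall r, (t <= r)%N -> (r <= s)%N -> ~~ B (z r)]).
Proof.
move=> pF Fx Flt xn nn v0 Bn hitle; set L := (n - 2 * ~~ isX)%N in hitle.
have [n3 [m3 [m2 m1]]] : (3 <= n /\ n1 <= n - 3 /\ n1 <= n - 2 /\ n1 <= n - 1)%N.
  by clear -nn n12; lia.
have [N1 [N2 N3]] : ((n - 1).+2 = n.+1 /\ n - 2 - 1 = n - 3 /\ (n - 3).+2 = n - 1)%N.
  by clear -n3; lia.
have [d1 [d2 d3]] : (n - 1 < n /\ n - 2 < n /\ n - 3 < n)%N by clear -n3; lia.
have [g1 [g2 g0]] : (n - 3 <= n - 1 /\ n - 3 <= n - 2 /\ n - 3 <= n.+1)%N by clear; lia.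
have d12 : (n - 2)%N <> (n - 1)%N by clear -n3; lia.
set V := [set z | exists s, pass n s z /\ _].
have /andP[e0 e1] := eps01.
(* After reaching level [L], X spends one factor [eps] and Y one or three; the exponent 3 covers all
   cases. *)
have e3le : eps ^+ 3 <= eps by rewrite exprS ger_pMr// exprn_ile1// ltW.
have mF := past_measurable pF.
have mB i : measurable ([set z | ~~ B (z i)] : set paths).
  exact: (@measurable_coord i (fun k => ~~ B k)).
have mV : measurable (V : set paths).
  apply: measurable_ex => s; apply: measurable_and; first exact: measurable_pass.
  by meas; exact: mB.
(* Decomposition by the first time [s] from [t] on at level [L] or above, with [B] avoided before;
   each [E s] is decided at time [s]. *)
pose E s := [set z : nat -> nat | (forall r, (t <= r)%N -> (r < s)%N ->
    (z r < L)%N /\ ~~ B (z r)) /\ (L <= z s)%N /\ (t <= s)%N] : set paths.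
have pE s : past s (E s).
  move=> z z' zz' [lt1 [zL ts]]; split; last by rewrite -zz'.
  by move=> r tr rs; rewrite -zz' ?(ltnW rs)//; exact: lt1.
have mE s : measurable (E s) by exact: past_measurable (pE s).
have tE : trivIset setT E.
  apply/trivIsetP => i j _ _ /eqP ij; apply/seteqP; split => // z.
  move=> [[lt1 [zi ti]] [lt2 [zj tj]]]; apply: ij; apply/eqP.
  rewrite eqn_leq; apply/andP; split; rewrite leqNgt; apply/negP.
    by move=> /(lt1 _ tj)[]; rewrite ltnNge zj.
  by move=> /(lt2 _ ti)[]; rewrite ltnNge zi.
have mEU : measurable (F `&` \bigcup_s E s) by apply: measurableI => //; exact: bigcupT_measurable.
have reach : v * pr F <= pr (F `&` \bigcup_s E s).
  set H := hit _ _ in hitle.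
  have mH : measurable (shift t H : set paths) by apply: shift_measurable; exact: measurable_hit.
  have mFH : measurable (F `&` shift t H) by exact: measurableI.
  suff : pr F <= pr (F `&` \bigcup_s E s) + pr (F `&` shift t H) by lra.
  apply: le_trans (pr_setU_le Q mEU mFH); apply: pr_regular_le => //.
    exact: measurableU.
  move=> z [step unb] Fz; have ex0 : exists s, (L <= z (t + s))%N by exact: unb.
  case: (ex_minnP ex0) => s Ls mins.
  have lts r : (r < s)%N -> (z (t + r) < L)%N.
    by move=> rs; rewrite ltnNge; apply/negP => /mins; rewrite leqNgt rs.
  have [[r [rs Br]]|noB] := pselect (exists r, (r < s)%N /\ B (z (t + r)%N)).
    right; split => //; exists r; split => // r' r'r; rewrite /= -ltnNge.
    by apply: lts; exact: ltn_trans rs.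
  left; split => //; exists (t + s)%N => //; split; last by split => //; exact: leq_addr.
  move=> r tr rs; have rE : r = (t + (r - t))%N by rewrite subnKC.
  have rts : (r - t < s)%N by lia.
  rewrite rE; split; first exact: lts.
  by apply/negP => Br; apply: noB; exists (r - t)%N.
suff : eps ^+ 3 * pr (F `&` \bigcup_s E s) <= pr ((F `&` V) `&` \bigcup_s E s).
  have : pr ((F `&` V) `&` \bigcup_s E s) <= pr (F `&` V).
    apply: pr_le; last by move=> z [].
      by apply: measurableI; [exact: measurableI|exact: bigcupT_measurable].
    exact: measurableI.
  have := ler_wpM2l (exprn_ge0 3 (ltW e0)) reach; rewrite mulrA; lra.
apply: pr_bigcup_ge => //; first by rewrite exprn_ge0// ltW.
  exact: measurableI.
move=> s; have mFE : measurable (F `&` E s) by exact: measurableI.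
have mFVE : measurable (F `&` V `&` E s) by apply: measurableI => //; exact: measurableI.
have [ts|st] := leqP t s; last first.
  rewrite [F `&` E s](_ : _ = set0) ?pr_set0 ?mulr0 ?pr_ge0//.
  by apply/seteqP; split => // z [_ [_ [_]]]; rewrite leqNgt st.
have pFE : past s (F `&` E s) by apply: pastI => //; exact: pastW pF.
have Lx : (x < L)%N by rewrite /L; clear -xn; case: isX => /=; lia.
have Es z : (F `&` E s) z -> (t < s)%N.
  move=> [Fz [_ [zL _]]]; rewrite ltn_neqAle ts andbT; apply/eqP => tseq.
  by move: zL; rewrite -tseq (Fx _ Fz) leqNgt Lx.
have Fb z r : (F `&` E s) z -> (r < s)%N -> (z r < n)%N.
  move=> [Fz [lt1 _]] rs; have [/(Flt _ Fz)//|tr] := leqP r t.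
  have [+ _] := lt1 _ (ltnW tr) rs; rewrite /L; clear; lia.
have FB z r : (F `&` E s) z -> (t <= r)%N -> (r < s)%N -> ~~ B (z r).
  by move=> [Fz [lt1 _]] tr rs; have [_] := lt1 _ tr rs.
have [iX|iX] := boolP isX.
  have Ln : L = n by rewrite /L iX muln0 subn0.
  pose G := F `&` E s `&` [set z | z s = n].
  have pG : past s G by apply: pastI => //; exact: past_at.
  have mG := past_measurable pG.
  have Gn : G `<=` [set z | z s = n] by move=> z [].
  have le1 : pr (F `&` E s) <= pr G.
    apply: pr_regular_le => // z [step _] FEz; split => //=.
    have tls := Es _ FEz; case: (FEz) => _ [lt1 [zL _]].
    have s0 : (0 < s)%N by exact: leq_ltn_trans tls.
    have := walkX_jump iX (step s.-1); rewrite prednK//.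
    have [||] := lt1 s.-1; rewrite ?prednK//; first by rewrite -ltnS prednK.
    by move: zL; rewrite Ln; clear; lia.
  apply: (@le_trans _ _ (eps * pr G)).
    by apply: ler_pM => //; rewrite ?exprn_ge0 ?pr_ge0// ltW.
  apply: le_trans (pr_next_ge pG Gn (walkX_up iX _)) _.
    exact: leq_trans m1 (leq_subr _ _).
  apply: pr_le => //; first by apply: measurableI => //; meas.
  move=> z [[FEz zs] zs1]; case: (FEz) => Fz Ez.
  split => //; split => //; exists s; split.
    split; first by move=> r; exact: Fb.
    by rewrite iX addn0; split.
  move=> r tr; rewrite leq_eqVlt => /orP[/eqP ->|]; last exact: FB.
  by rewrite zs; apply: Bn; exact: leq_subr.
have Ln : L = (n - 2)%N by rewrite /L (negbTE iX) muln1.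
pose G1 := F `&` E s `&` [set z | z s = (n - 1)%N].
pose G2 := F `&` E s `&` [set z | z s = (n - 2)%N].
have pG1 : past s G1 by apply: pastI => //; exact: past_at.
have pG2 : past s G2 by apply: pastI => //; exact: past_at.
have mG1 := past_measurable pG1; have mG2 := past_measurable pG2.
have le1 : pr (F `&` E s) <= pr G1 + pr G2.
  apply: le_trans (pr_setU_le Q mG1 mG2); apply: pr_regular_le => //.
    exact: measurableU.
  move=> z [step _] FEz; have tls := Es _ FEz; case: (FEz) => _ [lt1 [zL _]].
  have s0 : (0 < s)%N by exact: leq_ltn_trans tls.
  have [] := walkY_jump iX (step s.-1); rewrite prednK//.
  have [||] := lt1 s.-1; rewrite ?prednK//; first by rewrite -ltnS prednK.
  move=> zlt _ j1 j2; have [zs|zs] : z s = (n - 1)%N \/ z s = (n - 2)%N.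
  - by move: zL zlt j1; rewrite Ln; clear -n3; lia.
  - by left.
  - by right.
pose H1 := G1 `&` [set z | z s.+1 = n.+1].
pose K1 := G2 `&` [set z | z s.+1 = (n - 3)%N].
pose K2 := K1 `&` [set z | z s.+2 = (n - 1)%N].
pose H2 := K2 `&` [set z | z s.+3 = n.+1].
have pH1 : past s.+1 H1 by exact: past_next.
have pK1 : past s.+1 K1 by exact: past_next.
have pK2 : past s.+2 K2 by exact: past_next.
have pH2 : past s.+3 H2 by exact: past_next.
have mH1 := past_measurable pH1; have mH2 := past_measurable pH2.
have hH1 : eps * pr G1 <= pr H1.
  apply: (@pr_next_ge s _ (n - 1)) => //; first by move=> z [].
  by rewrite -N1; exact: walkY_up.
have hK1 : eps * pr G2 <= pr K1.
  apply: (@pr_next_ge s _ (n - 2)) => //; first by move=> z [].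
  by rewrite -N2; exact: walkY_down.
have hK2 : eps * pr K1 <= pr K2.
  apply: (@pr_next_ge s.+1 _ (n - 3)) => //; first by move=> z [].
  by rewrite -N3; exact: walkY_up.
have hH2 : eps * pr K2 <= pr H2.
  apply: (@pr_next_ge s.+2 _ (n - 1)) => //; first by move=> z [].
  by rewrite -N1; exact: walkY_up.
have passY s' z : z s' = n.+1 -> (forall r, (r < s')%N -> (z r < n)%N) -> pass n s' z.
  by move=> zs zlt; split => //; rewrite iX addn1; split => // iX'; rewrite iX' in iX.
have sub1 : H1 `<=` F `&` V `&` E s.
  move=> z [[FEz /= zs] zs1]; case: (FEz) => Fz Ez.
  split => //; split => //; exists s.+1; split.
    apply: passY => // r; rewrite ltnS leq_eqVlt => /orP[/eqP ->|]; last exact: Fb.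
    by rewrite zs.
  move=> r tr; rewrite leq_eqVlt => /orP[/eqP ->|]; first by apply: Bn; rewrite zs1.
  rewrite ltnS leq_eqVlt => /orP[/eqP ->|]; last exact: FB.
  by apply: Bn; rewrite zs.
have sub2 : H2 `<=` F `&` V `&` E s.
  move=> z [[[[FEz /= zs] /= zs1] /= zs2] /= zs3]; case: (FEz) => Fz Ez.
  split => //; split => //; exists s.+3; split.
    apply: passY => // r.
    rewrite ltnS leq_eqVlt => /orP[/eqP ->|]; first by rewrite zs2.
    rewrite ltnS leq_eqVlt => /orP[/eqP ->|]; first by rewrite zs1.
    rewrite ltnS leq_eqVlt => /orP[/eqP ->|]; last exact: Fb.
    by rewrite zs.
  move=> r tr; rewrite leq_eqVlt => /orP[/eqP ->|]; first by apply: Bn; rewrite zs3.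
  rewrite ltnS leq_eqVlt => /orP[/eqP ->|]; first by apply: Bn; rewrite zs2.
  rewrite ltnS leq_eqVlt => /orP[/eqP ->|]; first by apply: Bn; rewrite zs1.
  rewrite ltnS leq_eqVlt => /orP[/eqP ->|]; last exact: FB.
  by apply: Bn; rewrite zs.
have le2 : pr H1 + pr H2 <= pr (F `&` V `&` E s).
  have mEq : measurable ([set z | z s = (n - 1)%N] : set paths) by meas.
  rewrite (pr_split Q mFVE mEq); apply: lerD; apply: pr_le => //.
  - exact: measurableI.
  - by move=> z H1z; split; [exact: sub1|case: H1z => -[]].
  - by apply: measurableI => //; exact: measurableC.
  - move=> z H2z; split; first exact: sub2.
    by case: H2z => -[[[_ /= zs] _] _] _ /=; rewrite zs.
have G10 := pr_ge0 Q G1.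
apply: le_trans le2; apply: (@le_trans _ _ (eps ^+ 3 * (pr G1 + pr G2))).
  by rewrite ler_wpM2l// exprn_ge0// ltW.
rewrite mulrDr; apply: lerD; first by apply: le_trans hH1; rewrite ler_wpM2r.
apply: le_trans hH2; rewrite 2!exprS expr1 -!mulrA ler_wpM2l//; first exact: ltW.
by apply: le_trans hK2; rewrite ler_wpM2l// ltW.
Qed.

End Passage.

(** * Harmonic estimates *)

Section Scale.
Context {R : realType} (r : nat -> R) (n1 : nat).
Hypothesis r01 : forall k, (n1 <= k)%N -> 2^-1 <= r k <= 1.

Definition cprod (j : nat) : R := \prod_(n1 <= i < j) r i.
(** Discrete counterpart of the scale function of a diffusion. Empty products make its increments
    equal to 1 up to [n1]. *)
Definition scale (x : nat) : R := \sum_(j < x) cprod j.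
(** The term [j = m] is an empty product and supplies the leading 1 of D(m). *)
Definition Dpart (m n : nat) : R :=
  \sum_(m <= j < n) \prod_(m.+1 <= i < j.+1) r i.

Lemma cprod_gt0 j : 0 < cprod j.
Proof.
rewrite /cprod big_nat_cond; apply: prodr_gt0 => i /andP[/andP[/r01/andP[r1 _] _] _].
by apply: lt_le_trans r1; rewrite invr_gt0.
Qed.

Lemma cprodS j : (n1 <= j)%N -> cprod j.+1 = r j * cprod j.
Proof. by move=> nj; rewrite /cprod big_nat_recr//= mulrC. Qed.

Lemma cprodSle j : cprod j.+1 <= cprod j.
Proof.
have [nj|jn] := leqP n1 j; last by rewrite /cprod !big_geq// ltnW.
have /andP[_ r1] := r01 nj.
by rewrite cprodS// ger_pMl// cprod_gt0.
Qed.

(** The lower bound 1/2 on the ratios makes neighbouring increments of [scale] comparable, so that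
    shifting an index costs only a constant. *)
Lemma cprod_half j : cprod j <= 2 * cprod j.+1.
Proof.
have c0 := cprod_gt0 j; have [nj|jn] := leqP n1 j.
  by have /andP[rh _] := r01 nj; rewrite cprodS//; nra.
rewrite /cprod !big_geq//; last exact: ltnW.
by lra.
Qed.

Lemma cprod_le i j : (i <= j)%N -> cprod j <= cprod i.
Proof.
move=> /subnKC <-; elim: (j - i)%N => [|k IH]; first by rewrite addn0.
by rewrite addnS; apply: le_trans IH; exact: cprodSle.
Qed.

Lemma scaleS x : scale x.+1 = scale x + cprod x.
Proof. by rewrite /scale big_ord_recr. Qed.

Lemma scale_le x y : (x <= y)%N -> scale x <= scale y.
Proof.
move=> /subnKC <-; elim: (y - x)%N => [|k IH]; first by rewrite addn0.
by rewrite addnS scaleS; apply: le_trans IH _; rewrite lerDl ltW// cprod_gt0.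
Qed.

Lemma scale_lt x y : (x < y)%N -> scale x < scale y.
Proof.
move=> xy; apply: (@lt_le_trans _ _ (scale x.+1)); last exact: scale_le.
by rewrite scaleS ltrDl cprod_gt0.
Qed.

Lemma scaleB x n : scale (x + n) - scale x <= n%:R * cprod x.
Proof.
elim: n => [|n IH]; first by rewrite addn0 subrr mul0r.
rewrite addnS scaleS -natr1 mulrDl mul1r.
by have := cprod_le (leq_addr n x); lra.
Qed.

(** Every product [cprod j] with [j > m] contains [cprod m.+1]; this factorization is how hitting
    estimates stated with [scale] turn into estimates with D. *)
Lemma DpartE m n : (n1 <= m)%N -> (m <= n)%N ->
  cprod m.+1 * Dpart m n = scale n.+1 - scale m.+1.
Proof.
move=> nm /subnKC <-; rewrite /Dpart; elim: (n - m)%N => [|k IH]; first by rewrite addn0 big_geq// subrr mulr0.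
rewrite addnS big_nat_recr ?leq_addr//= mulrDr IH (scaleS (m + k).+1) [RHS]addrAC; congr (_ + _).
by rewrite /cprod -big_cat_nat//= ?ltnS ?leq_addr//; exact: leqW.
Qed.

Lemma DpartS m n : (m <= n)%N -> Dpart m n.+1 = Dpart m n + \prod_(m.+1 <= i < n.+1) r i.
Proof. by move=> mn; rewrite /Dpart big_nat_recr. Qed.

Lemma Dpart_prod_ge0 m n : (n1 <= m)%N -> 0 <= \prod_(m.+1 <= i < n) r i.
Proof.
move=> nm; rewrite big_nat_cond; apply: prodr_ge0 => i /andP[/andP[mi _] _].
have /andP[ri _] := r01 (leq_trans nm (ltnW mi)).
by apply: le_trans ri; rewrite invr_ge0.
Qed.

Lemma Dpart_prod_le1 m n : (n1 <= m)%N -> \prod_(m.+1 <= i < n) r i <= 1.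
Proof.
move=> nm; rewrite big_nat_cond; apply: prodr_ile1 => i /andP[/andP[mi _] _].
have /andP[ri ->] := r01 (leq_trans nm (ltnW mi)).
by rewrite andbT; apply: le_trans ri; rewrite invr_ge0.
Qed.

Lemma Dpart_nd m n n' : (n1 <= m)%N -> (m <= n)%N -> (n <= n')%N -> Dpart m n <= Dpart m n'.
Proof.
move=> nm mn /subnKC <-; elim: (n' - n)%N => [|k IH]; first by rewrite addn0.
rewrite addnS DpartS; last exact: leq_trans mn (leq_addr _ _).
by apply: le_trans IH _; rewrite lerDl Dpart_prod_ge0.
Qed.

Lemma Dpart1 m : Dpart m m.+1 = 1.
Proof. by rewrite /Dpart big_nat1 big_geq. Qed.

Lemma Dpart_ge1 m n : (n1 <= m)%N -> (m < n)%N -> 1 <= Dpart m n.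
Proof. by move=> nm mn; rewrite -(Dpart1 m); exact: Dpart_nd. Qed.

End Scale.

(** * Superharmonic and subharmonic potentials *)

Section Potential.
Context {R : realType} (isX : bool) (q p1 p2 : nat -> R).
Hypothesis Hq : forall k, (2 <= k)%N ->
  0 < q k /\ 0 <= p1 k /\ 0 < p2 k /\ q k + p1 k + p2 k = 1.
Local Notation tr := (walk isX q p1 p2).
Context (r : nat -> R) (n1 : nat).
Hypothesis n12 : (2 <= n1)%N.
Hypothesis r01 : forall k, (n1 <= k)%N -> 2^-1 <= r k <= 1.
Hypothesis r_nd : forall k, (n1 <= k)%N -> r k <= r k.+1.
Hypothesis r_char : forall k, (n1 <= k)%N ->
  if isX then q k * r k ^+ 2 = (p1 k + p2 k) * r k + p2 k
  else q k = (p1 k + p2 k) * r k + p2 k * r k ^+ 2.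
Local Notation cprod := (cprod r n1).
Local Notation scale := (scale r n1).
Local Notation Dpart := (Dpart r).
Let cprod0 := cprod_gt0 r01.

(** In units of [cprod (x - 1)] the drift involves [r (x - 1)] and [r x]. Were they equal, [r_char]
    would make it zero; the smaller [r (x - 1)] in place of one occurrence of [r x] gives it its
    sign. The offset [isX] aligns the increments with those crossed by the jumps. *)
Lemma scale_super x : (n1 + 2 <= x)%N ->
  \sum_(y < x + 3) tr x y * scale (y + isX) <= scale (x + isX).
Proof.
move=> nx; have x2 : (2 <= x)%N by lia.
have [q0 [p10 [p20 s1]]] := Hq x2.
have e1 : (x - 1).+1 = x by lia.
have nx1 : (n1 <= x - 1)%N by lia. have nx0 : (n1 <= x)%N by lia.
have c0 := cprod0 (x - 1); have := cprodS r nx1; rewrite e1 => c1.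
have c2 := cprodS r nx0; have := scaleS r n1 (x - 1); rewrite e1 => s1x.
have rc := r_char nx0; have := r_nd nx1; rewrite e1 => ruv.
have /andP[v0 v1] := r01 nx1; have /andP[u0 u1] := r01 nx0.
have [iX|iX] := boolP isX.
  have /= -> := @walkX_sum _ true q p1 p2 x (fun y => scale (y + true)) isT x2; rewrite iX in rc.
  have e2 : (x - 2 + 1 = x - 1)%N by lia.
  rewrite !addn1 e1 -(addn1 (x - 2)) e2 !scaleS c2 c1 s1x.
  move: rc c0 v0 v1 u0 u1 ruv; set u := r x; set v := r (x - 1)%N; set P := cprod _; set S := scale _.
  move=> rc c0 v0 v1 u0 u1 ruv.
  have key : q x * (u * v) <= (p1 x + p2 x) * v + p2 x.
    have up : 0 < u by lra.
    rewrite -(ler_pM2l up); nra.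
  have := ler_wpM2r (ltW c0) key; have := congr1 (fun y => y * (S + P + v * P)) s1.
  by nra.
have /= -> := @walkY_sum _ false q p1 p2 x (fun y => scale (y + false)) isT x2; rewrite (negbTE iX) in rc.
rewrite !addn0 !scaleS c2 c1 s1x.
move: rc c0 v0 v1 u0 u1 ruv; set u := r x; set v := r (x - 1)%N; set P := cprod _; set S := scale _.
move=> rc c0 v0 v1 u0 u1 ruv.
have key : (p1 x + p2 x) * v + p2 x * (v * u) <= q x by rewrite rc; nra.
have := ler_wpM2r (ltW c0) key; have := congr1 (fun y => y * (S + P)) s1.
by nra.
Qed.

(** One index further the drift involves [r x] and [r x.+1] instead, so a factor [r x] of [r_char]
    is now replaced by a larger one and the sign flips. *)
Lemma scale_sub x : (n1 <= x)%N ->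
  scale (x.+1 + isX) <= \sum_(y < x + 3) tr x y * scale (y.+1 + isX).
Proof.
move=> nx; have x2 : (2 <= x)%N by lia.
have [q0 [p10 [p20 s1]]] := Hq x2.
have e1 : (x - 1).+1 = x by lia.
have c0 := cprod0 x; have c1 := cprodS r nx.
have c2 := cprodS r (leqW nx).
have rc := r_char nx; have ruv := r_nd nx.
have /andP[u0 u1] := r01 nx; have /andP[w0 w1] := r01 (leqW nx).
have [iX|iX] := boolP isX.
  have /= -> := @walkX_sum _ true q p1 p2 x (fun y => scale (y.+1 + true)) isT x2; rewrite iX in rc.
  have e2 : ((x - 2).+1 + 1 = x)%N by lia.
  rewrite e2 !addn1 e1 !scaleS c2 c1.
  move: rc c0 w0 w1 u0 u1 ruv; set u := r x; set w := r _; set P := cprod _; set S := scale _.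
  move=> rc c0 w0 w1 u0 u1 ruv.
  have key : (p1 x + p2 x) * u + p2 x <= q x * (w * u) by rewrite -rc expr2; nra.
  have := ler_wpM2r (ltW c0) key; have := congr1 (fun y => y * (S + P + u * P)) s1.
  by nra.
have /= -> := @walkY_sum _ false q p1 p2 x (fun y => scale (y.+1 + false)) isT x2; rewrite (negbTE iX) in rc.
rewrite !addn0 e1 !scaleS c2 c1.
move: rc c0 w0 w1 u0 u1 ruv; set u := r x; set w := r _; set P := cprod _; set S := scale _.
move=> rc c0 w0 w1 u0 u1 ruv.
have key : q x <= (p1 x + p2 x) * u + p2 x * (w * u).
  have : p2 x * (u * u) <= p2 x * (w * u) by rewrite ler_pM2l// ler_wpM2r//; lra.
  by rewrite rc expr2; lra.
have := ler_wpM2r (ltW c0) key; have := congr1 (fun y => y * (S + P)) s1.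
by nra.
Qed.

End Potential.

Section Estimates.
Context {R : realType} (isX : bool) (q p1 p2 : nat -> R).
Hypothesis Hq : forall k, (2 <= k)%N ->
  0 < q k /\ 0 <= p1 k /\ 0 < p2 k /\ q k + p1 k + p2 k = 1.
Local Notation tr := (walk isX q p1 p2).
Local Notation pass := (pass isX).
Local Notation cut := (is_cutpoint isX).
Context (r : nat -> R) (n1 : nat).
Hypothesis n12 : (2 <= n1)%N.
Hypothesis r01 : forall k, (n1 <= k)%N -> 2^-1 <= r k <= 1.
Hypothesis r_nd : forall k, (n1 <= k)%N -> r k <= r k.+1.
Hypothesis r_char : forall k, (n1 <= k)%N ->
  if isX then q k * r k ^+ 2 = (p1 k + p2 k) * r k + p2 k
  else q k = (p1 k + p2 k) * r k + p2 k * r k ^+ 2.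
Variable eps : R.
Hypothesis eps01 : 0 < eps <= 1.
Hypothesis eps_le : forall k, (n1 <= k)%N -> eps <= q k /\ (~~ isX -> eps <= p2 k).
Local Notation cprod := (cprod r n1).
Local Notation scale := (scale r n1).
Local Notation Dpart := (Dpart r).
Context (Q : probability paths R) (x0 : nat) (QZ : markov_paths Q x0 tr).
Local Notation pr := (pr Q).
Let tr_ge0 := walk_ge0 isX Hq.
Let tr_sum := walk_sum1 isX Hq.
Let cprod0 := cprod_gt0 r01.

Section Start.
Variables (m t : nat) (F : set paths).
Hypothesis nm : (n1 < m)%N.
Hypothesis pF : past t F.
Hypothesis Fm : F `<=` [set z | z t = m.+1].

(** A truncated affine function of [scale] is superharmonic between the two levels, at least 1 from
    [n] on, and of size at most 3 / D(m, n) at the starting point. *)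
Lemma pr_reach_le n : (m < n)%N ->
  pr (F `&` shift t (hit [pred k | (n <= k)%N] [pred k | (k <= m)%N])) * Dpart m n
    <= 3 * pr F.
Proof.
move=> mn; set d := scale (n + isX) - scale m.
have d0 : 0 < d by rewrite subr_gt0; apply: scale_lt => //; exact: ltn_addr.
(* From a site above [m], X lands on [m - 1] or higher and Y on [m] or higher, so [m <= y + isX]
   throughout and the truncation is inactive. *)
pose f y : R := Num.max 0 ((scale (y + isX) - scale m) / d).
have fE y : (m <= y + isX)%N -> f y = d^-1 * scale (y + isX) - d^-1 * scale m.
  move=> my; rewrite /f max_r; first by ring.
  by apply: divr_ge0; [rewrite subr_ge0; exact: scale_le|exact: ltW].
have fpos y : 0 <= f y by rewrite /f le_max lexx.
have f1 y : [pred k | (n <= k)%N] y -> 1 <= f y.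
  move=> /= ny; rewrite /f le_max; apply/orP; right; rewrite ler_pdivlMr// mul1r.
  by rewrite lerB// scale_le// leq_add2r.
have := pr_hit_le tr_ge0 tr_sum QZ (A := [pred k | (n <= k)%N])
  (B := [pred k | (k <= m)%N]) fpos f1 _ pF Fm.
move=> /(_ _)/le_trans H; apply: (@le_trans _ _ (f m.+1 * pr F * Dpart m n)).
  apply: ler_wpM2r.
    by apply: le_trans (Dpart_ge1 r01 (ltnW nm) mn).
  apply: H; last exact: lexx.
  move=> y /= _; rewrite -ltnNge => my; have y2 : (2 <= y)%N.
    by apply: leq_trans n12 _; apply: leq_trans (ltnW nm) (ltnW my).
  rewrite (eq_walk_sum Hq (g := fun k => d^-1 * scale (k + isX) - d^-1 * scale m)); last first.
    move=> k tk; have [yk _] := walk_range y2 tk; apply: fE; clear -my yk; case: isX yk => /=; lia.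
  rewrite fE; last by rewrite (leq_trans (ltnW my))// leq_addr.
  rewrite (eq_bigr (fun k : 'I_(y + 3) =>
    d^-1 * (tr y k * scale (k + isX)) - tr y k * (d^-1 * scale m))); last first.
    by move=> k _; ring.
  rewrite sumrB -mulr_suml -mulr_sumr tr_sum mul1r lerD2r ler_wpM2l ?invr_ge0 ?(ltW d0)//.
  by apply: scale_super => //; clear -nm my; lia.
rewrite mulrAC; apply: ler_wpM2r; first exact: pr_ge0.
rewrite fE; last by rewrite (leq_trans (leqnSn m))// leq_addr.
rewrite -mulrBr -mulrA mulrC ler_pdivrMr//.
have c1 := cprod0 m.+1; have ch := cprod_half r01 m.
rewrite -(ler_pM2l c1) mulrCA DpartE//; last 2 first.
- exact: ltnW.
- exact: ltnW.
(* For X this is [cprod m + cprod m.+1], for Y only [cprod m], and [cprod m] is at most twice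
   [cprod m.+1]. *)
have e1 : scale (m.+1 + isX) - scale m <= 3 * cprod m.+1.
  by case: isX; rewrite ?addn1 ?addn0 !scaleS; lra.
have e2 : scale n.+1 - scale m.+1 <= d.
  rewrite /d; case: isX; first by rewrite addn1 lerB// scale_le.
  by rewrite addn0 !scaleS; have := cprod_le r01 (ltnW mn); lra.
have d0' : 0 <= scale n.+1 - scale m.+1 by rewrite subr_ge0 scale_le// ltnW.
rewrite mulrA; apply: ler_pM => //; last by rewrite mulrC.
by rewrite subr_ge0 scale_le// (leq_trans (leqnSn m))// leq_addr.
Qed.

Lemma pr_above_le n : (m < n)%N ->
  pr (F `&` shift t (above m)) * Dpart m n <= 3 * pr F.
Proof.
move=> mn; apply: le_trans (pr_reach_le mn).
apply: ler_wpM2r; first by apply: le_trans (Dpart_ge1 r01 (ltnW nm) mn).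
have mF := past_measurable pF.
apply: (pr_regular_le Hq QZ).
- by apply: measurableI => //; apply: shift_measurable; exact: measurable_above.
- by apply: measurableI => //; apply: shift_measurable; exact: measurable_hit.
move=> z [_ unb] [Fz ab]; split => //; have [s ns] := unb t n.
by exists s; split => // k _; rewrite /= -ltnNge; exact: ab.
Qed.

(** One minus a normalized increment of the subharmonic potential is superharmonic. The bound [S]
    includes the overshoot: a jump from [y] leads to an argument of [scale] at most [y + 3], so the
    truncation at 0 stays inactive. *)
Lemma pr_below_le (B : pred nat) (S : R) : 0 < S -> ~~ B m.+1 ->
  (forall y, (m < y)%N -> ~~ B y -> scale (y + 3) - scale (m.+1 + isX) <= S) ->
  pr (F `&` shift t (hit [pred k | (k <= m)%N] B)) <= (1 - cprod (m.+1 + isX) / S) * pr F.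
Proof.
move=> S0 Bm HS; set c := scale (m.+1 + isX) in HS *.
pose f y : R := Num.max 0 (1 - (scale (y.+1 + isX) - c) / S).
have fE y : scale (y.+1 + isX) - c <= S ->
    f y = (1 + S^-1 * c) - S^-1 * scale (y.+1 + isX).
  move=> le; rewrite /f max_r; first by ring.
  by rewrite subr_ge0 ler_pdivrMr// mul1r.
have fpos y : 0 <= f y by rewrite /f le_max lexx.
have f1 y : [pred k | (k <= m)%N] y -> 1 <= f y.
  move=> /= ym; rewrite /f le_max; apply/orP; right.
  rewrite lerDl oppr_ge0 pmulr_lle0 ?invr_gt0// subr_le0 /c; apply: scale_le => //.
  by rewrite leq_add2r.
have le3 y : (m < y)%N -> ~~ B y -> forall k, (k <= y.+1 + ~~ isX)%N ->
    scale (k.+1 + isX) - c <= S.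
  move=> my By k ky; apply: le_trans (HS _ my By); rewrite lerB// scale_le//.
  by clear -ky; case: isX ky => /=; lia.
have := pr_hit_le tr_ge0 tr_sum QZ (A := [pred k | (k <= m)%N]) (B := B) fpos f1 _ pF Fm.
move=> /(_ _)/le_trans; apply.
  move=> y /=; rewrite -ltnNge => my By; have y2 : (2 <= y)%N.
    by apply: leq_trans n12 _; apply: leq_trans (ltnW nm) (ltnW my).
  rewrite (eq_walk_sum Hq (g := fun k => (1 + S^-1 * c) - S^-1 * scale (k.+1 + isX))); last first.
    by move=> k tk; have [_ yk] := walk_range y2 tk; apply: fE; exact: le3 By _ yk.
  rewrite fE; last by apply: (le3 _ my By); rewrite (leq_trans (leqnSn y))// leq_addr.
  rewrite (eq_bigr (fun k : 'I_(y + 3) =>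
    tr y k * (1 + S^-1 * c) - S^-1 * (tr y k * scale (k.+1 + isX)))); last first.
    by move=> k _; ring.
  rewrite sumrB -mulr_suml -mulr_sumr tr_sum mul1r lerD2l lerN2 ler_wpM2l ?invr_ge0 ?(ltW S0)//.
  by apply: scale_sub => //; exact: leq_trans (ltnW nm) (ltnW my).
apply: ler_wpM2r; first exact: pr_ge0.
rewrite fE; last by apply: (le3 _ (ltnSn m) Bm); rewrite (leq_trans (leqnSn _))// leq_addr.
have -> : scale (m.+2 + isX) = c + cprod (m.+1 + isX) by rewrite -scaleS -addSn.
by rewrite mulrDr [_ / S]mulrC; lra.
Qed.

(** With no upper exit, [S] bounds all of the scale beyond [m + 1]. The factor 2 pays for X, where
    the numerator is [cprod m.+2] instead of [cprod m.+1]. *)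
Lemma pr_above_ge (D : R) : 0 < D -> (forall n, (m < n)%N -> Dpart m n <= D) ->
  (2 * D)^-1 * pr F <= pr (F `&` shift t (above m)).
Proof.
move=> D0 HD; have mF := past_measurable pF.
have c1 := cprod0 m.+1; have S0 : 0 < cprod m.+1 * D by rewrite mulr_gt0.
have HS y : (m < y)%N -> ~~ pred0 y -> scale (y + 3) - scale (m.+1 + isX) <= cprod m.+1 * D.
  move=> my _; apply: (@le_trans _ _ (scale (y + 3) - scale m.+1)).
    by rewrite lerB// scale_le// leq_addr.
  rewrite addn3 -DpartE//; last 2 first.
  - exact: ltnW.
  - by apply: leq_trans (ltnW my) _; rewrite leqW.
  rewrite ler_wpM2l//; first exact: ltW.
  by apply: HD; rewrite !ltnS; exact: leq_trans (ltnW my) _.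
have le := @pr_below_le pred0 _ S0 isT HS.
have mA : measurable (shift t (above m) : set paths).
  by apply: shift_measurable; exact: measurable_above.
have := pr_split Q mF mA.
have -> : F `&` ~` shift t (above m) = F `&` shift t (hit [pred k | (k <= m)%N] pred0).
  apply/seteqP; split => z [Fz].
    by move=> /existsNP[k /negP]; rewrite -leqNgt => zk; split => //; exists k.
  by move=> [k [/= zk _]]; split => // /(_ k); rewrite ltnNge zk.
have half : (2 * D)^-1 <= cprod (m.+1 + isX) / (cprod m.+1 * D).
  rewrite ler_pdivlMr// invfM -mulrA [D^-1 * _]mulrC mulfK ?gt_eqF// mulrC ler_pdivrMr//.
  case: isX; first by rewrite addn1 mulrC; exact: cprod_half.
  by rewrite addn0; lra.
by have := ler_wpM2r (pr_ge0 Q F) half; lra.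
Qed.

(** Since [cprod] decreases, the scale available up to level [L + 2] is at most its number of
    increments times the first one; this gives 1 / (n + 1 - m) for reaching [L], and the cube of
    [eps] pays for the passage. *)
Lemma pr_pass_between_ge n : (m + 4 <= n)%N ->
  F `<=` [set z | forall k, (k <= t)%N -> (z k < n)%N] ->
  eps ^+ 3 / (n + 1 - m)%:R * pr F <= pr (F `&` [set z | exists s, pass n s z /\
    forall k, (t <= k)%N -> (k <= s)%N -> (m < z k)%N]).
Proof.
move=> mn Flt; set L := (n - 2 * ~~ isX)%N.
have [Lm Ln] : (m + 2 <= L /\ L <= n)%N by rewrite /L; clear -mn; case: isX => /=; lia.
have nn : (n1 + 3 <= n)%N by clear -mn nm; lia.
set S := scale (L + 2) - scale (m.+1 + isX).
have S0 : 0 < S.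
  by rewrite subr_gt0; apply: scale_lt => //; clear -Lm; case: isX => /=; lia.
have HS y : (m < y)%N -> ~~ [pred k | (L <= k)%N] y -> scale (y + 3) - scale (m.+1 + isX) <= S.
  by move=> my /=; rewrite -ltnNge => yL; rewrite lerB// scale_le//; clear -yL; lia.
have Bm : ~~ [pred k | (L <= k)%N] m.+1 by rewrite /= -ltnNge; clear -Lm; lia.
have le := @pr_below_le [pred k | (L <= k)%N] _ S0 Bm HS.
have v0 : 0 <= cprod (m.+1 + isX) / S by rewrite divr_ge0 ?(ltW S0)// ltW.
have nB k : (n - 3 <= k)%N -> ~~ [pred k | (k <= m)%N] k.
  by move=> nk; rewrite /= -ltnNge; clear -mn nk; lia.
have xn : (m.+1 + 3 <= n)%N by clear -mn; lia.
have := pr_pass_ge Hq QZ eps01 n12 eps_le pF Fm Flt xn nn v0 nB le.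
have -> : [set z : nat -> nat | exists s, pass n s z /\ forall k, (t <= k)%N -> (k <= s)%N ->
    ~~ [pred k | (k <= m)%N] (z k)] =
  [set z | exists s, pass n s z /\ forall k, (t <= k)%N -> (k <= s)%N -> (m < z k)%N].
  by apply/seteqP; split => z [s [ps H]]; exists s; split => // k tk ks;
    have := H k tk ks; rewrite /= -ltnNge.
apply: le_trans; apply: ler_wpM2r; first exact: pr_ge0.
rewrite ler_wpM2l ?exprn_ge0//; first by case/andP: eps01 => /ltW.
have k0 : (0 : R) < (n + 1 - m)%:R by rewrite ltr0n; clear -mn; lia.
rewrite ler_pdivlMr// mulrC ler_pdivrMr// mulrC.
have -> : S = scale ((m.+1 + isX) + (L + 2 - (m.+1 + isX))) - scale (m.+1 + isX).
  by rewrite subnKC//; clear -Lm; case: isX => /=; lia.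
apply: le_trans (scaleB r01 _ _) _; rewrite ler_wpM2r//; first exact: ltW.
by rewrite ler_nat; clear -Ln Lm; case: isX => /=; lia.
Qed.

End Start.

Lemma pr_pass_start_ge t (F : set paths) x n : past t F -> F `<=` [set z | z t = x] ->
  F `<=` [set z | forall k, (k <= t)%N -> (z k < n)%N] ->
  (x + 3 <= n)%N -> (n1 + 3 <= n)%N ->
  eps ^+ 3 * pr F <= pr (F `&` \bigcup_s pass n s).
Proof.
move=> pF Fx Flt xn nn; have v0 : (0 : R) <= 1 by [].
have mF := past_measurable pF.
have mU : measurable (F `&` \bigcup_s pass n s).
  by apply: measurableI => //; apply: bigcupT_measurable => s; exact: measurable_pass.
have := pr_pass_ge Hq QZ eps01 n12 eps_le (B := pred0) pF Fx Flt xn nn v0 _ _.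
rewrite mulr1 => /(_ (fun _ _ => isT))/(_ _)/le_trans; apply.
  rewrite [F `&` _](_ : _ = set0) ?pr_set0 ?subrr ?mul0r//.
  by apply/seteqP; split => // z [_ [s []]].
apply: pr_le => //.
  apply: measurableI => //; apply: measurable_ex => s.
  apply: measurable_and; first exact: measurable_pass.
  by meas; exact: (@measurable_coord _ (fun k => ~~ pred0 k)).
by move=> z [Fz [s [ps _]]]; split => //; exists s.
Qed.

End Estimates.

(** * Correlations of cutpoints *)

Section Cutpoints.
Context {R : realType} (isX : bool) (q p1 p2 : nat -> R).
Hypothesis Hq : forall k, (2 <= k)%N ->
  0 < q k /\ 0 <= p1 k /\ 0 < p2 k /\ q k + p1 k + p2 k = 1.
Local Notation tr := (walk isX q p1 p2).
Local Notation pass := (pass isX).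
Local Notation cut := (is_cutpoint isX).
Context (r : nat -> R) (n1 : nat).
Hypothesis n12 : (2 <= n1)%N.
Hypothesis r01 : forall k, (n1 <= k)%N -> 2^-1 <= r k <= 1.
Hypothesis r_nd : forall k, (n1 <= k)%N -> r k <= r k.+1.
Hypothesis r_char : forall k, (n1 <= k)%N ->
  if isX then q k * r k ^+ 2 = (p1 k + p2 k) * r k + p2 k
  else q k = (p1 k + p2 k) * r k + p2 k * r k ^+ 2.
Variable eps : R.
Hypothesis eps01 : 0 < eps <= 1.
Hypothesis eps_le : forall k, (n1 <= k)%N -> eps <= q k /\ (~~ isX -> eps <= p2 k).
Local Notation Dpart := (Dpart r).
Context (Q : probability paths R) (x0 : nat) (QZ : markov_paths Q x0 tr).
Local Notation pr := (pr Q).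
Let tr_ge0 := walk_ge0 isX Hq.
Let tr_sum := walk_sum1 isX Hq.

Lemma measurable_bigpass n : measurable (\bigcup_s pass n s : set paths).
Proof. by apply: bigcupT_measurable => s; exact: measurable_pass. Qed.

Lemma cut_above n s z : regular isX q p1 p2 z -> pass n s z -> (z 0 < n)%N -> cut n z ->
  shift (s + isX) (above n) z.
Proof.
move=> rz ps z0 cz; have [s' [ps' ab]] := cut_pass rz z0 cz.
by rewrite (pass_inj ps ps').
Qed.

Section Base.
Variables (t : nat) (F : set paths).
Hypothesis pF : past t F.
Let mF := past_measurable pF.

Lemma past_Fpass n s : (t <= s + isX)%N -> past (s + isX) (F `&` pass n s).
Proof. by move=> ts; apply: pastI; [exact: pastW pF|exact: past_pass]. Qed.

Lemma Fpass_eq0 n s : F `<=` [set z | forall k, (k <= t)%N -> (z k < n)%N] ->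
  (s <= t)%N -> F `&` pass n s = set0.
Proof.
move=> Flt st; apply/seteqP; split => // z [Fz [_ [zs _]]].
by have := Flt _ Fz _ st; rewrite /= zs ltnNge leq_addr.
Qed.

Lemma pr_cut_le n N : (n1 < n)%N -> (n < N)%N ->
  F `<=` [set z | forall k, (k <= t)%N -> (z k < n)%N] ->
  pr (F `&` cut n) * Dpart n N <= 3 * pr F.
Proof.
move=> nn nN Flt; have D0 : 0 < Dpart n N.
  by apply: lt_le_trans (Dpart_ge1 r01 (ltnW nn) nN).
have mc : measurable (F `&` cut n) by apply: measurableI => //; exact: measurable_cut.
rewrite -ler_pdivlMr// mulrAC.
apply: (@le_trans _ _ (pr (F `&` cut n `&` \bigcup_s pass n s))).
  apply: (pr_regular_le Hq QZ) => //; first by apply: measurableI => //; exact: measurable_bigpass.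
  move=> z rz [Fz cz]; have [s [ps _]] := cut_pass rz (Flt _ Fz _ (leq0n t)) cz.
  by split => //; exists s.
apply: (@le_trans _ _ (3 / Dpart n N * pr (F `&` \bigcup_s pass n s))); last first.
  rewrite ler_wpM2l//; first by rewrite divr_ge0// ltW.
  by apply: pr_le => //; apply: measurableI => //; exact: measurable_bigpass.
apply: pr_bigcup_le => //.
- by rewrite divr_ge0// ltW.
- by move=> s; exact: measurable_pass.
- exact: trivIset_pass.
move=> s; have [st|ts] := leqP s t.
  by rewrite setIAC (Fpass_eq0 Flt st) set0I !pr_set0 mulr0.
have pFs := @past_Fpass n s (leq_trans (ltnW ts) (leq_addr _ _)).
have sub : F `&` pass n s `<=` [set z | z (s + isX)%N = n.+1].
  by move=> z [_ /pass_end].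
rewrite mulrAC ler_pdivlMr//.
apply: le_trans (pr_above_le Hq n12 r01 r_nd r_char QZ nn pFs sub nN).
rewrite ler_wpM2r//; first exact: ltW.
apply: (pr_regular_le Hq QZ).
- by apply: measurableI => //; exact: measurable_pass.
- apply: measurableI; first exact: past_measurable pFs.
  by apply: shift_measurable; exact: measurable_above.
move=> z rz [[Fz cz] ps]; split => //.
exact: cut_above rz ps (Flt _ Fz _ (leq0n t)) cz.
Qed.

(** The 9 is 3 times 3: one factor for reaching [n] before [0, m], one for never coming back from
    [n + 1] to [0, n]. *)
Lemma pr_above_cut_le m n N : (n1 < m)%N -> (m < n)%N -> (n < N)%N ->
  F `<=` [set z | z t = m.+1] ->
  F `<=` [set z | forall k, (k < t)%N -> (z k <= m)%N] -> (0 < t)%N ->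
  pr (F `&` shift t (above m) `&` cut n) * (Dpart m n * Dpart n N) <= 9 * pr F.
Proof.
move=> nm mn nN Fm Fle t0; have nn := ltn_trans nm mn.
have D0 : 0 < Dpart n N by apply: lt_le_trans (Dpart_ge1 r01 (ltnW nn) nN).
have Dm0 : 0 < Dpart m n by apply: lt_le_trans (Dpart_ge1 r01 (ltnW nm) mn).
have mA : measurable (shift t (above m) : set paths).
  by apply: shift_measurable; exact: measurable_above.
set V := F `&` _ `&` _.
have mV : measurable (V : set paths).
  by apply: measurableI; [exact: measurableI|exact: measurable_cut].
set U := F `&` shift t (hit [pred k | (n <= k)%N] [pred k | (k <= m)%N]).
have mU : measurable (U : set paths).
  by apply: measurableI => //; apply: shift_measurable; exact: measurable_hit.
have z0n z : F z -> (z 0 < n)%N.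
  by move=> /Fle/(_ 0%N t0) z0; exact: leq_ltn_trans z0 mn.
suff VU : pr V <= 3 / Dpart n N * pr U.
  have /= := pr_reach_le Hq n12 r01 r_nd r_char QZ nm pF Fm mn; rewrite -/U => hU.
  apply: (@le_trans _ _ (3 / Dpart n N * pr U * (Dpart m n * Dpart n N))).
    by rewrite ler_wpM2r// mulr_ge0// ltW.
  have -> : 3 / Dpart n N * pr U * (Dpart m n * Dpart n N) = 3 * (pr U * Dpart m n).
    by field; rewrite gt_eqF.
  by lra.
apply: (@le_trans _ _ (pr (V `&` \bigcup_s pass n s))).
  apply: (pr_regular_le Hq QZ) => //; first by apply: measurableI => //; exact: measurable_bigpass.
  move=> z rz Vz; case: (Vz) => -[Fz _] cz.
  by have [s [ps _]] := cut_pass rz (z0n _ Fz) cz; split => //; exists s.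
apply: (@le_trans _ _ (3 / Dpart n N * pr (U `&` \bigcup_s pass n s))); last first.
  rewrite ler_wpM2l//; first by rewrite divr_ge0// ltW.
  by apply: pr_le => //; apply: measurableI => //; exact: measurable_bigpass.
apply: pr_bigcup_le => //.
- by rewrite divr_ge0// ltW.
- by move=> s; exact: measurable_pass.
- exact: trivIset_pass.
move=> s; have [st|ts] := ltnP s t.
  have e : F `&` pass n s = set0.
    apply/seteqP; split => // z [Fz [_ [zs _]]].
    by have := Fle _ Fz _ st; rewrite /= zs leqNgt (leq_trans mn (leq_addr _ _)).
  have -> : V `&` pass n s = set0.
    by apply/seteqP; split => // z [[[Fz _] _] ps]; rewrite -e.
  by rewrite pr_set0 mulr_ge0 ?pr_ge0// divr_ge0// ltW.
(* Staying above [m] forever is not decided at a finite time; only its part up to the passage of [n]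
   is kept, and the future is then charged to [above n]. *)
pose G := F `&` pass n s `&` [set z | forall k, (k <= s)%N -> (t <= k)%N -> (m < z k)%N].
have pG : past (s + isX) G.
  apply: pastI; first by apply: past_Fpass; exact: leq_trans ts (leq_addr _ _).
  move=> z z' zz' H k ks tk; rewrite -zz'; first exact: H.
  exact: leq_trans ks (leq_addr _ _).
have sub : G `<=` [set z | z (s + isX)%N = n.+1] by move=> z [[_ /pass_end]].
have mG := past_measurable pG.
apply: (@le_trans _ _ (pr (G `&` shift (s + isX) (above n)))).
  apply: (pr_regular_le Hq QZ).
  - by apply: measurableI => //; exact: measurable_pass.
  - by apply: measurableI => //; apply: shift_measurable; exact: measurable_above.
  move=> z rz [[[Fz ab] cz] ps]; split; last exact: cut_above rz ps (z0n _ Fz) cz.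
  by split => // k ks tk; have := ab (k - t)%N; rewrite /= subnKC.
have h := pr_above_le Hq n12 r01 r_nd r_char QZ nn pG sub nN.
rewrite mulrAC ler_pdivlMr//; apply: le_trans h _; rewrite ler_wpM2l//.
apply: pr_le => //; first by apply: measurableI => //; exact: measurable_pass.
move=> z [[Fz ps] H]; split => //; split => //; exists (s - t)%N; split => /=.
  by rewrite subnKC//; case: ps => _ [-> _]; exact: leq_addr.
by move=> k kst; rewrite -ltnNge; apply: H; [lia|exact: leq_addr].
Qed.

End Base.

Lemma pr_cut2_le t (F : set paths) m n N : past t F ->
  (n1 < m)%N -> (m < n)%N -> (n < N)%N ->
  F `<=` [set z | forall k, (k <= t)%N -> (z k < m)%N] ->
  pr (F `&` cut m `&` cut n) * (Dpart m n * Dpart n N) <= 9 * pr F.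
Proof.
move=> pF nm mn nN Flt; have nn := ltn_trans nm mn; have mF := past_measurable pF.
have D0 : 0 < Dpart n N by apply: lt_le_trans (Dpart_ge1 r01 (ltnW nn) nN).
have Dm0 : 0 < Dpart m n by apply: lt_le_trans (Dpart_ge1 r01 (ltnW nm) mn).
have DD0 : 0 < Dpart m n * Dpart n N by rewrite mulr_gt0.
set V := F `&` cut m `&` cut n.
have mV : measurable (V : set paths).
  by apply: measurableI; [apply: measurableI => //|]; exact: measurable_cut.
rewrite -ler_pdivlMr// mulrAC.
apply: (@le_trans _ _ (pr (V `&` \bigcup_s pass m s))).
  apply: (pr_regular_le Hq QZ) => //; first by apply: measurableI => //; exact: measurable_bigpass.
  move=> z rz Vz; case: (Vz) => -[Fz cz] _; have [s [ps _]] := cut_pass rz (Flt _ Fz _ (leq0n t)) cz.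
  by split => //; exists s.
apply: (@le_trans _ _ (9 / (Dpart m n * Dpart n N) * pr (F `&` \bigcup_s pass m s))); last first.
  rewrite ler_wpM2l//; first by rewrite divr_ge0// ltW.
  by apply: pr_le => //; apply: measurableI => //; exact: measurable_bigpass.
apply: pr_bigcup_le => //.
- by rewrite divr_ge0// ltW.
- by move=> s; exact: measurable_pass.
- exact: trivIset_pass.
move=> s; have [st|ts] := leqP s t.
  have -> : V `&` pass m s = set0.
    by apply/seteqP; split => // z [[[Fz _] _] ps]; rewrite -(Fpass_eq0 Flt st).
  by rewrite (Fpass_eq0 Flt st) !pr_set0 mulr0.
have pFs := @past_Fpass t F pF m s (leq_trans (ltnW ts) (leq_addr isX _)).
have sub : F `&` pass m s `<=` [set z | z (s + isX)%N = m.+1].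
  by move=> z [_ /pass_end].
have sub2 : F `&` pass m s `<=` [set z | forall k, (k < s + isX)%N -> (z k <= m)%N].
  by move=> z [_ ps] k; exact: pass_prefix ps.
have s0 : (0 < s + isX)%N by rewrite addn_gt0 (leq_ltn_trans _ ts).
rewrite mulrAC ler_pdivlMr//.
apply: le_trans (pr_above_cut_le pFs nm mn nN sub sub2 s0).
rewrite ler_wpM2r//; first exact: ltW.
apply: (pr_regular_le Hq QZ).
- by apply: measurableI => //; exact: measurable_pass.
- apply: measurableI; last exact: measurable_cut.
  apply: measurableI; first exact: past_measurable pFs.
  by apply: shift_measurable; exact: measurable_above.
move=> z rz [[[Fz cm] cn] ps]; split => //; split => //.
exact: cut_above rz ps (Flt _ Fz _ (leq0n t)) cm.
Qed.

Lemma pr_cut_ge t (F : set paths) x n (D : R) : past t F -> F `<=` [set z | z t = x] ->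
  F `<=` [set z | forall k, (k <= t)%N -> (z k < n)%N] ->
  (x + 3 <= n)%N -> (n1 + 3 <= n)%N ->
  0 < D -> (forall N, (n < N)%N -> Dpart n N <= D) ->
  eps ^+ 3 / (2 * D) * pr F <= pr (F `&` cut n).
Proof.
move=> pF Fx Flt xn nn D0 HD; have mF := past_measurable pF.
have n1n : (n1 < n)%N by clear -nn; lia.
have h1 := pr_pass_start_ge Hq n12 eps01 eps_le QZ pF Fx Flt xn nn.
have i0 : 0 <= (2 * D)^-1 by rewrite invr_ge0; lra.
have mc : measurable (F `&` cut n) by apply: measurableI => //; exact: measurable_cut.
apply: (@le_trans _ _ ((2 * D)^-1 * pr (F `&` \bigcup_s pass n s))).
  by rewrite -mulrA mulrCA ler_wpM2l.
apply: (@le_trans _ _ (pr (F `&` cut n `&` \bigcup_s pass n s))); last first.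
  by apply: pr_le => //; apply: measurableI => //; exact: measurable_bigpass.
apply: pr_bigcup_ge => //.
- by move=> s; exact: measurable_pass.
- exact: trivIset_pass.
move=> s; have [st|ts] := leqP s t.
  by rewrite (Fpass_eq0 Flt st) pr_set0 mulr0 pr_ge0.
have pFs := @past_Fpass t F pF n s (leq_trans (ltnW ts) (leq_addr isX _)).
have sub : F `&` pass n s `<=` [set z | z (s + isX)%N = n.+1].
  by move=> z [_ /pass_end].
apply: le_trans (pr_above_ge Hq n12 r01 r_nd r_char QZ n1n pFs sub D0 HD) _.
apply: pr_le.
- apply: measurableI; first exact: past_measurable pFs.
  by apply: shift_measurable; exact: measurable_above.
- by apply: measurableI => //; exact: measurable_pass.
- by move=> z [[Fz ps] ab]; split => //; split => //; exact: pass_cut ab.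
Qed.

Lemma pr_start : pr [set z | z 0%N = x0] = 1.
Proof.
rewrite (_ : mkset _ = [set z | forall i, (i <= 0)%N -> z i = x0]).
  by rewrite /pr (QZ 0 (fun=> x0)) eqxx big_ord0 mulr1.
apply/seteqP; split => z /=; last by apply.
by move=> z0 i; rewrite leqn0 => /eqP ->.
Qed.

Lemma pr_start_le (A B : set paths) : measurable A -> measurable B ->
  (forall z, regular isX q p1 p2 z -> z 0%N = x0 -> A z -> B z) -> pr A <= pr B.
Proof.
move=> mA mB AB; have mS : measurable ([set z | z 0%N = x0] : set paths) by meas.
have mAS : measurable (A `&` [set z | z 0%N = x0]) by exact: measurableI.
apply: (@le_trans _ _ (pr (A `&` [set z | z 0%N = x0]))).
  apply: (pr_null_eq (N := ~` [set z | z 0%N = x0])) => //; first exact: measurableC.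
    by rewrite pr_setC// pr_start subrr.
  by move=> z /contrapT.
by apply: (pr_regular_le Hq QZ) => // z rz [Az z0]; exact: AB.
Qed.

Definition last_cut (m L : nat) : set (nat -> nat) :=
  cut m `&` [set z | forall j, (m < j)%N -> (j <= L)%N -> ~ cut j z].

Lemma measurable_last_cut m L : measurable (last_cut m L : set paths).
Proof.
apply: measurableI; first exact: measurable_cut.
by meas; exact: measurable_cut.
Qed.

(** The part of being a cutpoint at [n] that is settled when [m] is passed: should [m] turn out to
    be a cutpoint, [n] is one as well. *)
Definition linked (n m : nat) : set (nat -> nat) :=
  [set z | exists s, pass n s z /\ exists s', pass m s' z /\
     forall k, (s + isX <= k)%N -> (k <= s')%N -> (n < z k)%N].

Lemma measurable_linked n m : measurable (linked n m : set paths).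
Proof.
apply: measurable_ex => s; apply: measurable_and; first exact: measurable_pass.
apply: measurable_ex => s'; apply: measurable_and; first exact: measurable_pass.
by meas.
Qed.

Lemma pass_lt n m s s' z : (n < m)%N -> pass n s z -> pass m s' z -> (s < s')%N.
Proof.
move=> nm [nlt [zs _]] [_ [zs' _]]; rewrite ltnNge leq_eqVlt.
apply/negP => /orP[/eqP ss'|/nlt].
  by move: zs'; rewrite ss' zs => /eqP; rewrite eqn_add2r => /eqP nm'; rewrite nm' ltnn in nm.
by rewrite zs' ltnNge (leq_trans (ltnW nm) (leq_addr _ _)).
Qed.

Lemma past_linked n m s' : (n < m)%N -> past (s' + isX) (linked n m `&` pass m s').
Proof.
move=> nm z z' zz' [[s [ps [s0 [ps0 ab]]]] ps'].
have e0 := pass_inj ps0 ps'; rewrite {}e0 in ab ps0.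
have ss' := pass_lt nm ps ps'.
have pz' : pass m s' z' by apply: (@past_pass isX m s' z).
split => //; exists s; split.
  apply: (@past_pass isX n s z) => // i si; apply: zz'.
  by apply: leq_trans si _; rewrite leq_add2r ltnW.
exists s'; split => // k sk ks; rewrite -zz'; first exact: ab.
exact: leq_trans ks (leq_addr _ _).
Qed.

Lemma pr_linked_ge n m : (n1 + 3 <= n)%N -> (x0 + 3 <= n)%N -> (n + 4 <= m)%N ->
  eps ^+ 3 / (m + 1 - n)%:R * eps ^+ 3 <= pr (linked n m).
Proof.
move=> nn xn nm; have /andP[e0 _] := eps01.
have n1n : (n1 < n)%N by clear -nn; lia.
have mS : measurable ([set z | z 0%N = x0] : set paths) by meas.
have mI : measurable ([set z | z 0%N = x0] `&` \bigcup_s pass n s : set paths).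
  by apply: measurableI => //; exact: measurable_bigpass.
have mW := measurable_linked n m.
have start : eps ^+ 3 <= pr (setT `&` \bigcup_s pass n s).
  have := pr_pass_start_ge Hq n12 eps01 eps_le QZ (@past_at 0 x0) (@subset_refl _ _) _ xn nn.
  rewrite pr_start mulr1 => /(_ _)/le_trans; apply.
    move=> z /= z0 k; rewrite leqn0 => /eqP ->; rewrite z0; clear -xn; lia.
  by apply: pr_le => //; rewrite setTI; [exact: measurable_bigpass|move=> z []].
have c0 : 0 <= eps ^+ 3 / (m + 1 - n)%:R by rewrite divr_ge0// exprn_ge0// ltW.
apply: le_trans (ler_wpM2l c0 start) _.
apply: (@le_trans _ _ (pr (linked n m `&` \bigcup_s pass n s))); last first.
  by apply: pr_le => //; apply: measurableI => //; exact: measurable_bigpass.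
apply: pr_bigcup_ge => //.
- by move=> s; exact: measurable_pass.
- exact: trivIset_pass.
move=> s; rewrite setTI.
have sub : pass n s `<=` [set z | forall k, (k <= s + isX)%N -> (z k < m)%N].
  move=> z ps k; rewrite leq_eqVlt => /orP[/eqP ->|/(pass_prefix ps)].
    by rewrite (pass_end ps); clear -nm; lia.
  by move=> /leq_ltn_trans; apply; clear -nm; lia.
apply: le_trans (pr_pass_between_ge Hq n12 r01 r_nd r_char eps01 eps_le QZ n1n
  (@past_pass isX n s) (@pass_end isX n s) nm sub) _.
apply: pr_le.
- apply: measurableI; first exact: measurable_pass.
  apply: measurable_ex => s'; apply: measurable_and; first exact: measurable_pass.
  by meas.
- by apply: measurableI => //; exact: measurable_pass.
- by move=> z [ps [s' [ps' ab]]]; split => //; exists s; split => //; exists s'.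
Qed.

(* Given that [m] is a cutpoint, past and future are independent, so conditioning
   on the cutpoints above [m] does not affect the probability that [n] is one. *)
Lemma pr_cut_last_ge n m L : (n1 + 3 <= n)%N -> (x0 + 3 <= n)%N -> (n + 4 <= m)%N ->
  eps ^+ 6 / (m + 1 - n)%:R * pr (last_cut m L) <= pr (cut n `&` last_cut m L).
Proof.
move=> nn xn nm.
have nm' : (n < m)%N by clear -nm; lia.
have xm : (x0 < m)%N by clear -nm xn; lia.
have xn' : (x0 < n)%N by clear -xn; lia.
pose G := above m `&` [set z | forall j, (m < j)%N -> (j <= L)%N -> ~ cut j z] : set paths.
have mG : measurable G.
  by apply: measurableI; [exact: measurable_above|meas; exact: measurable_cut].
have mG' s : measurable (shift s G : set paths) by exact: shift_measurable.
have mL := measurable_last_cut m L; have mW := measurable_linked n m.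
have mLW : measurable (linked n m `&` last_cut m L : set paths) by exact: measurableI.
(* [k] is the chance, from [m + 1], of staying above [m] with no cutpoint in (m, L]. It bounds
   [last_cut] from above and reappears as a factor after [linked], so its unknown value cancels. *)
have [k k0 kP] := markov tr_ge0 tr_sum QZ m.+1 mG.
have cutj s z j : pass m s z -> (m < j)%N -> cut j z <-> shift (s + isX) (cut j) z.
  move=> ps mj; apply: cut_shift => i /(pass_prefix ps) zi zj.
  by move: mj; rewrite -zj ltnNge zi.
have lastk : pr (last_cut m L) <= k.
  apply: (@le_trans _ _ (pr (last_cut m L `&` \bigcup_s pass m s))).
    apply: pr_start_le => //; first by apply: measurableI => //; exact: measurable_bigpass.
    move=> z rz z0 lz; case: (lz) => cz _; split => //.
    by have [|s [ps _]] := cut_pass rz _ cz; [rewrite z0|exists s].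
  apply: (@le_trans _ _ (k * pr (setT `&` \bigcup_s pass m s))); last first.
    by rewrite setTI ler_piMr// pr_le1//; exact: measurable_bigpass.
  apply: pr_bigcup_le => //.
  - by move=> s; exact: measurable_pass.
  - exact: trivIset_pass.
  move=> s; rewrite setTI -(kP _ _ (@past_pass isX m s) (@pass_end isX m s)).
  apply: pr_start_le.
  - by apply: measurableI => //; exact: measurable_pass.
  - by apply: measurableI => //; exact: measurable_pass.
  move=> z rz z0 [[cz nc] ps]; split => //; split.
    by apply: cut_above rz ps _ cz; rewrite z0.
  by move=> j mj jL /(cutj _ _ _ ps mj); exact: nc.
have ge : k * pr (linked n m) <= pr (linked n m `&` last_cut m L).
  apply: (@le_trans _ _ (k * pr (linked n m `&` \bigcup_s pass m s))).
    rewrite ler_wpM2l//; apply: pr_le => //.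
      by apply: measurableI => //; exact: measurable_bigpass.
    by move=> z Wz; split => //; case: Wz => s [_ [s' [ps' _]]]; exists s'.
  apply: (@le_trans _ _ (pr (linked n m `&` last_cut m L `&` \bigcup_s pass m s))); last first.
    by apply: pr_le => //; apply: measurableI => //; exact: measurable_bigpass.
  apply: pr_bigcup_ge => //.
  - by move=> s; exact: measurable_pass.
  - exact: trivIset_pass.
  move=> s; rewrite -(kP _ _ (@past_linked n m s nm')); last by move=> z [_ /pass_end].
  apply: pr_le.
  - by apply: measurableI => //; apply: measurableI => //; exact: measurable_pass.
  - by apply: measurableI => //; exact: measurable_pass.
  move=> z [[Wz ps] [ab nc]]; split => //; split => //; split; first exact: pass_cut ab.
  by move=> j mj jL /(cutj _ _ _ ps mj); exact: nc.
have sub : pr (linked n m `&` last_cut m L) <= pr (cut n `&` last_cut m L).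
  apply: pr_start_le => //; first by apply: measurableI => //; exact: measurable_cut.
  move=> z rz z0 [[s [ps [s' [ps' H]]]] lz]; case: (lz) => cz _; split => //.
  have ab' : shift (s' + isX) (above m) z by apply: cut_above rz ps' _ cz; rewrite z0.
  apply: (pass_cut ps) => i; rewrite /shift /above /=; set j := (s + isX + i)%N.
  have [js|sj] := leqP j s'; first by apply: H => //; exact: leq_addr.
  apply: (leq_trans nm'); have := ab' (j - (s' + isX))%N; rewrite /= subnKC; first exact: ltnW.
  by clear -sj; case: isX; rewrite ?addn1 ?addn0 // ltnW.
apply: le_trans sub; apply: le_trans ge.
have := pr_linked_ge nn xn nm; have l0 := pr_ge0 Q (last_cut m L).
rewrite mulrAC -exprD => h; rewrite mulrC.
by apply: ler_pM => //; rewrite divr_ge0// exprn_ge0//; case/andP: eps01 => /ltW.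
Qed.

End Cutpoints.

(** * Summable case *)

Section FiniteSums.
Context {R : realType} (Q : probability paths R).
Local Notation pr := (pr Q).

Lemma pr_sum_trivIset_le (E : nat -> set paths) (A : set paths) s :
  uniq s -> (forall i, measurable (E i)) -> measurable A -> trivIset setT E ->
  \sum_(i <- s) pr (A `&` E i) <= pr A.
Proof.
move=> us mE + tE; elim: s us A => [_ A mA|i s IH /= /andP[nis us] A mA].
  by rewrite big_nil pr_ge0.
rewrite big_cons (pr_split Q mA (mE i)) lerD2l.
have mAE : measurable (A `&` ~` E i) by apply: measurableI => //; exact: measurableC.
apply: le_trans (IH us _ mAE); rewrite big_seq [leRHS]big_seq; apply: ler_sum => j js.
apply: pr_le; [exact: measurableI|exact: measurableI|].
move=> z [Az Ej]; split => //; split => // Ei.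
have : i <> j by move=> ij; move: nis; rewrite ij js.
move/trivIsetP : tE => /(_ i j I I) + /eqP ij => /(_ ij) e.
by have : (E i `&` E j) z by []; rewrite e.
Qed.

Lemma pr_cover_le (E : nat -> set paths) (A : set paths) s :
  (forall i, measurable (E i)) -> measurable A ->
  (forall z, A z -> exists2 i, i \in s & E i z) ->
  pr A <= \sum_(i <- s) pr (E i).
Proof.
move=> mE; elim: s A => [|i s IH] A mA cov.
  rewrite big_nil (_ : A = set0) ?pr_set0//.
  by apply/seteqP; split => // z /cov[].
rewrite big_cons (pr_split Q mA (mE i)); apply: lerD.
  by apply: pr_le => //; exact: measurableI.
apply: IH; first by apply: measurableI => //; exact: measurableC.
move=> z [Az nEi]; have [j] := cov z Az; rewrite inE => /orP[/eqP -> //|js Ej].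
by exists j.
Qed.

End FiniteSums.

Lemma ln_nat_step {R : realType} i : (0 < i)%N ->
  ln (i.+1%:R : R) - ln (i%:R) <= i%:R^-1.
Proof.
move=> i0; have ip : (0 : R) < i%:R by rewrite ltr0n.
rewrite -ln_div ?posrE ?ltr0n//.
have -> : (i.+1%:R / i%:R : R) = 1 + i%:R^-1.
  by rewrite -natr1 mulrDl divff ?mul1r ?gt_eqF.
by apply: le_ln1Dx; apply: (@lt_trans _ _ 0); rewrite ?ltrN10 ?invr_gt0.
Qed.

(** Each term dominates a difference of logarithms. The range ends at [m - 4], the largest [n] with
    [n + 4 <= m], which leaves ln 5 at the end of the telescope. *)
Lemma harmonic_ge {R : realType} b m : (b + 4 < m)%N ->
  ln ((m + 1 - b)%:R / 5 : R) <= \sum_(b.+1 <= n < m - 3) (m + 1 - n)%:R^-1.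
Proof.
move=> bm; rewrite ln_div ?posrE ?ltr0n//; last by rewrite subn_gt0; lia.
have := @telescope_sumr R b.+1 (m - 3) (fun n => - ln (m + 2 - n)%:R).
rewrite (_ : m + 2 - (m - 3) = 5)%N; last by lia.
rewrite (_ : m + 2 - b.+1 = m + 1 - b)%N; last by lia.
move=> /(_ ltac:(lia)) e; rewrite (_ : ln _ - ln _ = - ln 5 - - ln (m + 1 - b)%:R); last by ring.
rewrite -{}e big_nat_cond [leRHS]big_nat_cond; apply: ler_sum => n /andP[/andP[bn nm] _].
rewrite opprK addrC (_ : m + 2 - n = (m + 1 - n).+1)%N; last by lia.
rewrite (_ : m + 2 - n.+1 = m + 1 - n)%N; last by lia.
by apply: ln_nat_step; lia.
Qed.

(** The fourth power of b + 2 is at least 18 ^ 3 * (b + 2), and 18 ^ 3 exceeds 4 * 5 ^ 4. This turns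
    the harmonic bound into a multiple of the logarithm of the block end. *)
Lemma ln_quarter {R : realType} b : (16 <= b)%N ->
  ln (4 * b%:R : R) <= 4 * ln ((b + 2)%:R / 5).
Proof.
move=> b16; have b0 : (0 : R) < b%:R by rewrite ltr0n; lia.
rewrite [leRHS]mulr_natl -lnXn ?divr_gt0 ?ltr0n ?addn2//.
rewrite ler_ln ?posrE; first last.
- by rewrite exprn_gt0// divr_gt0 ?ltr0n.
- by rewrite mulr_gt0.
rewrite expr_div_n ler_pdivlMr ?exprn_gt0//.
have b2 : (b%:R : R) <= (b.+2)%:R by rewrite ler_nat; lia.
have b18 : (18 : R) <= (b.+2)%:R by rewrite ler_nat; lia.
set x : R := b.+2%:R in b2 b18 *.
have : (18 : R) ^+ 3 <= x ^+ 3 by rewrite lerXn2r// ?nnegrE; lra.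
move=> x3; rewrite (exprSr x 3); have -> : (5 : R) ^+ 4 = 625 by rewrite -natrX.
have e18 : (18 : R) ^+ 3 = 5832 by rewrite -natrX.
rewrite e18 in x3; nra.
Qed.

Section Blocks.
Context {R : realType} (Q : probability paths R) (C : nat -> set paths).
Local Notation pr := (pr Q).
Hypothesis mC : forall n, measurable (C n).
Let last m L := C m `&` [set z | forall j, (m < j)%N -> (j <= L)%N -> ~ C j z] : set paths.
Variables (c : R) (n0 : nat) (u : nat -> R) (S : R).
Hypothesis c0 : 0 < c.
Hypothesis last_ge : forall n m L, (n0 <= n)%N -> (n + 4 <= m)%N ->
  c / (m + 1 - n)%:R * pr (last m L) <= pr (C n `&` last m L).
Hypothesis u_ge0 : forall n, 0 <= u n.
Hypothesis C_le : forall n, (n0 <= n)%N -> pr (C n) <= u n.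
Hypothesis u_sum : forall N, \sum_(2 <= n < N) u n / ln n%:R <= S.

Let block b := [set z | exists n, (2 * b < n)%N /\ (n <= 4 * b)%N /\ C n z] : set paths.

Let mblock b : measurable (block b).
Proof. by rewrite /block; meas. Qed.

Let mlast m L : measurable (last m L).
Proof. by rewrite /last; apply: measurableI => //; meas. Qed.

(** A double count of pairs (n, m) with [m] the last site of the block: the events [E m] are
    disjoint, so each [n] is counted at most [pr (C n)]. The window starts at [b] rather than
    [2 * b] so that even the lowest [m] has about [b] sites below it. *)
Lemma pr_block_le b : (16 <= b)%N -> (n0 <= b)%N ->
  pr (block b) <= 4 / c * \sum_(b.+1 <= n < (4 * b).+1) u n / ln n%:R.
Proof.
move=> b16 nb; set L := (4 * b)%N; pose E m := if (m <= L)%N then last m L else set0.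
have mE m : measurable (E m) by rewrite /E; case: ifP.
have tE : trivIset setT E.
  apply/trivIsetP => i j _ _; rewrite /E; wlog ij : i j / (i < j)%N.
    move=> H ij; have [|ji|eij] := ltngtP i j; first by move/H; apply.
      by rewrite setIC; apply: H => //; rewrite eq_sym.
    by rewrite eij eqxx in ij.
  move=> _; case: ifP => _; last by rewrite set0I.
  case: ifP => jL; last by rewrite setI0.
  by apply/seteqP; split => // z [[_ nz] [Cj _]]; exact: nz ij jL Cj.
have h1 : pr (block b) <= \sum_((2 * b).+1 <= m < L.+1) pr (E m).
  apply: pr_cover_le => // z [n [bn [nL Cn]]].
  have ex : exists n, (n <= L)%N && `[< C n z >] by exists n; rewrite nL; exact/asboolP.
  have bd i : (i <= L)%N && `[< C i z >] -> (i <= L)%N by case/andP.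
  case: (ex_maxnP ex bd) => m /andP[mL /asboolP Cm] maxm.
  exists m.
    rewrite mem_index_iota ltnS mL andbT; apply: leq_trans bn _.
    by apply: maxm; rewrite nL; exact/asboolP.
  rewrite /E mL; split => // j mj jL Cj; have := maxm j; rewrite jL leqNgt mj.
  by move=> /(_ _)/negP; apply => //; rewrite /=; exact/asboolP.
have l0 : 0 < ln (L%:R : R) by apply: ln_gt0; rewrite ltr1n /L; lia.
have h2 m : (2 * b < m)%N -> (m <= L)%N ->
    c / 4 * ln L%:R * pr (E m) <= \sum_(b.+1 <= n < L.+1) pr (C n `&` E m).
  move=> bm mL; rewrite /E mL.
  apply: (@le_trans _ _ (\sum_(b.+1 <= n < m - 3) pr (C n `&` last m L))); last first.
    rewrite [leRHS](@big_cat_nat _ _ _ (m - 3))/=; [|lia|lia].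
    by rewrite lerDl; apply: sumr_ge0 => n _; exact: pr_ge0.
  apply: (@le_trans _ _ (\sum_(b.+1 <= n < m - 3) c / (m + 1 - n)%:R * pr (last m L))); last first.
    rewrite big_nat_cond [leRHS]big_nat_cond; apply: ler_sum => n /andP[/andP[bn nm] _].
    by apply: last_ge; lia.
  rewrite -mulr_suml ler_wpM2r ?pr_ge0// -mulr_sumr -mulrA ler_pM2l//.
  have bm4 : (b + 4 < m)%N by lia.
  apply: le_trans (harmonic_ge (R := R) bm4).
  have := ln_quarter (R := R) b16; rewrite -natrM -/L => le4.
  rewrite mulrC ler_pdivrMr// mulrC; apply: le_trans le4 _; rewrite ler_pM2l//.
  rewrite ler_ln ?posrE ?divr_gt0 ?ltr0n//; try lia.
  by rewrite ler_pM2r ?invr_gt0// ler_nat; lia.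
have h3 : c / 4 * ln L%:R * pr (block b) <= \sum_(b.+1 <= n < L.+1) u n.
  apply: (@le_trans _ _ (c / 4 * ln L%:R * \sum_((2 * b).+1 <= m < L.+1) pr (E m))).
    by rewrite ler_wpM2l// mulr_ge0 ?(ltW l0)// divr_ge0// ltW.
  apply: (@le_trans _ _ (\sum_((2 * b).+1 <= m < L.+1) \sum_(b.+1 <= n < L.+1) pr (C n `&` E m))).
    rewrite mulr_sumr big_nat_cond [leRHS]big_nat_cond.
    by apply: ler_sum => m /andP[/andP[bm mL] _]; exact: h2.
  rewrite exchange_big/= big_nat_cond [leRHS]big_nat_cond.
  apply: ler_sum => n /andP[/andP[bn _] _]; apply: le_trans (C_le _); last by lia.
  by apply: pr_sum_trivIset_le => //; exact: iota_uniq.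
have h4 : (ln L%:R)^-1 * \sum_(b.+1 <= n < L.+1) u n <= \sum_(b.+1 <= n < L.+1) u n / ln n%:R.
  rewrite mulr_sumr big_nat_cond [leRHS]big_nat_cond.
  apply: ler_sum => n /andP[/andP[bn nL] _]; rewrite mulrC ler_wpM2l//.
  have ln0 : 0 < ln (n%:R : R) by apply: ln_gt0; rewrite ltr1n; lia.
  by rewrite lef_pV2 ?posrE// ler_ln ?posrE ?ltr0n ?ler_nat//; lia.
have l1 : 0 <= (ln (L%:R : R))^-1 by rewrite invr_ge0 ltW.
have c4 : 0 <= 4 / c by rewrite divr_ge0// ltW.
have := ler_wpM2l c4 (le_trans (ler_wpM2l l1 h3) h4); apply: le_trans.
by rewrite le_eqVlt; apply/orP; left; apply/eqP; field; rewrite !gt_eqF.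
Qed.

(** The window (b, 4b] with b a power of 2 consists of two dyadic ranges, so every term is used at
    most twice, whence 8 = 2 * 4. The shift by 4 in the exponent ensures [16 <= b]. *)
Lemma block_sum_le K j : (n0 <= 2 ^ (K + 4))%N ->
  \sum_(i < j) pr (block (2 ^ (i + K + 4))) <= 8 / c * S.
Proof.
move=> nK; pose s k := \sum_((2 ^ k).+1 <= n < (2 ^ k.+1).+1) u n / ln n%:R : R.
have ul n : 0 <= u n / ln n%:R.
  case: n => [|n]; first by rewrite ln0 ?invr0 ?mulr0.
  by rewrite divr_ge0// ln_ge0// ler1n.
have ss i k : \sum_(l < i) s (l + k)%N = \sum_((2 ^ k).+1 <= n < (2 ^ (i + k)).+1) u n / ln n%:R.
  elim: i => [|i IH]; first by rewrite big_ord0 big_geq.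
  rewrite big_ord_recr/= IH /s addSn -big_cat_nat//= ltnS leq_exp2l//; lia.
have sS i k : \sum_(l < i) s (l + k)%N <= S.
  rewrite ss; have [le|lt] := leqP 2 (2 ^ (i + k)).+1; last first.
    rewrite big_geq; last by apply: leq_trans (ltnW lt) _; rewrite ltnS expn_gt0.
    by apply: le_trans (u_sum 0); rewrite big_geq.
  apply: le_trans (u_sum (2 ^ (i + k)).+1).
  rewrite [leRHS](@big_cat_nat _ _ _ (2 ^ k).+1)/=; last 2 first.
  - by rewrite ltnS expn_gt0.
  - by rewrite ltnS leq_exp2l//; lia.
  by rewrite lerDr; apply: sumr_ge0.
apply: (@le_trans _ _ (4 / c * (\sum_(l < j) s (l + (K + 4))%N +
    \sum_(l < j) s (l + (K + 4).+1)%N))); last first.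
  have := sS j (K + 4)%N; have := sS j (K + 4).+1.
  have c4 : 0 < 4 / c by rewrite divr_gt0.
  move=> s1 s2; rewrite (_ : 8 / c = 4 / c + 4 / c); last by field; rewrite gt_eqF.
  by nra.
rewrite -big_split/= mulr_sumr; apply: ler_sum => i _.
have b16 : (16 <= 2 ^ (i + K + 4))%N by rewrite (@leq_exp2l 2 4)// leq_addl.
have nb : (n0 <= 2 ^ (i + K + 4))%N.
  by apply: leq_trans nK _; rewrite leq_exp2l// -addnA leq_addl.
apply: le_trans (pr_block_le b16 nb) _; rewrite ler_wpM2l ?divr_ge0 ?(ltW c0)//.
have -> : (i + (K + 4).+1 = (i + K + 4).+1)%N by lia.
rewrite addnA /s -big_cat_nat/=; last 2 first.
- by rewrite ltnS leq_exp2l.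
- by rewrite ltnS leq_exp2l.
by rewrite (expnS 2 (i + K + 4).+1) (expnS 2 (i + K + 4)) mulnA.
Qed.

Theorem finitely_many : exists N : set paths, measurable N /\ Q N = 0%E /\
  forall z, ~ N z -> finite_set [set k | C k z].
Proof.
pose K := n0; pose B i := block (2 ^ (i + K + 4)).
have nK : (n0 <= 2 ^ (K + 4))%N.
  by apply: leq_trans (ltnW (ltn_expl n0 (isT : 1 < 2)%N)) _; rewrite leq_exp2l// leq_addr.
exists (lim_sup_set B); split; last split.
- rewrite /lim_sup_set; apply: bigcapT_measurable => n.
  by apply: bigcup_measurable => k _; exact: mblock.
- apply: lim_sup_set_cvg0; first by move=> k; exact: mblock.
  apply: (@le_lt_trans _ _ (8 / c * S)%:E); last by rewrite ltry.
  apply: lime_le; first exact: is_cvg_nneseries.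
  apply: nearW => j; rewrite big_mkord.
  rewrite (eq_bigr (fun i : 'I_j => (pr (B i))%:E)); last by move=> i _; rewrite -prE//; exact: mblock.
  by rewrite sumEFin lee_fin; exact: block_sum_le.
move=> z nz; have [k kB] : exists k, forall i, (k <= i)%N -> ~ B i z.
  apply: contrapT => /forallNP H; apply: nz => k _.
  by have /existsNP[i /not_implyP[ki /contrapT Bi]] := H k; exists i.
apply: (@sub_finite_set _ _ `I_(2 ^ (k + K + 4).+2)); last exact: finite_II.
move=> n /= Cn; rewrite ltnNge; apply/negP => kn.
have n1 : (0 < n.-1)%N.
  by have := @leq_exp2l 2 1 (k + K + 4).+2; rewrite // expn1 ltnS; lia.
(* Blocks are open on the left and closed on the right, so the dyadic range of [n] is found from the
   logarithm of [n.-1]. *)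
have /andP[l1 l2] := @trunc_log_bounds 2 n.-1 isT n1.
set t := trunc_log 2 n.-1 in l1 l2.
have kt : ((k + K + 4).+1 <= t)%N.
  have : (2 ^ (k + K + 4).+1 <= n.-1)%N.
    by move: kn; rewrite expnS; have := expn_gt0 2 (k + K + 4).+1; lia.
  by move=> /leq_ltn_trans/(_ l2); rewrite ltn_exp2l// ltnS.
apply: (kB (t - (K + 4).+1)%N); first by lia.
exists n; have e : (t - (K + 4).+1 + K + 4 = t.-1)%N by lia.
rewrite e; have t0 : t = t.-1.+1 by lia.
move: l1 l2; rewrite t0 !expnS /=; split; first by lia.
by split => //; lia.
Qed.

End Blocks.

(** * Divergent case *)

Lemma sum_triangle {R : realType} (f : nat -> nat -> R) N :
  \sum_(i < N) \sum_(j < i) f i j = \sum_(j < N) \sum_(j.+1 <= i < N) f i j.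
Proof.
elim: N => [|N IH]; first by rewrite !big_ord0.
rewrite big_ord_recr/= IH [RHS]big_ord_recr/= [X in _ = _ + X]big_geq// addr0 -big_split/=.
by apply: eq_bigr => j _; rewrite big_nat_recr.
Qed.

(** 1 - x / y is at most ln (y / x), and y <= x + 1 <= 2 x lets the denominator y be exchanged for x
    at the cost of a factor 2. *)
Lemma ln_increment {R : realType} (x y : R) : 1 <= x -> x <= y -> y <= x + 1 ->
  (y - x) / x <= 2 * (ln y - ln x).
Proof.
move=> x1 xy yx; have x0 : 0 < x by lra. have y0 : 0 < y by lra.
have h : 1 - x / y <= ln y - ln x.
  have : ln (1 + (x / y - 1)) <= x / y - 1.
    by apply: le_ln1Dx; have := divr_gt0 x0 y0; lra.
  by rewrite addrC subrK ln_div ?posrE//; lra.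
apply: le_trans (ler_wpM2l (ler0n _ 2) h).
have -> : 1 - x / y = (y - x) / y by field; rewrite gt_eqF.
rewrite mulrCA ler_wpM2l ?subr_ge0//.
by rewrite ler_pdivlMr// mulrC ler_pdivrMr//; lra.
Qed.

(** * A second moment inequality without integrals *)

Section SecondMoment.
Context {R : realType} (Q : probability paths R) (A : nat -> set paths) (w : nat -> R).
Local Notation pr := (pr Q).
Hypothesis mA : forall n, measurable (A n).

(* The expectation of [1_G (c + \sum_(i < n) w i 1_(A i))^2], expanded. *)
Lemma pr_square_ge0 n (G : set paths) (c : R) : measurable G ->
  0 <= c ^+ 2 * pr G + 2 * c * \sum_(i < n) w i * pr (G `&` A i) +
    \sum_(i < n) (w i ^+ 2 * pr (G `&` A i) +
      2 * \sum_(j < i) w i * w j * pr (G `&` A i `&` A j)).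
Proof.
elim: n G c => [|n IH] G c mG.
  by rewrite !big_ord0 mulr0 !addr0 mulr_ge0 ?sqr_ge0 ?pr_ge0.
have mGA : measurable (G `&` A n) by exact: measurableI.
have mGnA : measurable (G `&` ~` A n) by apply: measurableI => //; exact: measurableC.
(* On [A n] the last summand joins the constant, off [A n] it disappears. *)
have := addr_ge0 (IH _ (c + w n) mGA) (IH _ c mGnA).
rewrite !big_ord_recr/= (pr_split Q mG (mA n)).
have e1 i : pr (G `&` A i) = pr (G `&` A n `&` A i) + pr (G `&` ~` A n `&` A i).
  rewrite (pr_split Q _ (mA n)); last exact: measurableI.
  by congr (_ + _); congr pr; rewrite setIAC.
have e2 i j : pr (G `&` A i `&` A j) =
    pr (G `&` A n `&` A i `&` A j) + pr (G `&` ~` A n `&` A i `&` A j).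
  rewrite (pr_split Q _ (mA n)); last by apply: measurableI => //; exact: measurableI.
  by congr (_ + _); congr pr; rewrite setIAC (setIAC G).
set a := pr (G `&` A n); set b := pr (G `&` ~` A n).
set s1 := \sum_(i < n) w i * pr (G `&` A n `&` A i).
set s2 := \sum_(i < n) w i * pr (G `&` ~` A n `&` A i).
set t1 := \sum_(i < n) (w i ^+ 2 * pr (G `&` A n `&` A i) + _).
set t2 := \sum_(i < n) (w i ^+ 2 * pr (G `&` ~` A n `&` A i) + _).
have -> : \sum_(i < n) w i * pr (G `&` A i) = s1 + s2.
  by rewrite -big_split/=; apply: eq_bigr => i _; rewrite e1 mulrDr.
have -> : \sum_(i < n) (w i ^+ 2 * pr (G `&` A i) +
    2 * \sum_(j < i) w i * w j * pr (G `&` A i `&` A j)) = t1 + t2.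
  rewrite -big_split/=; apply: eq_bigr => i _; rewrite e1.
  rewrite (eq_bigr (fun j : 'I_i => w i * w j * pr (G `&` A n `&` A i `&` A j) +
    w i * w j * pr (G `&` ~` A n `&` A i `&` A j))); last first.
    by move=> j _; rewrite e2 mulrDr.
  by rewrite big_split/=; ring.
have -> : \sum_(j < n) w n * w j * pr (G `&` A n `&` A j) = w n * s1.
  by rewrite mulr_sumr; apply: eq_bigr => j _; rewrite mulrA.
move=> h; apply: le_trans h _; rewrite le_eqVlt; apply/orP; left; apply/eqP; ring.
Qed.

(** With W the weighted count, this is the expectation of (W - k) ^ 2 >= 0 over [F] and [U], divided
    by 2 k; W vanishes off [U]. The free [k] takes the place of Cauchy-Schwarz. *)
Lemma pr_second_moment (F U : set paths) (k : R) n : measurable F -> measurable U -> 0 < k ->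
  (forall i, w i != 0 -> A i `<=` U) ->
  \sum_(i < n) w i * pr (F `&` A i) <=
    (2 * k)^-1 * \sum_(i < n) (w i ^+ 2 * pr (F `&` A i) +
      2 * \sum_(j < i) w i * w j * pr (F `&` A i `&` A j)) + k / 2 * pr (F `&` U).
Proof.
move=> mF mU k0 AU; have mG : measurable (F `&` U) by exact: measurableI.
have := pr_square_ge0 n (- k) mG.
have e i : w i != 0 -> F `&` U `&` A i = F `&` A i.
  move=> /AU AiU; apply/seteqP; split => z; first by case=> -[].
  by move=> [Fz Az]; split => //; split => //; exact: AiU.
rewrite (eq_bigr (fun i : 'I_n => w i * pr (F `&` A i))); last first.
  by move=> i _; have [->|/e ->//] := eqVneq (w i) 0; rewrite !mul0r.
rewrite [X in _ + X](eq_bigr (fun i : 'I_n => w i ^+ 2 * pr (F `&` A i) +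
    2 * \sum_(j < i) w i * w j * pr (F `&` A i `&` A j))); last first.
  move=> i _; have [->|/e -> //] := eqVneq (w i) 0.
  rewrite expr0n/= !mul0r !big1 ?mulr0// => j _; by rewrite !mul0r.
set s := \sum_(i < n) _; set t := \sum_(i < n) _; set p := pr _ => h.
rewrite -(ler_pM2l (_ : 0 < 2 * k)); last by lra.
rewrite mulrDr mulrA divff ?mul1r; last by rewrite gt_eqF//; lra.
have -> : 2 * k * (k / 2 * p) = k ^+ 2 * p by field.
by rewrite sqrrN in h; lra.
Qed.

End SecondMoment.

Section Recurrence.
Context {R : realType} (Q : probability paths R) (C : nat -> set paths).
Local Notation pr := (pr Q).
Hypothesis mC : forall n, measurable (C n).
Variables (F : set paths) (M : nat) (D : nat -> R) (Dp : nat -> nat -> R).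
Variables (c1 c2 c3 : R).
Hypothesis mF : measurable F.
Hypothesis c1_gt0 : 0 < c1.
Hypothesis c2_gt0 : 0 < c2.
Hypothesis c3_ge0 : 0 <= c3.
Hypothesis ln_ge1 : forall n, (M <= n)%N -> 1 <= ln (n%:R : R).
Hypothesis D_ge1 : forall n, (M <= n)%N -> 1 <= D n.
Hypothesis lnD : forall n, (M <= n)%N -> ln (D n) <= c3 * ln n%:R.
Hypothesis Dp1 : forall m, (M <= m)%N -> Dp m m.+1 = 1.
Hypothesis Dp_incr : forall m n, (M <= m)%N -> (m < n)%N ->
  Dp m n <= Dp m n.+1 <= Dp m n + 1.
Hypothesis Dp_le : forall m n, (M <= m)%N -> (m < n)%N -> Dp m n <= D m.
Hypothesis D_rec : forall m n, (M <= m)%N -> (m < n)%N ->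
  D m <= Dp m n + (Dp m n.+1 - Dp m n) * D n.
Hypothesis C_ge : forall n, (M <= n)%N -> c1 / D n * pr F <= pr (F `&` C n).
Hypothesis C_le : forall n, (M <= n)%N -> pr (F `&` C n) <= c2 / D n * pr F.
Hypothesis C2_le : forall m n, (M <= m)%N -> (m < n)%N ->
  pr (F `&` C m `&` C n) <= c2 / (Dp m n * D n) * pr F.
Hypothesis diverges : forall S : R, exists N,
  S <= \sum_(M <= n < N) (D n)^-1 / ln n%:R.

Let w n : R := if (M <= n)%N then (ln n%:R)^-1 else 0.

Let w_ge0 n : 0 <= w n.
Proof.
by rewrite /w; case: ifP => // /ln_ge1 l1; rewrite invr_ge0; apply: le_trans l1.
Qed.

Let Dp_ge1 m n : (M <= m)%N -> (m < n)%N -> 1 <= Dp m n.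
Proof.
move=> Mm /subnKC <-; elim: (n - m.+1)%N => [|k IH]; first by rewrite addn0 Dp1.
apply: le_trans IH _; rewrite addnS.
by have /andP[] := Dp_incr Mm (leq_addr k m.+1).
Qed.

Lemma sum_log_increments m N : (M <= m)%N -> (m < N)%N ->
  \sum_(m.+1 <= n < N) (Dp m n.+1 - Dp m n) / Dp m n <= 2 * ln (Dp m N).
Proof.
move=> Mm /subnKC <-; elim: (N - m.+1)%N => [|k IH].
  by rewrite addn0 big_geq// Dp1// ln1 mulr0.
rewrite addnS big_nat_recr ?leq_addr//=.
have mk : (m < m.+1 + k)%N by exact: leq_addr.
have /andP[d1 d2] := Dp_incr Mm mk.
have := ln_increment (Dp_ge1 Mm mk) d1 d2; lra.
Qed.

Let weight N := \sum_(i < N) w i / D i.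

Let term_ge0 i : 0 <= w i / D i.
Proof.
rewrite /w; case: ifP => [Mi|_]; last by rewrite mul0r.
rewrite divr_ge0// ?invr_ge0; first by apply: le_trans (ln_ge1 Mi).
by apply: le_trans (D_ge1 Mi).
Qed.

(** [D_rec] splits each term into [w i / D i] and a relative increment of [Dp m]. On the latter
    [w i] is raised to [w m], so the telescoped 2 ln (D m) meets the factor 1 / ln m and leaves
    [2 * c3]. *)
Lemma tail_le m N : (M <= m)%N -> (m < N)%N ->
  \sum_(m.+1 <= i < N) w i / (Dp m i * D i) <= (D m)^-1 * (weight N + 2 * c3).
Proof.
move=> Mm mN; have Dm := D_ge1 Mm; have Dm0 : 0 < D m by lra.
apply: (@le_trans _ _ (\sum_(m.+1 <= i < N)
   ((D m)^-1 * (w i / D i) + (D m)^-1 * (w m * ((Dp m i.+1 - Dp m i) / Dp m i))))).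
  rewrite big_nat_cond [leRHS]big_nat_cond; apply: ler_sum => i /andP[/andP[mi iN] _].
  have Mi : (M <= i)%N by exact: leq_trans Mm (ltnW mi).
  have Di : 0 < D i by have := D_ge1 Mi; lra.
  have Dpi : 0 < Dp m i by have := Dp_ge1 Mm mi; lra.
  have := D_rec Mm mi; have /andP[u0 _] := Dp_incr Mm mi.
  set u := Dp m i.+1 - Dp m i => rec.
  have wim : w i <= w m.
    rewrite /w Mm Mi lef_pV2 ?posrE; last 2 first.
    - by have := ln_ge1 Mi; lra.
    - by have := ln_ge1 Mm; lra.
    have m0 : (0 < m)%N.
      by rewrite lt0n; apply/eqP => m0; have := ln_ge1 Mm; rewrite m0 ln0//; lra.
    by rewrite ler_ln ?posrE ?ltr0n ?ler_nat// ?(ltn_trans m0)// ltnW.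
  apply: (@le_trans _ _ (w i * ((D m)^-1 * ((D i)^-1 + u / Dp m i)))).
    rewrite ler_wpM2l// -(ler_pM2l Dm0) mulrA divff ?mul1r ?gt_eqF//.
    rewrite -(ler_pM2r (mulr_gt0 Dpi Di)) -mulrA mulVf ?mulr1; last first.
      by rewrite gt_eqF// mulr_gt0.
    rewrite (_ : _ * (Dp m i * D i) = Dp m i + u * D i)//.
    by field; rewrite !gt_eqF.
  rewrite mulrCA -mulrDr ler_wpM2l ?invr_ge0 ?(ltW Dm0)// mulrDr lerD2l.
  by rewrite ler_wpM2r// divr_ge0 ?subr_ge0// ltW.
rewrite big_split/= -!mulr_sumr -mulrDr ler_wpM2l ?invr_ge0 ?(ltW Dm0)//.
apply: lerD.
  rewrite /weight -(big_mkord xpredT (fun i => w i / D i)) [leRHS](@big_cat_nat _ _ _ m.+1)//=.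
  by rewrite lerDr sumr_ge0.
have lm := ln_ge1 Mm; have lm0 : 0 < ln (m%:R : R) by lra.
apply: le_trans (ler_wpM2l (w_ge0 m) (sum_log_increments Mm mN)) _.
rewrite /w Mm mulrC ler_pdivrMr//.
have : ln (Dp m N) <= ln (D m).
  rewrite ler_ln ?posrE; first exact: Dp_le.
    by have := Dp_ge1 Mm mN; lra.
  by [].
by have := lnD Mm; lra.
Qed.

(** Cutting the series where its sum [s] has passed 1 gives [s <= s ^+ 2], which absorbs the
    diagonal and the logarithmic excess: 3 + 4 c3 = 1 + 2 (1 + 2 c3). *)
Lemma pr_some_ge : c1 ^+ 2 / (c2 * (3 + 4 * c3)) * pr F <=
  pr (F `&` [set z | exists n, (M <= n)%N /\ C n z]).
Proof.
set U := [set z | _]; have mU : measurable (U : set paths) by rewrite /U; meas.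
have [N] := diverges 1; set s := weight N => le1.
have s1 : 1 <= s.
  apply: le_trans le1 _; rewrite /s /weight -(big_mkord xpredT (fun i => w i / D i)).
  have [MN|NM] := leqP M N; last first.
    rewrite [leLHS]big_geq; last exact: ltnW.
    by apply: sumr_ge0 => i _; exact: term_ge0.
  rewrite [leRHS](@big_cat_nat _ _ _ M)//= -[leLHS]add0r lerD//; first by apply: sumr_ge0 => i _; exact: term_ge0.
  rewrite big_nat_cond [leRHS]big_nat_cond ler_sum// => i /andP[/andP[Mi _] _].
  by rewrite /w Mi mulrC.
have p0 := pr_ge0 Q F; set p := pr F in p0 *.
set C3 := c2 * (3 + 4 * c3); have C30 : 0 < C3 by apply: mulr_gt0 => //; have := c3_ge0; lra.
have s0 : 0 < s := lt_le_trans ltr01 s1.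
(* With this value of the free parameter the quadratic term is at most half of the lower bound
   [c1 * s * p]. *)
have k0 : 0 < C3 * s / c1 by rewrite divr_gt0// mulr_gt0.
have AU i : w i != 0 -> C i `<=` U.
  by rewrite /w; case: ifP => [Mi _ z Cz|]; [exists i|rewrite eqxx].
have := @pr_second_moment _ Q C w mC F U _ N mF mU k0 AU.
have lo : c1 * s * p <= \sum_(i < N) w i * pr (F `&` C i).
  rewrite /s /weight mulr_sumr mulr_suml; apply: ler_sum => i _.
  rewrite /w; case: ifP => [Mi|_]; last by rewrite !mul0r mulr0 mul0r.
  rewrite mulrCA -mulrA ler_wpM2l ?C_ge//.
  by rewrite invr_ge0; apply: le_trans (ln_ge1 Mi).
have hi : \sum_(i < N) (w i ^+ 2 * pr (F `&` C i) +
      2 * \sum_(j < i) w i * w j * pr (F `&` C i `&` C j)) <= C3 * s ^+ 2 * p.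
  rewrite big_split/= -mulr_sumr.
  have d1 : \sum_(i < N) w i ^+ 2 * pr (F `&` C i) <= c2 * s * p.
    rewrite /s /weight mulr_sumr mulr_suml; apply: ler_sum => i _.
    have [Mi|Mi] := leqP M i; last first.
      by rewrite /w leqNgt Mi /= expr0n/= !mul0r mulr0 mul0r.
    have w1 : w i <= 1.
      by rewrite /w Mi invf_le1 ?ln_ge1//; have := ln_ge1 Mi; lra.
    apply: (@le_trans _ _ (w i * (c2 / D i * p))); last by rewrite le_eqVlt; apply/orP; left; apply/eqP; ring.
    rewrite expr2 -mulrA ler_wpM2l//; apply: le_trans (C_le Mi).
    by rewrite ler_piMl// pr_ge0.
  have d2 : \sum_(i < N) \sum_(j < i) w i * w j * pr (F `&` C i `&` C j) <=
      c2 * (s + 2 * c3) * s * p.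
    rewrite (sum_triangle (fun i j => w i * w j * pr (F `&` C i `&` C j))).
    apply: (@le_trans _ _ (\sum_(j < N) w j / D j * (c2 * (s + 2 * c3) * p))); last first.
      by rewrite -mulr_suml -/(weight N) -/s le_eqVlt; apply/orP; left; apply/eqP; ring.
    apply: ler_sum => j _; have [Mj|Mj] := leqP M j; last first.
      rewrite /w (leqNgt M j) Mj /= !mul0r big1// => i _.
      by rewrite mulr0 mul0r.
    apply: (@le_trans _ _ (\sum_(j.+1 <= i < N) w j * (c2 * p) * (w i / (Dp j i * D i)))).
      rewrite big_nat_cond [leRHS]big_nat_cond; apply: ler_sum => i /andP[/andP[ji _] _].
      apply: (@le_trans _ _ (w i * w j * (c2 / (Dp j i * D i) * p))).
        rewrite ler_wpM2l ?mulr_ge0//; rewrite setIAC; exact: C2_le.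
      by rewrite le_eqVlt; apply/orP; left; apply/eqP; ring.
    rewrite -mulr_sumr; apply: (@le_trans _ _ (w j * (c2 * p) * ((D j)^-1 * (s + 2 * c3)))).
      rewrite ler_wpM2l//; last exact: tail_le.
      by rewrite !mulr_ge0// ltW.
    by rewrite le_eqVlt; apply/orP; left; apply/eqP; ring.
  have ss : c2 * p * s <= c2 * p * s ^+ 2.
    by rewrite ler_wpM2l ?mulr_ge0 ?(ltW c2_gt0)// expr2 ler_peMl// ltW.
  have ss' : c3 * (c2 * p * s) <= c3 * (c2 * p * s ^+ 2) by rewrite ler_wpM2l.
  rewrite /C3; have := d1; have := d2; move: ss ss'; rewrite !expr2.
  by move=> *; lra.
set P := pr (F `&` U); set sw := \sum_(i < N) _ in lo *.
set T := \sum_(i < N) _ in hi * => main.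
have hi2 : (2 * (C3 * s / c1))^-1 * T <= c1 * s * p / 2.
  apply: le_trans (ler_wpM2l _ hi) _; first by rewrite invr_ge0 mulr_ge0// ltW.
  by rewrite le_eqVlt; apply/orP; left; apply/eqP; field; rewrite !gt_eqF.
have fin : c1 * s * p / 2 <= C3 * s / c1 / 2 * P by lra.
have e : c1 ^+ 2 / C3 * p = (2 * c1 / (C3 * s)) * (c1 * s * p / 2).
  by field; rewrite !gt_eqF.
rewrite e; have l0 : 0 <= 2 * c1 / (C3 * s).
  by apply: divr_ge0; apply: mulr_ge0; rewrite ?ltW.
apply: le_trans (ler_wpM2l l0 fin) _.
by rewrite le_eqVlt; apply/orP; left; apply/eqP; field; rewrite !gt_eqF.
Qed.

End Recurrence.

Section CutpointSeries.
Context {R : realType} (isX : bool) (q p1 p2 : nat -> R).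
Hypothesis Hq : forall k, (2 <= k)%N ->
  0 < q k /\ 0 <= p1 k /\ 0 < p2 k /\ q k + p1 k + p2 k = 1.
Local Notation tr := (walk isX q p1 p2).
Local Notation cut := (is_cutpoint isX).
Context (r : nat -> R) (n1 : nat).
Hypothesis n12 : (2 <= n1)%N.
Hypothesis r01 : forall k, (n1 <= k)%N -> 2^-1 <= r k <= 1.
Hypothesis r_nd : forall k, (n1 <= k)%N -> r k <= r k.+1.
Hypothesis r_char : forall k, (n1 <= k)%N ->
  if isX then q k * r k ^+ 2 = (p1 k + p2 k) * r k + p2 k
  else q k = (p1 k + p2 k) * r k + p2 k * r k ^+ 2.
Variable eps : R.
Hypothesis eps01 : 0 < eps <= 1.
Hypothesis eps_le : forall k, (n1 <= k)%N -> eps <= q k /\ (~~ isX -> eps <= p2 k).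
Local Notation Dpart := (Dpart r).
Context (Q : probability paths R) (x0 : nat) (QZ : markov_paths Q x0 tr).
Local Notation pr := (pr Q).
Let tr_ge0 := walk_ge0 isX Hq.
Let tr_sum := walk_sum1 isX Hq.

Lemma finitely_many_cuts (u : nat -> R) (S : R) n0 : (forall n, 0 <= u n) ->
  (forall n, (n0 <= n)%N -> pr (cut n) <= u n) ->
  (forall N, \sum_(2 <= n < N) u n / ln n%:R <= S) ->
  exists N : set paths, measurable N /\ Q N = 0%E /\
    forall z, ~ N z -> finite_set [set k | cut k z].
Proof.
move=> u0 cu uS; have /andP[e0 _] := eps01.
apply: (@finitely_many _ Q cut (@measurable_cut isX) (eps ^+ 6)
  (n0 + (n1 + 3) + (x0 + 3)) u S) => //.
- exact: exprn_gt0.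
- move=> n m L nn nm; apply: (pr_cut_last_ge Hq n12 r01 r_nd r_char eps01 eps_le QZ) => //.
    by clear -nn; lia.
  by clear -nn; lia.
- by move=> n nn; apply: cu; clear -nn; lia.
Qed.

(** All terms from index [n] on share the product of the ratios from [m + 1] to [n], which is the
    increment of [Dpart m] at [n]; what remains of them sums to [Dpart n N]. *)
Lemma Dpart_rec m n N : (n1 <= m)%N -> (m < n)%N -> (n <= N)%N ->
  Dpart m N = Dpart m n + (Dpart m n.+1 - Dpart m n) * Dpart n N.
Proof.
move=> nm mn nN; have nn := leq_trans nm (ltnW mn).
have c0 := cprod_gt0 r01 m.+1.
rewrite (DpartS r (ltnW mn)) addrAC subrr add0r.
apply: (mulfI (_ : cprod r n1 m.+1 != 0)); first by rewrite gt_eqF.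
rewrite mulrDr mulrA (DpartE r nm (ltnW mn)) (DpartE r nm (leq_trans (ltnW mn) nN)).
have -> : cprod r n1 m.+1 * \prod_(m.+1 <= i < n.+1) r i = cprod r n1 n.+1.
  by rewrite /cprod -big_cat_nat//=; [exact: leqW|exact: leqW].
by rewrite (DpartE r nn nN); ring.
Qed.

Variables (D : nat -> R) (n2 : nat) (c3 : R).
Hypothesis c3_ge0 : 0 <= c3.
Hypothesis Dpart_le : forall n N, (n2 <= n)%N -> (n < N)%N -> Dpart n N <= D n.
Hypothesis D_le : forall n (c : R), (n2 <= n)%N ->
  (forall N, (n < N)%N -> Dpart n N <= c) -> D n <= c.
Hypothesis lnD : forall n, (n2 <= n)%N -> ln (D n) <= c3 * ln n%:R.
Hypothesis diverges : forall M (S : R), (2 <= M)%N -> exists N,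
  S <= \sum_(M <= n < N) (D n)^-1 / ln n%:R.

Let D_ge1 n : (n2 <= n)%N -> 1 <= D n.
Proof.
move=> nn; apply: le_trans (Dpart_le nn (ltnSn n)).
by rewrite Dpart1.
Qed.

Let mul_D_le n (a b : R) : (n2 <= n)%N -> 0 <= a -> 0 <= b ->
  (forall N, (n < N)%N -> a * Dpart n N <= b) -> a * D n <= b.
Proof.
move=> nn; rewrite le_eqVlt => /orP[/eqP <- b0 _|a0 b0 H]; first by rewrite mul0r.
rewrite mulrC -ler_pdivlMr//; apply: D_le => // N nN.
by rewrite ler_pdivlMr// mulrC; exact: H.
Qed.

(** The constant of [pr_some_ge] for [c1 = eps ^+ 3 / 2] and [c2 = 9]. *)
Let c5 : R := (eps ^+ 3 / 2) ^+ 2 / (9 * (3 + 4 * c3)).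

Lemma pr_some_cut_ge t (F : set paths) x B M0 : past t F -> F `<=` [set z | z t = x] ->
  F `<=` [set z | forall k, (k <= t)%N -> (z k <= B)%N] ->
  c5 * pr F <= pr (F `&` [set z | exists n, (M0 <= n)%N /\ cut n z]).
Proof.
move=> pF Fx FB; have mF := past_measurable pF; have /andP[e0 _] := eps01.
(* Beyond every site visited so far and every threshold; the final 4 makes ln n >= 1. The constant
   [c5] does not depend on this choice. *)
pose M := (M0 + n2 + (n1 + 3) + (x + 3) + B.+1 + 4)%N.
have [M1 [M2 [M3 [M4 [M5 M6]]]]] : (M0 <= M /\ n2 <= M /\ n1 + 3 <= M /\ x + 3 <= M /\
  B < M /\ 4 <= M)%N by rewrite /M; clear; lia.
have Flt n : (M <= n)%N -> F `<=` [set z | forall k, (k <= t)%N -> (z k < n)%N].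
  by move=> Mn z /FB zB k /zB /leq_ltn_trans; apply; exact: leq_trans M5 Mn.
have n1M n : (M <= n)%N -> (n1 < n)%N by clear -M3; lia.
have D0 n : (M <= n)%N -> 0 < D n.
  by move=> Mn; apply: lt_le_trans (D_ge1 (leq_trans M2 Mn)).
apply: (@le_trans _ _ (pr (F `&` [set z | exists n, (M <= n)%N /\ cut n z]))); last first.
  apply: pr_le.
  - by apply: measurableI => //; meas; exact: measurable_cut.
  - by apply: measurableI => //; meas; exact: measurable_cut.
  - by move=> z [Fz [n [Mn cn]]]; split => //; exists n; split => //; exact: leq_trans Mn.
apply: (@pr_some_ge _ Q cut (@measurable_cut isX) F M D Dpart (eps ^+ 3 / 2) 9 c3) => //.
- by rewrite divr_gt0// exprn_gt0.
- move=> n Mn; have n4 : (4 <= n)%N by exact: leq_trans Mn.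
  have l2 : 2^-1 <= ln (2 : R).
    have := @le_ln1Dx R (- 2^-1) ltac:(lra).
    rewrite (_ : 1 + - 2^-1 = 2^-1); last by lra.
    by rewrite lnV ?posrE//; lra.
  apply: (@le_trans _ _ (ln (4 : R))).
    rewrite (_ : 4 = 2 ^+ 2 :> R); last by rewrite -natrX.
    by rewrite lnXn// mulr2n; lra.
  by rewrite ler_ln ?posrE// ?ler_nat// ltr0n; exact: leq_trans n4.
- by move=> n Mn; apply: D_ge1; exact: leq_trans Mn.
- by move=> n Mn; apply: lnD; exact: leq_trans Mn.
- by move=> m _; exact: Dpart1.
- move=> m n Mm mn; rewrite (DpartS r (ltnW mn)) lerDl lerD2l.
  by rewrite (Dpart_prod_ge0 r01 _ (ltnW (n1M _ Mm))) (Dpart_prod_le1 r01 _ (ltnW (n1M _ Mm))).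
- by move=> m n Mm mn; apply: Dpart_le => //; exact: leq_trans Mm.
- move=> m n Mm mn; have Mn := leq_trans Mm (ltnW mn).
  have nm := ltnW (n1M _ Mm).
  apply: D_le; first exact: leq_trans Mm.
  have u0 : 0 <= Dpart m n.+1 - Dpart m n.
    by rewrite (DpartS r (ltnW mn)) addrAC subrr add0r; exact: (Dpart_prod_ge0 r01).
  move=> N mN; have [Nn|nN] := leqP N n.
    apply: (@le_trans _ _ (Dpart m n)); first exact: (Dpart_nd r01 nm (ltnW mN)).
    by rewrite lerDl mulr_ge0// ltW// D0.
  rewrite (Dpart_rec nm mn (ltnW nN)) lerD2l ler_wpM2l//.
  by apply: Dpart_le => //; exact: leq_trans Mn.
- move=> n Mn; have -> : eps ^+ 3 / 2 / D n = eps ^+ 3 / (2 * D n) by rewrite invfM mulrA.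
  apply: (pr_cut_ge Hq n12 r01 r_nd r_char eps01 eps_le QZ pF Fx (Flt _ Mn)).
  + exact: leq_trans Mn.
  + exact: leq_trans Mn.
  + exact: D0.
  + by move=> N nN; apply: Dpart_le => //; exact: leq_trans Mn.
- move=> n Mn; rewrite mulrAC ler_pdivlMr ?D0//.
  apply: mul_D_le; rewrite ?mulr_ge0 ?pr_ge0//; first exact: leq_trans Mn.
  move=> N nN; apply: le_trans (pr_cut_le Hq n12 r01 r_nd r_char QZ pF (n1M _ Mn) nN (Flt _ Mn)) _.
  by rewrite ler_wpM2r ?pr_ge0// ler_nat.
- move=> m n Mm mn; have Mn := leq_trans Mm (ltnW mn).
  have Dm0 : 0 < Dpart m n by apply: lt_le_trans (Dpart_ge1 r01 (ltnW (n1M _ Mm)) mn).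
  rewrite mulrAC ler_pdivlMr; last by rewrite mulr_gt0// D0.
  rewrite mulrA; apply: mul_D_le; rewrite ?mulr_ge0 ?pr_ge0 ?(ltW Dm0)//.
    exact: leq_trans Mn.
  move=> N nN; rewrite -mulrA.
  exact: (pr_cut2_le Hq n12 r01 r_nd r_char eps01 QZ pF (n1M _ Mm) mn nN (Flt _ Mm)).
- by move=> S; apply: diverges; exact: leq_trans M6.
Qed.

(** Splitting [F] into histories fixes the present state and bounds the visited sites; [c5] is the
    same for all pieces, so they add up. *)
Lemma pr_some_cut_ge_past t (F : set paths) M0 : past t F ->
  c5 * pr F <= pr (F `&` [set z | exists n, (M0 <= n)%N /\ cut n z]).
Proof.
move=> pF; have mF := past_measurable pF; have /andP[e0 _] := eps01.
set U := [set z | _]; have mU : measurable (U : set paths) by rewrite /U; meas; exact: measurable_cut.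
have c50 : 0 <= c5.
  by rewrite /c5 divr_ge0 ?sqr_ge0// mulr_ge0//; have := c3_ge0; lra.
pose E := history t; have EU : \bigcup_k E k = setT := bigcup_history t.
have pE k : past t (E k) := @past_history t k.
have mE k : measurable (E k) by exact: past_measurable (pE k).
have tE : trivIset setT E := @trivIset_history t.
have mFU : measurable (F `&` U) by exact: measurableI.
have := @pr_bigcup_ge _ Q E (F `&` U) F c5 c50 mE tE mFU mF.
rewrite EU !setIT; apply => k.
have [[z0 [Fz0 Ek]]|/forallNP noz] := pselect (exists z, F z /\ E k z); last first.
  rewrite [F `&` E k](_ : _ = set0) ?pr_set0 ?mulr0 ?pr_ge0//.
  by apply/seteqP; split => z // /noz.
have same z : E k z -> forall i, (i <= t)%N -> z i = z0 i by move/(eq_history z Ek).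
(* The sum of the visited sites is a convenient upper bound for each of them. *)
rewrite setIAC; apply: (@pr_some_cut_ge t _ (z0 t) (\sum_(i < t.+1) z0 i)).
- exact: pastI.
- by move=> z [_ /same/(_ _ (leqnn t))].
- move=> z [_ /same zz0] i it; rewrite zz0//.
  by rewrite (bigD1 (Ordinal (_ : i < t.+1)%N))//= leq_addr.
Qed.

Lemma infinitely_many_cuts : exists N : set paths, measurable N /\ Q N = 0%E /\
  forall z, ~ N z -> infinite_set [set k | cut k z].
Proof.
have /andP[e0 _] := eps01.
have c50 : 0 < c5.
  rewrite /c5 divr_gt0 ?exprn_gt0 ?divr_gt0 ?exprn_gt0//.
  by apply: mulr_gt0 => //; have := c3_ge0; lra.
pose H M := [set z | forall n, (M <= n)%N -> ~ cut n z] : set paths.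
have mH M : measurable (H M) by rewrite /H; meas; exact: measurable_cut.
have H0 M : pr (H M) = 0.
  apply: (pr_eq0_of_past (mH M) c50) => t F pF.
  rewrite setDE (_ : ~` H M = [set z | exists n, (M <= n)%N /\ cut n z]).
    exact: pr_some_cut_ge_past pF.
  apply/seteqP; split => z.
    by move=> /existsNP[n /not_implyP[Mn /contrapT cn]]; exists n.
  by move=> [n [Mn cn]] /(_ n Mn).
exists (\bigcup_M H M); split; last split.
- exact: bigcupT_measurable.
- rewrite prE; last exact: bigcupT_measurable.
  by rewrite pr_bigcup_null.
move=> z nz /finite_setP[m]; rewrite /= => fin.
have : finite_set [set k | cut k z] by exists m.
move=> /finite_fsetP[X XE]; apply: nz; exists (\sum_(i <- finmap.enum_fset X) i).+1 => // n Xn cn.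
have nX : n \in finmap.enum_fset X.
  have : [set k | cut k z] n by [].
  by rewrite XE.
by move: Xn; rewrite (big_rem n)//= ltnNge leq_addr.
Qed.

End CutpointSeries.

(** * The series D and the asymptotic regime *)

Definition Dseries {R : realType} (r : nat -> R) (n : nat) : \bar R :=
  (1%:E + \sum_(n.+1 <= j <oo) (\prod_(n.+1 <= i < j.+1) r i)%:E)%E.

Section DSeries.
Context {R : realType} (r : nat -> R).
Hypothesis r_ge0 : forall k, (2 <= k)%N -> 0 <= r k.

Let prod_ge0 n j : (2 <= n)%N -> 0 <= \prod_(n.+1 <= i < j.+1) r i.
Proof.
move=> n2; rewrite big_nat_cond; apply: prodr_ge0 => i /andP[/andP[ni _] _].
by apply: r_ge0; exact: leq_trans n2 (ltnW ni).
Qed.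

Let DpartE1 n N : (n < N)%N ->
  ((Dpart r n N)%:E = 1%:E + \sum_(n.+1 <= j < N) (\prod_(n.+1 <= i < j.+1) r i)%:E)%E.
Proof. by move=> nN; rewrite /Dpart big_ltn// big_geq// EFinD sumEFin. Qed.

Lemma Dpart_le_Dseries n N : (2 <= n)%N -> (n < N)%N ->
  ((Dpart r n N)%:E <= Dseries r n)%E.
Proof.
move=> n2 nN; rewrite DpartE1// leeD2l// nneseries_lim_ge// => j _ _.
by rewrite lee_fin prod_ge0.
Qed.

Lemma Dseries_le n (c : R) : (2 <= n)%N -> (forall N, (n < N)%N -> Dpart r n N <= c) ->
  (Dseries r n <= c%:E)%E.
Proof.
move=> n2 H; rewrite (_ : c%:E = 1%:E + (c - 1)%:E)%E; last by rewrite -EFinD addrC subrK.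
rewrite leeD2l//; apply: lime_le.
  by apply: is_cvg_nneseries => j _ _; rewrite lee_fin prod_ge0.
apply: nearW => N; have [nN|Nn] := ltnP n N.
  by have := H _ nN; rewrite -lee_fin DpartE1// sumEFin -EFinD !lee_fin; lra.
rewrite big_geq; last exact: leqW.
by have := H _ (ltnSn n); rewrite Dpart1 lee_fin; lra.
Qed.

Lemma Dseries_ge1 n : (2 <= n)%N -> (1%:E <= Dseries r n)%E.
Proof. by move=> n2; rewrite -(Dpart1 r n); exact: Dpart_le_Dseries. Qed.

(** At infinity [fine] returns 0 and the inverse of 0 is 0, in agreement with 1 / oo = 0. *)
Lemma einvE (x : \bar R) : einv x = (fine x)^-1.
Proof. by case: x => //=; rewrite invr0. Qed.

Lemma einv_Dseries_ge0 n : (2 <= n)%N -> 0 <= einv (Dseries r n).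
Proof.
move=> n2; rewrite einvE invr_ge0 fine_ge0//.
by apply: le_trans (Dseries_ge1 n2); rewrite lee_fin.
Qed.

Let term_ge0 n : (2 <= n)%N -> 0 <= einv (Dseries r n) / ln n%:R.
Proof.
move=> n2; rewrite divr_ge0 ?einv_Dseries_ge0// ln_ge0// ler1n.
exact: leq_trans n2.
Qed.

Lemma Dseries_sum_lty : (\sum_(2 <= n <oo) (einv (Dseries r n) / ln n%:R)%:E < +oo)%E ->
  exists S : R, forall N, \sum_(2 <= n < N) einv (Dseries r n) / ln n%:R <= S.
Proof.
move=> lt; set s := (\sum_(2 <= n <oo) _)%E in lt.
have s0 : (0 <= s)%E by apply: nneseries_ge0 => n n2 _; rewrite lee_fin term_ge0.
exists (fine s) => N; rewrite -lee_fin fineK ?ge0_fin_numE// -sumEFin.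
by apply: nneseries_lim_ge => n n2 _; rewrite lee_fin term_ge0.
Qed.

Lemma Dseries_sum_pinfty : (\sum_(2 <= n <oo) (einv (Dseries r n) / ln n%:R)%:E = +oo)%E ->
  forall M (S : R), (2 <= M)%N -> exists N,
    S <= \sum_(M <= n < N) einv (Dseries r n) / ln n%:R.
Proof.
move=> eq M S M2; apply: contrapT => /forallNP H.
suff : (\sum_(2 <= n <oo) (einv (Dseries r n) / ln n%:R)%:E <=
    (\sum_(2 <= n < M) einv (Dseries r n) / ln n%:R + `|S|)%:E)%E.
  by rewrite eq leNgt ltry.
apply: lime_le.
  by apply: is_cvg_nneseries => j j2 _; rewrite lee_fin term_ge0.
apply: nearW => N; rewrite sumEFin lee_fin; have [MN|NM] := leqP M N.
  rewrite (@big_cat_nat _ _ _ M)//= lerD2l.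
  have /negP := H N; rewrite -ltNge => /ltW/le_trans; apply; exact: ler_norm.
apply: (@le_trans _ _ (\sum_(2 <= n < M) einv (Dseries r n) / ln n%:R)); last by rewrite lerDl.
have [N2|N2] := leqP 2 N; last first.
  rewrite big_geq; last exact: ltnW.
  rewrite big_nat_cond; apply: sumr_ge0 => n /andP[/andP[n2 _] _]; exact: term_ge0.
rewrite [leRHS](@big_cat_nat _ _ _ N)//=; last exact: ltnW.
rewrite lerDl big_nat_cond; apply: sumr_ge0 => n /andP[/andP[Nn _] _].
by apply: term_ge0; exact: leq_trans Nn.
Qed.

End DSeries.

Section Constants.
Context {R : realType} (isX : bool) (q p1 p2 : nat -> R) (a b : R) (N0 : nat).
Hypothesis Hq : forall k, (2 <= k)%N ->
  0 < q k /\ 0 <= p1 k /\ 0 < p2 k /\ q k + p1 k + p2 k = 1.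
Hypothesis ak_a : ak q p1 p2 @ \oo --> a.
Hypothesis bk_b : bk q p2 @ \oo --> b.
Hypothesis a_gt0 : 0 < a.
Hypothesis b_gt0 : 0 < b.
Hypothesis ab1 : a + b = 1.
Local Notation rho := (rho q p1 p2).
Hypothesis rho_mono : forall k m, (N0 <= k)%N -> (k <= m)%N ->
  if isX then rho k <= rho m else rho m <= rho k.

Definition ratio (k : nat) : R := if isX then rho k else (rho k)^-1.

Lemma ak_bk_gt0 k : (2 <= k)%N -> 0 < ak q p1 p2 k /\ 0 < bk q p2 k.
Proof.
move=> /Hq[q0 [p10 [p20 _]]]; split; first by apply: divr_gt0 => //; lra.
exact: divr_gt0.
Qed.

Lemma rho_gt0 k : (2 <= k)%N -> 0 < rho k.
Proof.
move=> /ak_bk_gt0[a0 b0]; rewrite divr_gt0//.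
by apply: ltr_wpDr => //; exact: sqrtr_ge0.
Qed.

Lemma rho_char k : (2 <= k)%N -> rho k ^+ 2 = ak q p1 p2 k * rho k + bk q p2 k.
Proof.
move=> /ak_bk_gt0[a0 b0]; rewrite /Defs.rho.
set s := Num.sqrt _; have s2 : s ^+ 2 = ak q p1 p2 k ^+ 2 + 4 * bk q p2 k.
  by rewrite sqr_sqrtr// addr_ge0 ?sqr_ge0// mulr_ge0// ltW.
by field: s2.
Qed.

Lemma walk_constants : exists n1 (eps : R), (2 <= n1)%N /\ 0 < eps <= 1 /\
  (forall k, (n1 <= k)%N -> eps <= q k /\ (~~ isX -> eps <= p2 k)) /\
  (forall k, (n1 <= k)%N -> 2^-1 <= ratio k <= 1) /\
  (forall k, (n1 <= k)%N -> ratio k <= ratio k.+1) /\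
  (forall k, (n1 <= k)%N ->
    if isX then q k * ratio k ^+ 2 = (p1 k + p2 k) * ratio k + p2 k
    else q k = (p1 k + p2 k) * ratio k + p2 k * ratio k ^+ 2).
Proof.
have pa := a_gt0; have pb := b_gt0; have ab := ab1.
have near_ab (e : R) : 0 < e -> exists N, forall k, (N <= k)%N ->
    `|a - ak q p1 p2 k| < e /\ `|b - bk q p2 k| < e.
  move=> e0; have /cvgrPdist_lt/(_ e e0)[A _ HA] := ak_a.
  have /cvgrPdist_lt/(_ e e0)[B _ HB] := bk_b.
  exists (maxn A B) => k; rewrite geq_max => /andP[Ak Bk].
  by split; [exact: HA|exact: HB].
(* This tolerance keeps b_k above b / 2 and a_k + b_k within b / 2 < 1 / 2 of 1. *)
have b2 : 0 < b / 4 by lra.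
have [N1 HN1] := near_ab _ b2; pose n1 := (N0 + N1 + 2)%N.
have n1N k : (n1 <= k)%N -> (N0 <= k)%N /\ (N1 <= k)%N /\ (2 <= k)%N by rewrite /n1; lia.
have abk k : (n1 <= k)%N -> 0 < ak q p1 p2 k /\ b / 2 < bk q p2 k /\ ak q p1 p2 k < 3 / 2 /\
    2^-1 < ak q p1 p2 k + bk q p2 k < 3 / 2.
  move=> /n1N[_ [kN /ak_bk_gt0[a0 _]]]; have [] := HN1 k kN.
  rewrite !ltr_norml => /andP[h1 h2] /andP[h3 h4]; lra.
(* If [rho k > 1] for X, monotonicity keeps [rho m >= rho k] for all later [m], while the quadratic
   equation then gives rho_m <= a_m + b_m, which tends to 1. For Y all inequalities are reversed. *)
have rho1 k : (n1 <= k)%N -> if isX then rho k <= 1 else 1 <= rho k.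
  move=> nk; have [kN0 _] := n1N _ nk.
  have rr m : (n1 <= m)%N -> 0 < rho m /\ rho m ^+ 2 = ak q p1 p2 m * rho m + bk q p2 m /\
      0 < ak q p1 p2 m /\ 0 < bk q p2 m.
    by move=> /n1N[_ [_ m2]]; have [? ?] := ak_bk_gt0 m2; split; [exact: rho_gt0|split; [exact: rho_char|]].
  have [iX|iX] := boolP isX; rewrite leNgt; apply/negP => rk.
    have e0 : 0 < (rho k - 1) / 2 by lra.
    have [N HN] := near_ab _ e0; pose m := (k + N)%N.
    have km : (k <= m)%N by exact: leq_addr.
    have := rho_mono kN0 km; rewrite iX => rkm.
    have [] := HN m (leq_addl _ _); rewrite !ltr_norml => /andP[h1 h2] /andP[h3 h4].
    have [r0 [rc [am bm]]] := rr _ (leq_trans nk km).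
    have : rho m ^+ 2 <= (ak q p1 p2 m + bk q p2 m) * rho m by rewrite rc; nra.
    rewrite expr2 ler_pM2r//; lra.
  have e0 : 0 < (1 - rho k) / 2 by lra.
  have [N HN] := near_ab _ e0; pose m := (k + N)%N.
  have km : (k <= m)%N by exact: leq_addr.
  have := rho_mono kN0 km; rewrite (negbTE iX) => rkm.
  have [] := HN m (leq_addl _ _); rewrite !ltr_norml => /andP[h1 h2] /andP[h3 h4].
  have [r0 [rc [am bm]]] := rr _ (leq_trans nk km).
  have : (ak q p1 p2 m + bk q p2 m) * rho m <= rho m ^+ 2 by rewrite rc; nra.
  rewrite expr2 ler_pM2r//; lra.
have rhoE k : (2 <= k)%N -> q k * rho k ^+ 2 = (p1 k + p2 k) * rho k + p2 k.
  move=> k2; have [q0 _] := Hq k2; rewrite rho_char// /ak /bk; field.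
  by rewrite gt_eqF.
(* From q_k (1 + a_k) = 1 and a_k < 3 / 2 one has q_k >= 1 / 3, hence p_k2 = b_k q_k >= b / 6; and b
   < 1 puts b / 6 below q_k too. *)
exists n1, (b / 6); split; first by rewrite /n1; lia.
split; first by apply/andP; split; lra.
split; last split; last split.
- move=> k nk; have [_ [_ k2]] := n1N _ nk; have [q0 [p10 [p20 s1]]] := Hq k2.
  have [a0 [bb [a3 _]]] := abk _ nk.
  have e1 : ak q p1 p2 k * q k = p1 k + p2 k by rewrite /ak divfK// gt_eqF.
  have e2 : bk q p2 k * q k = p2 k by rewrite /bk divfK// gt_eqF.
  have q3 : 3^-1 <= q k by nra.
  by split => [|_]; [lra|nra].
(* For X, [rho <= 1] in the quadratic equation yields rho_k >= a_k + b_k > 1 / 2; for Y, [rho >= 1]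
   yields rho_k <= a_k + b_k < 3 / 2. *)
- move=> k nk; have := rho1 _ nk; have [_ [_ k2]] := n1N _ nk.
  have r0 := rho_gt0 k2; have rc := rho_char k2.
  have [a0 [bb [a3 /andP[s1 s2]]]] := abk _ nk; rewrite /ratio; case: isX => r1.
    rewrite r1 andbT; have : (ak q p1 p2 k + bk q p2 k) * rho k <= rho k ^+ 2 by rewrite rc; nra.
    by rewrite expr2 ler_pM2r//; lra.
  rewrite invf_le1// r1 andbT lef_pV2 ?posrE//.
  have : rho k ^+ 2 <= (ak q p1 p2 k + bk q p2 k) * rho k by rewrite rc; nra.
  by rewrite expr2 ler_pM2r//; lra.
- move=> k nk; have [kN0 _] := n1N _ nk; have [_ [_ k2]] := n1N _ nk.
  have := rho_mono kN0 (leqnSn k); rewrite /ratio; case: isX => // le.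
  by rewrite lef_pV2 ?posrE// rho_gt0// leqW.
- move=> k nk; have [_ [_ k2]] := n1N _ nk; have r0 := rho_gt0 k2.
  have := rhoE k k2; rewrite /ratio; case: isX => // e.
  apply: (mulIf (_ : rho k ^+ 2 != 0)); first by rewrite gt_eqF// exprn_gt0.
  by rewrite e; field; rewrite gt_eqF.
Qed.

End Constants.

(** * Transfer from the probability space to path space *)

Section PathSpace.
Context {d : measure_display} {T : measurableType d} {R : realType} (P : probability T R).
Context (Z : nat -> T -> nat).
Hypothesis mZ : forall n k, measurable [set w | Z n w = k].

Definition trajectory (w : T) : paths := fun n => Z n w.

(** Within one history, the preimage of a cylinder event is empty or a finite intersection of events
    that fix one [Z i]; there are countably many histories. *)
Lemma measurable_trajectory : measurable_fun setT trajectory.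
Proof.
apply: (@measurability _ _ T paths setT trajectory cylinders) => // _ [B [t pB] <-]; rewrite setTI.
pose E k := trajectory @^-1` history t k.
have mE k : measurable (trajectory @^-1` B `&` E k).
  have [[w [Bw Ek]]|/forallNP no] := pselect (exists w, B (trajectory w) /\ E k w).
    have -> : trajectory @^-1` B `&` E k =
        \bigcap_(i in [set i | (i <= t)%N]) [set w' | Z i w' = Z i w].
      apply/seteqP; split => w'.
        by move=> [_ /(eq_history _ Ek) e] i /= it; exact: e.
      move=> e; have e' : forall i, (i <= t)%N -> Z i w' = Z i w by move=> i it; exact: e.
      split; last exact/(eq_history _ Ek).
      by apply: (pB (trajectory w)) => // i it; rewrite /trajectory e'.
    by apply: bigcap_measurable => [|i _]; [exists 0%N|exact: mZ].
  rewrite (_ : _ `&` _ = set0); first exact: measurable0.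
  by apply/seteqP; split => // w [Bw Ek]; exact: (no w).
rewrite (_ : _ @^-1` _ = \bigcup_k (trajectory @^-1` B `&` E k)).
  exact: bigcupT_measurable.
apply/seteqP; split => w; last by case=> k _ [].
by move=> Bw; exists (pickle (mkseq (trajectory w) t.+1)).
Qed.

HB.instance Definition _ := isMeasurableFun.Build _ _ _ _ trajectory measurable_trajectory.

Definition law : probability paths R := distribution P trajectory.

Lemma law_ae (A : set paths) (B : set (nat -> nat)) : measurable A -> law A = 0%E ->
  (forall z, ~ A z -> B z) -> {ae P, forall w, B (trajectory w)}.
Proof.
move=> mA A0 AB; exists (trajectory @^-1` A); split.
- by rewrite -[X in measurable X]setTI; exact: measurable_trajectory.
- exact: A0.
- by move=> w /= nB; apply: contrapT => nA; apply: nB; exact: AB.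
Qed.

End PathSpace.

Section Dichotomy.
Context {R : realType} (isX : bool) (q p1 p2 : nat -> R) (a b : R) (N0 : nat).
Hypothesis Hq : forall k, (2 <= k)%N ->
  0 < q k /\ 0 <= p1 k /\ 0 < p2 k /\ q k + p1 k + p2 k = 1.
Hypothesis ak_a : ak q p1 p2 @ \oo --> a.
Hypothesis bk_b : bk q p2 @ \oo --> b.
Hypothesis a_gt0 : 0 < a.
Hypothesis b_gt0 : 0 < b.
Hypothesis ab1 : a + b = 1.
Local Notation rho := (rho q p1 p2).
Hypothesis rho_mono : forall k m, (N0 <= k)%N -> (k <= m)%N ->
  if isX then rho k <= rho m else rho m <= rho k.
Context (Q : probability paths R) (x0 : nat) (QZ : markov_paths Q x0 (walk isX q p1 p2)).
Local Notation D := (Dseries (ratio isX q p1 p2)).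
Local Notation cut := (is_cutpoint isX).

Let ratio_ge0 k : (2 <= k)%N -> 0 <= ratio isX q p1 p2 k.
Proof. by move=> /(rho_gt0 Hq)/ltW r0; rewrite /ratio; case: isX; rewrite ?invr_ge0. Qed.

Lemma finite_cuts : (\sum_(2 <= n <oo) (einv (D n) / ln n%:R)%:E < +oo)%E ->
  exists N : set paths, measurable N /\ Q N = 0%E /\
    forall z, ~ N z -> finite_set [set k | cut k z].
Proof.
move=> /(Dseries_sum_lty ratio_ge0)[S HS].
have [n1 [eps [n12 [eps01 [eps_le [r01 [r_nd r_char]]]]]]] :=
  walk_constants Hq ak_a bk_b a_gt0 b_gt0 ab1 rho_mono.
pose n0 := (n1 + x0).+1; pose u n := if (n0 <= n)%N then 3 * einv (D n) else 0 : R.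
have n02 n : (n0 <= n)%N -> (2 <= n)%N by rewrite /n0 => h; apply: leq_trans n12 _; clear -h; lia.
apply: (finitely_many_cuts Hq n12 r01 r_nd r_char eps01 eps_le QZ (u := u) (S := 3 * S) (n0 := n0)).
- by move=> n; rewrite /u; case: ifP => // /n02 n2; rewrite mulr_ge0// einv_Dseries_ge0.
- move=> n n0n; rewrite /u n0n; have n2 := n02 _ n0n.
  have n1n : (n1 < n)%N by clear -n0n; rewrite /n0 in n0n; lia.
  have mC := @measurable_cut isX n.
  have le N : (n < N)%N -> pr Q (cut n) * Dpart (ratio isX q p1 p2) n N <= 3.
    move=> nN; have sub : [set z | z 0%N = x0] `<=` [set z | forall k, (k <= 0)%N -> (z k < n)%N].
      move=> z /= z0 k; rewrite leqn0 => /eqP ->; rewrite z0; clear -n0n; rewrite /n0 in n0n; lia.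
    have := pr_cut_le Hq n12 r01 r_nd r_char QZ (@past_at 0 x0) n1n nN sub.
    rewrite (pr_start QZ) mulr1; apply: le_trans; rewrite ler_wpM2r//.
      by apply: le_trans (Dpart_ge1 r01 (ltnW n1n) nN).
    apply: (pr_start_le Hq QZ) => //; apply: measurableI => //; exact: measurable_eq.
  (* An infinite D(n) makes the cutpoint probability 0, as [einv] then demands; conversely a
     positive probability bounds D(n) by 3 over it, so that D(n) is finite. *)
  have [c0|c0] := leP (pr Q (cut n)) 0.
    by apply: le_trans c0 _; rewrite mulr_ge0// einv_Dseries_ge0.
  have Dle : (D n <= (3 / pr Q (cut n))%:E)%E.
    apply: (Dseries_le ratio_ge0 n2) => N nN.
    by rewrite ler_pdivlMr// mulrC; exact: le.
  have D1 := Dseries_ge1 ratio_ge0 n2; rewrite einvE.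
  have Dfin : D n \is a fin_num.
    by apply: fin_real; rewrite (lt_le_trans _ D1) ?ltNyr// (le_lt_trans Dle)// ltry.
  move: D1 Dle; rewrite -(fineK Dfin) !lee_fin => D1 Dle.
  have f0 : 0 < fine (D n) by exact: lt_le_trans D1.
  by rewrite ler_pdivlMr// mulrC -ler_pdivlMr.
- move=> N; apply: le_trans (ler_wpM2l (ler0n _ 3) (HS N)).
  rewrite mulr_sumr big_nat_cond [leRHS]big_nat_cond.
  apply: ler_sum => n /andP[/andP[n2 _] _]; rewrite /u; case: ifP => _; first by rewrite mulrA.
  rewrite mul0r mulr_ge0// divr_ge0 ?einv_Dseries_ge0// ln_ge0// ler1n.
  exact: leq_trans n2.
Qed.

Lemma infinite_cuts (delta : R) (N : nat) : 0 < delta ->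
  (forall n, (N <= n)%N -> (D n <= (delta * n%:R * ln n%:R)%:E)%E) ->
  (\sum_(2 <= n <oo) (einv (D n) / ln n%:R)%:E = +oo)%E ->
  exists N : set paths, measurable N /\ Q N = 0%E /\
    forall z, ~ N z -> infinite_set [set k | cut k z].
Proof.
move=> d0 Dle sumoo.
have [n1 [eps [n12 [eps01 [eps_le [r01 [r_nd r_char]]]]]]] :=
  walk_constants Hq ak_a bk_b a_gt0 b_gt0 ab1 rho_mono.
pose n2 := (n1 + N + (Num.truncn delta).+1)%N.
have n2P n : (n2 <= n)%N -> (2 <= n)%N /\ (N <= n)%N /\ delta <= n%:R.
  move=> nn; split; last split.
  - by apply: leq_trans n12 _; clear -nn; rewrite /n2 in nn; lia.
  - by clear -nn; rewrite /n2 in nn; lia.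
  - apply/ltW/(lt_le_trans (truncnS_gt _)); rewrite ler_nat.
    exact: leq_trans (leq_addl _ _) nn.
have fin n : (n2 <= n)%N -> D n \is a fin_num.
  move=> /n2P[n2' [Nn _]]; apply: fin_real.
  rewrite (lt_le_trans _ (Dseries_ge1 ratio_ge0 n2')) ?ltNyr//.
  by rewrite (le_lt_trans (Dle _ Nn))// ltry.
apply: (infinitely_many_cuts Hq n12 r01 r_nd r_char eps01 eps_le QZ
  (D := fun n => fine (D n)) (n2 := n2) (c3 := 3)) => //.
- move=> n M nn nM; have [n2' _] := n2P _ nn.
  by rewrite -lee_fin (fineK (fin _ nn)); exact: Dpart_le_Dseries.
- move=> n c nn H; have [n2' _] := n2P _ nn.
  by rewrite -lee_fin (fineK (fin _ nn)); exact: Dseries_le.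
(* Since [delta <= n] and ln n <= n beyond [n2], the growth bound gives D(n) <= n ^ 3; this is the
   origin of [c3 := 3]. *)
- move=> n nn; have [n2' [Nn dn]] := n2P _ nn.
  have D1 := Dseries_ge1 ratio_ge0 n2'; have := Dle _ Nn.
  move: D1; rewrite -(fineK (fin _ nn)) !lee_fin => D1 Dn.
  have n0 : (0 : R) < n%:R by rewrite ltr0n; exact: leq_trans n2'.
  have f0 : 0 < fine (D n) by exact: lt_le_trans D1.
  rewrite [leRHS]mulr_natl -lnXn// ler_ln ?posrE ?exprn_gt0//.
  apply: le_trans Dn _; rewrite !exprS expr0 mulr1 mulrA.
  have l0 : 0 <= ln (n%:R : R) by rewrite ln_ge0// ler1n; exact: leq_trans n2'.
  apply: ler_pM => //; first by rewrite mulr_ge0 ?(ltW d0)// ltW.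
    by rewrite ler_wpM2r// ltW.
  exact/ltW/ln_sublinear.
- move=> M S M2; have [K HK] := Dseries_sum_pinfty ratio_ge0 sumoo S M2.
  by exists K; under eq_bigr do rewrite -einvE.
Qed.

End Dichotomy.

(* isX = true : Z = X (the (2,1) walk);  isX = false : Z = Y (the (1,2) walk) *)
Theorem theorem1 (R : realType) (q p1 p2 : nat -> R)
  (d : measure_display) (T : measurableType d) (P : probability T R)
  (isX : bool) (Z : nat -> T -> nat) (a b : R) (N0 : nat) :
  (forall k, (2 <= k)%N ->
     0 < q k /\ 0 <= p1 k /\ 0 < p2 k /\ q k + p1 k + p2 k = 1) ->
  is_markov_chain P Z 2%N (if isX then transX q p1 p2 else transY q p1 p2) ->
  ak q p1 p2 @ \oo --> a ->
  bk q p2 @ \oo --> b ->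
  0 < a -> 0 < b -> a + b = 1 ->
  (0 < N0)%N ->
  (forall k m, (N0 <= k)%N -> (k <= m)%N ->
     if isX then rho q p1 p2 k <= rho q p1 p2 m
     else rho q p1 p2 m <= rho q p1 p2 k) ->
  let D := if isX then DX q p1 p2 else DY q p1 p2 in
  let cut := if isX then cutpointX Z else cutpointY Z in
  ((\sum_(2 <= n <oo) (einv (D n) / ln n%:R)%:E < +oo)%E ->
     {ae P, forall w, finite_set [set k | cut w k]}) /\
  ((exists delta : R, 0 < delta /\ exists N : nat, forall n, (N <= n)%N ->
       (D n <= (delta * n%:R * ln n%:R)%:E)%E) ->
   (\sum_(2 <= n <oo) (einv (D n) / ln n%:R)%:E = +oo)%E ->
     {ae P, forall w, infinite_set [set k | cut w k]}).
Proof.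
move=> Hq [mZ Zcyl] ak_a bk_b a0 b0 ab _ rho_mono D cut.
have QZ : markov_paths (law P mZ) 2 (walk isX q p1 p2) by move=> n x; exact: Zcyl.
have DE : D = Dseries (ratio isX q p1 p2) by rewrite /D /ratio; case: (isX).
have cutE w : [set k | cut w k] = [set k | is_cutpoint isX k (trajectory Z w)].
  by rewrite /cut; case: (isX).
rewrite DE; split.
  move=> /(finite_cuts Hq ak_a bk_b a0 b0 ab rho_mono QZ)[A [mA [A0 HA]]].
  suff : {ae P, forall w, finite_set [set k | is_cutpoint isX k (trajectory Z w)]}.
    by apply: filterS => w; rewrite cutE.
  exact: (law_ae (B := [set z | finite_set [set k | is_cutpoint isX k z]]) mA A0 HA).
move=> [delta [d0 [N Dle]]] sumoo.
have [A [mA [A0 HA]]] := infinite_cuts Hq ak_a bk_b a0 b0 ab rho_mono QZ d0 Dle sumoo.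
suff : {ae P, forall w, infinite_set [set k | is_cutpoint isX k (trajectory Z w)]}.
  by apply: filterS => w; rewrite cutE.
exact: (law_ae (B := [set z | infinite_set [set k | is_cutpoint isX k z]]) mA A0 HA).
Qed.
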